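(* Let $\nu>0$, $b\ge0$, $a,c\in\mathbb{R}$, $x_0^2:=a^2+4\nu b$, $k_m\ge0$, $\omega_m>0$ fixed; for mesh size $h$ and time step $\Delta t$ let $k_M=\pi/h$, $\omega_M=\pi/\Delta t$, $D=\{(\omega,k):\omega_m\le|\omega|\le\omega_M,\ k_m\le|k|\le k_M\}$. For small $\Delta t$ and $h$, with overlap $L\asymp h$, the Ventcel best approximation problem $\inf_{(p,q)\in\mathbb{C}^2}\sup_{(\omega,k)\in D}|\rho(\omega,k,p,q,L)|$ has a unique solution $(p_1^*(L),q_1^*(L))$ with minimal value $\delta_1^*(L)$, and $$\text{if }\Delta t\asymp h^2:\quad p_1^*(L)\sim p^*_{1,\infty}(L),\quad q_1^*(L)\sim q^*_{1,\infty}(L);$$ $$\text{if }\Delta t\asymp h:\quad p_1^*(L)\sim2^{-1/5}p^*_{1,\infty}(L),\quad q_1^*(L)\sim2^{3/5}q^*_{1,\infty}(L);$$ in both cases $\delta_1^*(L)\sim1-\dfrac{A}{2p_1^*(L)}$. Here $p^*_{1,\infty}(L):=\frac12\sqrt[5]{\frac{\nu A^4}{8L}}$, $q^*_{1,\infty}(L):=4\sqrt[5]{\frac{\nu^2L^3}{2A^2}}$, and $A$ is the constant defined in the context.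
   Context: This concerns the optimized Schwarz waveform relaxation algorithm for $\partial_t u+(a,c)\cdot\nabla u-\nu\Delta u+bu=f$ on $\mathbb{R}^2$, decomposed into $\Omega_1=(-\infty,L)\times\mathbb{R}$ and $\Omega_2=(0,\infty)\times\mathbb{R}$ ($L\ge0$ the overlap), with Ventcel transmission operators $(\nu\nabla-\tfrac{(a,c)^T}{2})\cdot n_i+\tfrac{s}{2}$, $s=p+q(\partial_t+c\partial_y-\nu\Delta_y)$; its convergence factor in Fourier variables $(\omega,k)$ is $$\rho(\omega,k,p,q,L)=\frac{p+q(\nu k^2+i(\omega+ck))-\sqrt{x_0^2+4\nu(\nu k^2+i(\omega+ck))}}{p+q(\nu k^2+i(\omega+ck))+\sqrt{x_0^2+4\nu(\nu k^2+i(\omega+ck))}}\,e^{-\frac{L}{2\nu}\sqrt{x_0^2+4\nu(\nu k^2+i(\omega+ck))}},$$ with $\sqrt{\cdot}$ the branch with positive real part. Define $$\bar k=|c|\frac{\sqrt{(c^2+x_0^2)^2+16\nu^2\omega_m^2}-(c^2+x_0^2)}{8\nu^2\omega_m},\qquad \varphi(k,\xi)=2\sqrt2\sqrt{\sqrt{(x_0^2+4\nu^2k^2)^2+16\nu^2\xi^2}+x_0^2+4\nu^2k^2},$$ and $A=\varphi(\bar k,-\omega_m+|c|\bar k)$ if $k_m\le\bar k$; $A=\varphi(k_m,-\omega_m+|c|k_m)$ if $\bar k\le k_m\le\omega_m/|c|$; $A=\varphi(k_m,0)$ if $k_m\ge\omega_m/|c|$. Standing assumption: either $x_0^2+4\nu^2k_m^2\ne0$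 or $\omega_m\ne0$. Notation: $Q\sim R$ means $Q/R\to1$; $Q\asymp h$ means $Q\sim Ch$ for some constant $C\ne0$ (limits as $h\to0$). *)

(* Defs.v *)
From Stdlib Require Import Reals Lra.
From Coquelicot Require Import Coquelicot.
Open Scope R_scope.

(* Principal square root on C: the branch with nonnegative real part
   (positive real part away from the nonpositive real axis). *)
Definition Csqrt (z : C) : C :=
  let x := Re z in let y := Im z in
  (sqrt ((Cmod z + x) / 2),
   (if Rlt_dec y 0 then -1 else 1) * sqrt ((Cmod z - x) / 2)).

Definition Cexp (z : C) : C :=
  (exp (Re z) * cos (Im z), exp (Re z) * sin (Im z)).

Definition x02 (nu a b : R) : R := a ^ 2 + 4 * nu * b.

Definition zsym (nu c w k : R) : C := (nu * k ^ 2, w + c * k).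

Definition rho (nu a b c : R) (w k : R) (p q : C) (L : R) : C :=
  let z := zsym nu c w k in
  let s := Csqrt (Cplus (RtoC (x02 nu a b)) (Cmult (RtoC (4 * nu)) z)) in
  Cmult (Cdiv (Cminus (Cplus p (Cmult q z)) s) (Cplus (Cplus p (Cmult q z)) s))
        (Cexp (Cmult (RtoC (- L / (2 * nu))) s)).

Definition inD (km wm h dt : R) (w k : R) : Prop :=
  wm <= Rabs w <= PI / dt /\ km <= Rabs k <= PI / h.

Definition supRho (nu a b c km wm h dt L : R) (p q : C) : Rbar :=
  Lub_Rbar (fun r => exists w k, inD km wm h dt w k /\ r = Cmod (rho nu a b c w k p q L)).

Definition unique_best_approx (nu a b c km wm h dt L : R) (p q : C) (d : R) : Prop :=
  supRho nu a b c km wm h dt L p q = Finite d /\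
  (forall p' q' : C, Rbar_le (supRho nu a b c km wm h dt L p q)
                             (supRho nu a b c km wm h dt L p' q')) /\
  (forall p' q' : C, supRho nu a b c km wm h dt L p' q' = supRho nu a b c km wm h dt L p q ->
                     p' = p /\ q' = q).

Definition phi (nu a b : R) (k xi : R) : R :=
  2 * sqrt 2 * sqrt (sqrt ((x02 nu a b + 4 * nu ^ 2 * k ^ 2) ^ 2 + 16 * nu ^ 2 * xi ^ 2)
                     + x02 nu a b + 4 * nu ^ 2 * k ^ 2).

Definition kbar (nu a b c wm : R) : R :=
  Rabs c * (sqrt ((c ^ 2 + x02 nu a b) ^ 2 + 16 * nu ^ 2 * wm ^ 2) - (c ^ 2 + x02 nu a b))
  / (8 * nu ^ 2 * wm).

(* The constant A.  The case "k_m >= w_m/|c|" is written |c| k_m >= w_m,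
   so that for c = 0 (w_m/|c| = +infinity) it never applies. *)
Definition Aconst (nu a b c km wm : R) : R :=
  let kb := kbar nu a b c wm in
  if Rle_dec km kb then phi nu a b kb (- wm + Rabs c * kb)
  else if Rle_dec wm (Rabs c * km) then phi nu a b km 0
  else phi nu a b km (- wm + Rabs c * km).

Definition pinf (nu A L : R) : R := / 2 * Rpower (nu * A ^ 4 / (8 * L)) (/ 5).
Definition qinf (nu A L : R) : R := 4 * Rpower (nu ^ 2 * L ^ 3 / (2 * A ^ 2)) (/ 5).

Definition equiv0 (f g : R -> C) : Prop :=
  filterlim (fun h => Cdiv (f h) (g h)) (at_right 0) (locally (RtoC 1)).

Definition asymp0 (f : R -> R) (n : nat) : Prop :=
  exists C0 : R, C0 <> 0 /\ equiv0 (fun h => RtoC (f h)) (fun h => RtoC (C0 * h ^ n)).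

Definition ventcel_asymptotics (nu a b c km wm : R) (L dt : R -> R) (cp cq : R) : Prop :=
  let A := Aconst nu a b c km wm in
  exists (ps qs : R -> C) (ds : R -> R),
    (exists eps : R, 0 < eps /\ forall h, 0 < h < eps ->
       unique_best_approx nu a b c km wm h (dt h) (L h) (ps h) (qs h) (ds h)) /\
    equiv0 ps (fun h => RtoC (cp * pinf nu A (L h))) /\
    equiv0 qs (fun h => RtoC (cq * qinf nu A (L h))) /\
    equiv0 (fun h => RtoC (ds h)) (fun h => Cminus (RtoC 1) (Cdiv (RtoC A) (Cmult (RtoC 2) (ps h)))).

(* Main.v *)
(* With [f = sqrt (x0^2 + 4 nu z)] the symbol [p + q z] becomes [P = p' + q' f^2], so one has to
   minimize the maximum of [|(P - f) / (P + f)| exp (- L Re f / (2 nu))] over a compact set [K]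
   of the half plane [Re f > 0].

   Existence and uniqueness.  At level [d] the constraint at [f] says that [P] lies in a disc as
   long as [d exp (L Re f / (2 nu)) < 1]; discs are strictly convex, so the midpoint of two
   minimizers is strictly better wherever they differ.  For large [f] the constraint set is the
   exterior of a disc, but there it follows from the convex condition [Re (P conj f) > 0], which
   near-optimal [P] satisfy: positivity of [Re (q' f)] in the extreme directions of [K] is forced
   by the constraints at [|f|] of order [L^(-4/5)] and propagates to larger [f].  As [K] is
   invariant under conjugation, the minimizer is real.

   Asymptotics.  Put [s = L^(1/5)], [p' = x P / s], [q' = y Q s^3].  To leading order
   [- ln |rho|] is [2 Re f / p'] for bounded [f], [2 Re (P / f)] for [|f|] of order [s^-2], and
   [Re (2 / (q' f)) + L Re f / (2 nu)] for [|f|] of order [s^-4].  The minima of the three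
   expressions are balanced exactly at [x = y = 1].  Conversely the test points [Re f = A / 4]
   and [Re f = nu D / s^4] bound [x] and [y] from above by [1 + o(1)], and a test point with
   [|f|^2 = P / (Q s^4)] bounds [x + y] from below by [2 - o(1)].  The two regimes of the time
   step only differ in the largest slope [tau] of [|Im f| / Re f] on [K] for large [f]. *)
Require Import Defs.
From Stdlib Require Import Reals Lra Lia Psatz Classical ClassicalEpsilon.
From Coquelicot Require Import Coquelicot.
Open Scope R_scope.

Lemma bounded_seq_cvg_subseq (x : nat -> R) (B : R) :
  (forall n, Rabs (x n) <= B) ->
  exists (g : nat -> nat) (l : R),
    (forall n, (g n < g (S n))%nat) /\ is_lim_seq (fun n => x (g n)) l.
Proof.
  intros HB.
  destruct (Bolzano_Weierstrass x (fun c => - B <= c <= B) (compact_P3 (- B) B))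
    as [l Hl].
  { intros n. specialize (HB n). apply Rabs_le_between in HB. lra. }
  assert (Hpick : forall k N : nat, { m : nat | (N <= m)%nat /\ Rabs (x m - l) < / (INR k + 1) }).
  { intros k N. apply constructive_indefinite_description.
    assert (Hk : 0 < / (INR k + 1)) by (apply Rinv_0_lt_compat; pose proof (pos_INR k); lra).
    destruct (Hl (fun y => Rabs (y - l) < / (INR k + 1)) N) as [m [Hm1 Hm2]].
    - exists (mkposreal _ Hk). intros y Hy. exact Hy.
    - exists m. split; assumption. }
  set (g := fix g (n : nat) : nat :=
         match n with O => proj1_sig (Hpick O O)
                    | S n' => proj1_sig (Hpick (S n') (S (g n'))) end).
  assert (Hg0 : g O = proj1_sig (Hpick O O)) by reflexivity.
  assert (HgS : forall n, g (S n) = proj1_sig (Hpick (S n) (S (g n)))) by reflexivity.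
  clearbody g. exists g, l. split.
  - intros n. rewrite HgS. pose proof (proj1 (proj2_sig (Hpick (S n) (S (g n))))). lia.
  - assert (Hg : forall n, Rabs (x (g n) - l) < / (INR n + 1)).
    { intros [|n].
      - rewrite Hg0. exact (proj2 (proj2_sig (Hpick O O))).
      - rewrite HgS. exact (proj2 (proj2_sig (Hpick (S n) (S (g n))))). }
    apply is_lim_seq_spec. intros eps.
    destruct (archimed_cor1 eps (cond_pos eps)) as [N [HN HN0]].
    exists N. intros n Hn. eapply Rlt_trans; [apply Hg|].
    eapply Rle_lt_trans; [|exact HN].
    apply Rinv_le_contravar; [apply lt_0_INR; lia|].
    apply le_INR in Hn. lra.
Qed.

Lemma subseq_comp (g g' : nat -> nat) :
  (forall n, (g n < g (S n))%nat) -> (forall n, (g' n < g' (S n))%nat) ->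
  forall n, (g (g' n) < g (g' (S n)))%nat.
Proof.
  intros Hg Hg' n.
  assert (Hmono : forall a b, (a < b)%nat -> (g a < g b)%nat).
  { intros a b Hab. induction Hab; [apply Hg|].
    eapply Nat.lt_trans; [exact IHHab|apply Hg]. }
  apply Hmono, Hg'.
Qed.

Lemma is_lim_seq_strict_subseq (x : nat -> R) (l : Rbar) (g : nat -> nat) :
  (forall n, (g n < g (S n))%nat) -> is_lim_seq x l -> is_lim_seq (fun n => x (g n)) l.
Proof.
  intros Hg Hx. apply (is_lim_seq_subseq x l g); [apply eventually_subseq, Hg|exact Hx].
Qed.

Lemma bounded_seq2_cvg_subseq (x y : nat -> R) (B : R) :
  (forall n, Rabs (x n) <= B) -> (forall n, Rabs (y n) <= B) ->
  exists (g : nat -> nat) (lx ly : R),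
    (forall n, (g n < g (S n))%nat) /\
    is_lim_seq (fun n => x (g n)) lx /\ is_lim_seq (fun n => y (g n)) ly.
Proof.
  intros Hx Hy.
  destruct (bounded_seq_cvg_subseq x B Hx) as [g [lx [Hg Hlx]]].
  destruct (bounded_seq_cvg_subseq (fun n => y (g n)) B) as [g' [ly [Hg' Hly]]].
  { intros n; apply Hy. }
  exists (fun n => g (g' n)), lx, ly. split; [apply subseq_comp; assumption|split; [|exact Hly]].
  exact (is_lim_seq_strict_subseq (fun n => x (g n)) lx g' Hg' Hlx).
Qed.

Lemma bounded_seq4_cvg_subseq (x y z t : nat -> R) (B : R) :
  (forall n, Rabs (x n) <= B) -> (forall n, Rabs (y n) <= B) ->
  (forall n, Rabs (z n) <= B) -> (forall n, Rabs (t n) <= B) ->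
  exists (g : nat -> nat) (lx ly lz lt : R),
    (forall n, (g n < g (S n))%nat) /\
    is_lim_seq (fun n => x (g n)) lx /\ is_lim_seq (fun n => y (g n)) ly /\
    is_lim_seq (fun n => z (g n)) lz /\ is_lim_seq (fun n => t (g n)) lt.
Proof.
  intros Hx Hy Hz Ht.
  destruct (bounded_seq2_cvg_subseq x y B Hx Hy) as [g [lx [ly [Hg [Hlx Hly]]]]].
  destruct (bounded_seq2_cvg_subseq (fun n => z (g n)) (fun n => t (g n)) B)
    as [g' [lz [lt [Hg' [Hlz Hlt]]]]]; [intros n; apply Hz|intros n; apply Ht|].
  exists (fun n => g (g' n)), lx, ly, lz, lt.
  split; [apply subseq_comp; assumption|].
  split; [exact (is_lim_seq_strict_subseq (fun n => x (g n)) lx g' Hg' Hlx)|].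
  split; [exact (is_lim_seq_strict_subseq (fun n => y (g n)) ly g' Hg' Hly)|].
  split; assumption.
Qed.

Lemma seq_choice (A : Type) (Q : nat -> A -> Prop) :
  (forall n, exists a, Q n a) -> exists f : nat -> A, forall n, Q n (f n).
Proof.
  intros H.
  exists (fun n => proj1_sig (constructive_indefinite_description _ (H n))).
  intros n. exact (proj2_sig (constructive_indefinite_description _ (H n))).
Qed.

(** * Best approximation of [f] by [p + q f^2] on a compact set of the right half plane *)

(* The point [(u, v)] stands for the complex number [f = u + i v]; [symX] and [symY]
   are the real and imaginary parts of [p + q f^2]. *)
Definition symX (p q : C) (u v : R) : R :=
  Re p + Re q * (u * u - v * v) - Im q * (2 * u * v).
Definition symY (p q : C) (u v : R) : R :=
  Im p + Re q * (2 * u * v) + Im q * (u * u - v * v).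
Definition numer (p q : C) (u v : R) : R :=
  (symX p q u v - u) * (symX p q u v - u) + (symY p q u v - v) * (symY p q u v - v).
Definition denom (p q : C) (u v : R) : R :=
  (symX p q u v + u) * (symX p q u v + u) + (symY p q u v + v) * (symY p q u v + v).

Definition admissible (K : R -> R -> Prop) (l d : R) (p q : C) : Prop :=
  forall u v, K u v -> numer p q u v <= d * d * exp (l * u) * denom p q u v.

Definition seq_compact (K : R -> R -> Prop) : Prop :=
  forall U V : nat -> R, (forall n, K (U n) (V n)) ->
  exists (g : nat -> nat) (u v : R), (forall n, (g n < g (S n))%nat) /\ K u v /\
    is_lim_seq (fun n => U (g n)) u /\ is_lim_seq (fun n => V (g n)) v.

(* Positive exactly where the constraint of level [d] is violated; convex in [p + q f^2]
   as long as [d^2 exp (l u) < 1]. *)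
Definition excess (l d : R) (p q : C) (u v : R) : R :=
  numer p q u v - d * d * exp (l * u) * denom p q u v.

Definition Cmix (t : R) (p p' : C) : C :=
  ((1 - t) * Re p + t * Re p', (1 - t) * Im p + t * Im p').

Lemma denom_ge0 p q u v : 0 <= denom p q u v.
Proof. apply Rplus_le_le_0_compat; apply Rle_0_sqr. Qed.

Lemma numer_ge0 p q u v : 0 <= numer p q u v.
Proof. apply Rplus_le_le_0_compat; apply Rle_0_sqr. Qed.

Lemma denom_sub_numer p q u v :
  denom p q u v - numer p q u v = 4 * (symX p q u v * u + symY p q u v * v).
Proof. unfold denom, numer; ring. Qed.

Lemma symX_mix t p p' q q' u v :
  symX (Cmix t p p') (Cmix t q q') u v = (1 - t) * symX p q u v + t * symX p' q' u v.
Proof. unfold symX, Cmix; simpl; ring. Qed.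

Lemma symY_mix t p p' q q' u v :
  symY (Cmix t p p') (Cmix t q q') u v = (1 - t) * symY p q u v + t * symY p' q' u v.
Proof. unfold symY, Cmix; simpl; ring. Qed.

Lemma excess_mix l d t p p' q q' u v :
  excess l d (Cmix t p p') (Cmix t q q') u v =
  (1 - t) * excess l d p q u v + t * excess l d p' q' u v
  - t * (1 - t) * (1 - d * d * exp (l * u)) *
    ((symX p q u v - symX p' q' u v) ^ 2 + (symY p q u v - symY p' q' u v) ^ 2).
Proof. unfold excess, numer, denom. rewrite symX_mix, symY_mix. ring. Qed.

Lemma is_lim_seq_exp (x : nat -> R) (a : R) :
  is_lim_seq x a -> is_lim_seq (fun n => exp (x n)) (exp a).
Proof.
  apply is_lim_seq_continuous, derivable_continuous_pt, derivable_pt_exp.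
Qed.

Ltac lim_arith := cbv beta;
  lazymatch goal with
  | |- is_lim_seq (fun n => @?f n + @?g n) (Finite (?a + ?b)) =>
      apply (is_lim_seq_plus' f g a b); lim_arith
  | |- is_lim_seq (fun n => @?f n - @?g n) (Finite (?a - ?b)) =>
      apply (is_lim_seq_minus' f g a b); lim_arith
  | |- is_lim_seq (fun n => @?f n * @?g n) (Finite (?a * ?b)) =>
      apply (is_lim_seq_mult' f g a b); lim_arith
  | |- is_lim_seq (fun n => exp (@?f n)) (Finite (exp ?a)) =>
      apply (is_lim_seq_exp f a); lim_arith
  | |- is_lim_seq (fun _ => ?a) (Finite ?a) => apply is_lim_seq_const
  | |- _ => try assumption
  end.

Lemma numer_lim (p1 p2 q1 q2 U V : nat -> R) (a1 a2 b1 b2 u v : R) :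
  is_lim_seq p1 a1 -> is_lim_seq p2 a2 -> is_lim_seq q1 b1 -> is_lim_seq q2 b2 ->
  is_lim_seq U u -> is_lim_seq V v ->
  is_lim_seq (fun n => numer (p1 n, p2 n) (q1 n, q2 n) (U n) (V n)) (numer (a1, a2) (b1, b2) u v).
Proof. intros. unfold numer, symX, symY; cbn [Re Im fst snd]. lim_arith. Qed.

Lemma denom_lim (p1 p2 q1 q2 U V : nat -> R) (a1 a2 b1 b2 u v : R) :
  is_lim_seq p1 a1 -> is_lim_seq p2 a2 -> is_lim_seq q1 b1 -> is_lim_seq q2 b2 ->
  is_lim_seq U u -> is_lim_seq V v ->
  is_lim_seq (fun n => denom (p1 n, p2 n) (q1 n, q2 n) (U n) (V n)) (denom (a1, a2) (b1, b2) u v).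
Proof. intros. unfold denom, symX, symY; cbn [Re Im fst snd]. lim_arith. Qed.

Lemma excess_lim (l : R) (d p1 p2 q1 q2 U V : nat -> R) (d0 a1 a2 b1 b2 u v : R) :
  is_lim_seq d d0 ->
  is_lim_seq p1 a1 -> is_lim_seq p2 a2 -> is_lim_seq q1 b1 -> is_lim_seq q2 b2 ->
  is_lim_seq U u -> is_lim_seq V v ->
  is_lim_seq (fun n => excess l (d n) (p1 n, p2 n) (q1 n, q2 n) (U n) (V n))
             (excess l d0 (a1, a2) (b1, b2) u v).
Proof.
  intros. unfold excess. apply is_lim_seq_minus'; [apply numer_lim; assumption|].
  apply is_lim_seq_mult'; [|apply denom_lim; assumption]. lim_arith.
Qed.

Lemma is_lim_seq_inv_nat2 : is_lim_seq (fun n => / (INR n + 2)) 0.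
Proof.
  replace (Finite 0) with (Rbar_inv p_infty) by reflexivity.
  apply is_lim_seq_inv; [|discriminate].
  replace p_infty with (Rbar_plus p_infty 2) by reflexivity.
  apply is_lim_seq_plus with p_infty 2; [apply is_lim_seq_INR|apply is_lim_seq_const|reflexivity].
Qed.

Lemma inv_nat2_bounds n : 0 < / (INR n + 2) <= / 2.
Proof.
  pose proof (pos_INR n). split; [apply Rinv_0_lt_compat; lra|].
  apply Rinv_le_contravar; lra.
Qed.

Lemma is_lim_seq_le_const (x : nat -> R) (a b : R) :
  (forall n, a <= x n) -> is_lim_seq x b -> a <= b.
Proof.
  intros H Hx.
  exact (is_lim_seq_le (fun _ => a) x a b H (is_lim_seq_const a) Hx).
Qed.

Lemma admissible_shrink (K : R -> R -> Prop) (l d : R) (p q : C) :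
  seq_compact K -> (exists u v, K u v) -> 0 <= d ->
  (forall u v, K u v -> excess l d p q u v < 0) ->
  exists d', 0 <= d' < d /\ admissible K l d' p q.
Proof.
  intros HK [u0 [v0 Hne]] Hd Hneg.
  destruct Hd as [Hd|Hd].
  2:{ exfalso. specialize (Hneg _ _ Hne). unfold excess in Hneg. rewrite <- Hd in Hneg.
      pose proof (numer_ge0 p q u0 v0). lra. }
  apply NNPP. intros Hno.
  assert (Hex : forall n : nat, exists w : R * R,
             K (fst w) (snd w) /\ 0 <= excess l (d * (1 - / (INR n + 2))) p q (fst w) (snd w)).
  { intros n. apply NNPP. intros Hn. apply Hno. exists (d * (1 - / (INR n + 2))).
    pose proof (inv_nat2_bounds n). split; [split; nra|].
    intros u v Huv. apply Rnot_lt_le. intros Hlt. apply Hn. exists (u, v). simpl.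
    split; [exact Huv|]. unfold excess. lra. }
  apply seq_choice in Hex. destruct Hex as [w Hw].
  destruct (HK (fun n => fst (w n)) (fun n => snd (w n))) as [g [u [v [Hg [Huv [HU HV]]]]]].
  { intros n; apply Hw. }
  assert (Hlim : 0 <= excess l (d * (1 - 0)) p q u v).
  { destruct p as [p1 p2], q as [q1 q2].
    apply is_lim_seq_le_const with
      (fun n => excess l (d * (1 - / (INR (g n) + 2))) (p1, p2) (q1, q2)
                  (fst (w (g n))) (snd (w (g n)))).
    - intros n. apply Hw.
    - apply (excess_lim l (fun n => d * (1 - / (INR (g n) + 2)))
               (fun _ => p1) (fun _ => p2) (fun _ => q1) (fun _ => q2)
               (fun n => fst (w (g n))) (fun n => snd (w (g n)))); lim_arith.
      apply (is_lim_seq_strict_subseq (fun n => / (INR n + 2)) 0 g Hg is_lim_seq_inv_nat2). }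
  specialize (Hneg u v Huv). replace (d * (1 - 0)) with d in Hlim by ring. lra.
Qed.

Lemma sum_sq_eq0 (x y : R) : x ^ 2 + y ^ 2 = 0 -> x = 0 /\ y = 0.
Proof.
  intros H. pose proof (pow2_ge_0 x). pose proof (pow2_ge_0 y).
  split; apply Rsqr_eq_0; unfold Rsqr; simpl in *; lra.
Qed.

Lemma sq_inj_half_plane u v u' v' :
  0 < u -> 0 < u' -> u * u - v * v = u' * u' - v' * v' -> 2 * u * v = 2 * u' * v' ->
  u = u' /\ v = v'.
Proof.
  intros Hu Hu' H1 H2.
  assert (E : ((u - u') ^ 2 + (v - v') ^ 2) * ((u + u') ^ 2 + (v + v') ^ 2) = 0).
  { transitivity ((u * u - v * v - (u' * u' - v' * v')) ^ 2 + (2 * u * v - 2 * u' * v') ^ 2);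
      [ring|rewrite H1, H2; ring]. }
  apply Rmult_integral in E. destruct E as [E|E].
  - apply sum_sq_eq0 in E. lra.
  - apply sum_sq_eq0 in E. lra.
Qed.

Lemma common_value_unique (p q p' q' : C) u v u' v' :
  (p, q) <> (p', q') -> 0 < u -> 0 < u' ->
  symX p q u v = symX p' q' u v -> symY p q u v = symY p' q' u v ->
  symX p q u' v' = symX p' q' u' v' -> symY p q u' v' = symY p' q' u' v' ->
  u = u' /\ v = v'.
Proof.
  destruct p as [p1 p2], q as [q1 q2], p' as [a1 a2], q' as [b1 b2].
  unfold symX, symY; cbn [Re Im fst snd]. intros Hne Hu Hu' H1 H2 H3 H4.
  set (x := q1 - b1). set (y := q2 - b2).
  set (s := u * u - v * v - (u' * u' - v' * v')).
  set (t := 2 * u * v - 2 * u' * v').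
  assert (E1 : x * s - y * t = 0) by (unfold x, y, s, t; lra).
  assert (E2 : x * t + y * s = 0) by (unfold x, y, s, t; lra).
  assert (E : (x ^ 2 + y ^ 2) * (s ^ 2 + t ^ 2) = 0).
  { transitivity ((x * s - y * t) ^ 2 + (x * t + y * s) ^ 2); [ring|rewrite E1, E2; ring]. }
  apply Rmult_integral in E. destruct E as [E|E].
  - exfalso. apply Hne.
    apply sum_sq_eq0 in E. destruct E as [Hx Hy]. unfold x, y in Hx, Hy.
    assert (q1 = b1) by lra. assert (q2 = b2) by lra. subst b1 b2.
    f_equal; f_equal; lra.
  - apply sum_sq_eq0 in E. apply sq_inj_half_plane; auto; unfold s, t in E; lra.
Qed.

(* The midpoint of two minimizers satisfies the constraint strictly except possibly at the
   single point where they agree; there, moving towards the constant [f] gains strictly. *)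
Lemma minimizer_unique (K : R -> R -> Prop) (l d : R) (p q p' q' : C) (ua va ub vb : R) :
  seq_compact K -> K ua va -> K ub vb -> (ua, va) <> (ub, vb) ->
  (forall u v, K u v -> 0 < u) -> 0 <= d ->
  admissible K l d p q -> admissible K l d p' q' ->
  (forall u v, K u v -> 0 < symX p q u v * u + symY p q u v * v) ->
  (forall u v, K u v -> 0 < symX p' q' u v * u + symY p' q' u v * v) ->
  (forall d' a b, 0 <= d' -> admissible K l d' a b -> d <= d') ->
  p = p' /\ q = q'.
Proof.
  intros HK Ha Hb Hab Hpos Hd HS HS' Hre Hre' Hmin.
  apply NNPP. intros Hdiff.
  assert (Hpq : (p, q) <> (p', q')).
  { intros E. injection E. tauto. }
  assert (Hdpos : 0 < d).
  { destruct Hd as [Hd|Hd]; [exact Hd|exfalso].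
    assert (Hval : forall a b, admissible K l d a b -> forall u v, K u v ->
              symX a b u v = u /\ symY a b u v = v).
    { intros a b H u v Huv. specialize (H u v Huv). rewrite <- Hd in H.
      replace (0 * 0 * exp (l * u) * denom a b u v) with 0 in H by ring.
      assert (E := numer_ge0 a b u v). unfold numer in *.
      destruct (sum_sq_eq0 (symX a b u v - u) (symY a b u v - v)); lra. }
    destruct (common_value_unique p q p' q' ua va ub vb) as [E1 E2]; eauto;
      try (etransitivity; [apply (Hval p q)|symmetry; apply (Hval p' q')]; assumption).
    apply Hab. congruence. }
  set (pm := Cmix (/ 2) p p'). set (qm := Cmix (/ 2) q q').
  assert (Hm : forall u v, K u v -> excess l d pm qm u v <= 0 /\
            (0 <= excess l d pm qm u v ->
              d * d * exp (l * u) < 1 /\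
              symX p q u v = symX p' q' u v /\ symY p q u v = symY p' q' u v)).
  { intros u v Huv. specialize (HS u v Huv). specialize (HS' u v Huv).
    destruct (Rlt_le_dec (d * d * exp (l * u)) 1) as [He|He].
    - assert (E := excess_mix l d (/ 2) p p' q q' u v). fold pm qm in E.
      assert (H1 : excess l d p q u v <= 0) by (unfold excess; lra).
      assert (H2 : excess l d p' q' u v <= 0) by (unfold excess; lra).
      set (dx := symX p q u v - symX p' q' u v) in *.
      set (dy := symY p q u v - symY p' q' u v) in *.
      set (e := d * d * exp (l * u)) in *.
      assert (H3 : 0 <= (1 - e) * (dx ^ 2 + dy ^ 2)) by (apply Rmult_le_pos; [lra|apply Rplus_le_le_0_compat; apply pow2_ge_0]).
      split; [nra|]. intros H0.
      assert (H4 : (1 - e) * (dx ^ 2 + dy ^ 2) = 0) by nra.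
      apply Rmult_integral in H4. destruct H4 as [H4|H4]; [lra|].
      apply sum_sq_eq0 in H4. unfold dx, dy in H4. lra.
    - assert (Hlt : excess l d pm qm u v < 0); [|split; lra].
      assert (Hmid := denom_sub_numer pm qm u v). unfold pm, qm in Hmid.
      rewrite symX_mix, symY_mix in Hmid. fold pm qm in Hmid.
      specialize (Hre u v Huv). specialize (Hre' u v Huv).
      pose proof (denom_ge0 pm qm u v). unfold excess.
      assert (denom pm qm u v <= d * d * exp (l * u) * denom pm qm u v) by nra.
      lra. }
  assert (Hstar : exists c : C, forall u v, K u v -> 0 <= excess l d pm qm u v ->
            excess l d c (0, 0) u v < 0).
  { destruct (classic (exists u0 v0, K u0 v0 /\ 0 <= excess l d pm qm u0 v0))
      as [[u0 [v0 [H0 He0]]]|Hnone].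
    - exists (u0, v0). intros u v Huv He.
      destruct (Hm u v Huv) as [_ Hm1]. destruct (Hm1 He) as [_ [HX HY]].
      destruct (Hm u0 v0 H0) as [_ Hm0]. destruct (Hm0 He0) as [_ [HX0 HY0]].
      destruct (common_value_unique p q p' q' u v u0 v0) as [-> ->]; eauto.
      specialize (Hpos u0 v0 H0).
      unfold excess, numer, denom, symX, symY; cbn [Re Im fst snd].
      pose proof (exp_pos (l * u0)).
      match goal with |- ?x < 0 =>
        replace x with (- (d * d * exp (l * u0) * (4 * (u0 * u0 + v0 * v0)))) by ring end.
      apply Ropp_lt_gt_0_contravar.
      apply Rmult_lt_0_compat; [apply Rmult_lt_0_compat; nra|nra].
    - exists (0, 0). intros u v Huv He. exfalso. apply Hnone. eauto. }
  destruct Hstar as [c Hc].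
  assert (Ht : exists n : nat, forall u v, K u v ->
            excess l d (Cmix (/ (INR n + 2)) pm c) (Cmix (/ (INR n + 2)) qm (0, 0)) u v < 0).
  { apply NNPP. intros Hno.
    assert (Hex : forall n : nat, exists w : R * R, K (fst w) (snd w) /\
       0 <= excess l d (Cmix (/ (INR n + 2)) pm c) (Cmix (/ (INR n + 2)) qm (0, 0))
              (fst w) (snd w)).
    { intros n. apply NNPP. intros Hn. apply Hno. exists n. intros u v Huv.
      apply Rnot_le_lt. intros Hle. apply Hn. exists (u, v). split; assumption. }
    apply seq_choice in Hex. destruct Hex as [w Hw].
    destruct (HK (fun n => fst (w n)) (fun n => snd (w n))) as [g [u [v [Hg [Huv [HU HV]]]]]].
    { intros n; apply Hw. }
    assert (Hinv := is_lim_seq_strict_subseq _ _ g Hg is_lim_seq_inv_nat2).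
    assert (Hlim : 0 <= excess l d (Cmix 0 pm c) (Cmix 0 qm (0, 0)) u v).
    { apply is_lim_seq_le_const with
        (fun n => excess l d (Cmix (/ (INR (g n) + 2)) pm c)
                    (Cmix (/ (INR (g n) + 2)) qm (0, 0)) (fst (w (g n))) (snd (w (g n)))).
      - intros n. apply Hw.
      - unfold Cmix. apply excess_lim with (d := fun _ => d)
          (U := fun n => fst (w (g n))) (V := fun n => snd (w (g n))); lim_arith. }
    replace (Cmix 0 pm c) with pm in Hlim
      by (unfold Cmix; destruct pm; simpl; f_equal; ring).
    replace (Cmix 0 qm (0, 0)) with qm in Hlim
      by (unfold Cmix; destruct qm; simpl; f_equal; ring).
    destruct (Hm u v Huv) as [_ Hmuv]. destruct (Hmuv Hlim) as [He _].
    specialize (Hc u v Huv Hlim).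
    assert (L1 : is_lim_seq (fun n => excess l d c (0, 0) (fst (w (g n))) (snd (w (g n))))
                   (excess l d c (0, 0) u v)).
    { destruct c as [c1 c2].
      apply (excess_lim l (fun _ => d) (fun _ => c1) (fun _ => c2) (fun _ => 0) (fun _ => 0)
               (fun n => fst (w (g n))) (fun n => snd (w (g n)))); lim_arith. }
    assert (L2 : is_lim_seq (fun n => d * d * exp (l * fst (w (g n)))) (d * d * exp (l * u)))
      by lim_arith.
    apply is_lim_seq_spec in L1. apply is_lim_seq_spec in L2.
    assert (Hc' : 0 < - excess l d c (0, 0) u v) by lra.
    assert (He' : 0 < 1 - d * d * exp (l * u)) by lra.
    destruct (L1 (mkposreal _ Hc')) as [n1 Hn1]. destruct (L2 (mkposreal _ He')) as [n2 Hn2].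
    specialize (Hn1 (max n1 n2) (Nat.le_max_l _ _)).
    specialize (Hn2 (max n1 n2) (Nat.le_max_r _ _)).
    simpl in Hn1, Hn2. apply Rabs_lt_between in Hn1, Hn2.
    set (n := max n1 n2) in *.
    destruct (Hw (g n)) as [Hk Hge]. rewrite excess_mix in Hge.
    destruct (Hm _ _ Hk) as [Hle _].
    destruct (inv_nat2_bounds (g n)) as [Ht1 Ht2].
    set (t := / (INR (g n) + 2)) in *.
    set (X := (symX pm qm _ _ - _) ^ 2 + _) in Hge.
    assert (0 <= X) by (unfold X; apply Rplus_le_le_0_compat; apply pow2_ge_0).
    set (e := d * d * exp (l * fst (w (g n)))) in *.
    assert (0 <= t * (1 - t) * (1 - e) * X).
    { apply Rmult_le_pos; [apply Rmult_le_pos|]; nra. }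
    set (E1 := excess l d pm qm _ _) in *. set (E2 := excess l d c _ _ _) in *.
    nra. }
  destruct Ht as [n Hn].
  destruct (admissible_shrink K l d _ _ HK (ex_intro _ _ (ex_intro _ _ Ha)) Hd Hn)
    as [d' [Hd' Hadm]].
  specialize (Hmin d' _ _ (proj1 Hd') Hadm). lra.
Qed.
Lemma admissible_mono (K : R -> R -> Prop) (l d d' : R) (p q : C) :
  0 <= d <= d' -> admissible K l d p q -> admissible K l d' p q.
Proof.
  intros Hd H u v Huv. eapply Rle_trans; [apply H, Huv|].
  apply Rmult_le_compat_r; [apply denom_ge0|].
  apply Rmult_le_compat_r; [apply Rlt_le, exp_pos|]. nra.
Qed.

Definition coef_bounded (B : R) (p q : C) : Prop :=
  Rabs (Re p) <= B /\ Rabs (Im p) <= B /\ Rabs (Re q) <= B /\ Rabs (Im q) <= B.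

Lemma minimizer_exists (K : R -> R -> Prop) (l d0 B : R) (p0 q0 : C) :
  0 <= d0 -> admissible K l d0 p0 q0 ->
  (forall p q, admissible K l d0 p q -> coef_bounded B p q) ->
  exists (d : R) (p q : C), 0 <= d <= d0 /\ admissible K l d p q /\
    (forall d' a b, 0 <= d' -> admissible K l d' a b -> d <= d').
Proof.
  intros Hd0 H0 HB.
  set (E := fun x => exists p q, 0 <= - x <= d0 /\ admissible K l (- x) p q).
  destruct (completeness E) as [m [Hub Hlub]].
  - exists 0. intros x [p [q [Hx _]]]. lra.
  - exists (- d0), p0, q0. rewrite Ropp_involutive. split; [lra|exact H0].
  - assert (Hm0 : m <= 0) by (apply Hlub; intros x [p [q [Hx _]]]; lra).
    assert (Hmd : - d0 <= m).
    { apply Hub. exists p0, q0. rewrite Ropp_involutive. split; [lra|exact H0]. }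
    assert (Hex : forall n : nat, exists w : R * (C * C),
              0 <= fst w <= d0 /\ admissible K l (fst w) (fst (snd w)) (snd (snd w)) /\
              - m <= fst w < - m + / (INR n + 2)).
    { intros n. apply NNPP. intros Hn.
      destruct (inv_nat2_bounds n) as [Hn0 _].
      assert (Hle : m <= m - / (INR n + 2)); [|lra].
      apply Hlub. intros x [p [q [Hx Hadm]]]. apply Rnot_lt_le. intros Hlt. apply Hn.
      exists (- x, (p, q)). cbn [fst snd]. split; [exact Hx|split; [exact Hadm|]].
      assert (x <= m) by (apply Hub; exists p, q; split; assumption). lra. }
    apply seq_choice in Hex. destruct Hex as [w Hw].
    assert (Hbd : forall n, coef_bounded B (fst (snd (w n))) (snd (snd (w n)))).
    { intros n. destruct (Hw n) as [H1 [H2 _]]. apply HB.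
      apply admissible_mono with (fst (w n)); assumption. }
    destruct (bounded_seq4_cvg_subseq
                (fun n => Re (fst (snd (w n)))) (fun n => Im (fst (snd (w n))))
                (fun n => Re (snd (snd (w n)))) (fun n => Im (snd (snd (w n)))) B)
      as [g [a1 [a2 [b1 [b2 [Hg [L1 [L2 [L3 L4]]]]]]]]]; try (intros n; apply Hbd).
    assert (Ld : is_lim_seq (fun n => fst (w (g n))) (- m)).
    { apply (is_lim_seq_strict_subseq (fun n => fst (w n)) (- m) g Hg).
      apply is_lim_seq_le_le with (fun _ => - m) (fun n => - m + / (INR n + 2)).
      - intros n. destruct (Hw n) as [_ [_ Hn]]. lra.
      - apply is_lim_seq_const.
      - replace (Finite (- m)) with (Finite (- m + 0)) by (f_equal; ring).
        apply (is_lim_seq_plus' (fun _ => - m) _ (- m) 0);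
          [apply is_lim_seq_const|apply is_lim_seq_inv_nat2]. }
    exists (- m), (a1, a2), (b1, b2). split; [lra|split].
    + intros u v Huv. apply Rminus_le.
      assert (Hlim : is_lim_seq (fun n => excess l (fst (w (g n)))
          (Re (fst (snd (w (g n)))), Im (fst (snd (w (g n)))))
          (Re (snd (snd (w (g n)))), Im (snd (snd (w (g n))))) u v)
          (excess l (- m) (a1, a2) (b1, b2) u v)).
      { apply (excess_lim l (fun n => fst (w (g n)))
          (fun n => Re (fst (snd (w (g n))))) (fun n => Im (fst (snd (w (g n)))))
          (fun n => Re (snd (snd (w (g n))))) (fun n => Im (snd (snd (w (g n)))))
          (fun _ => u) (fun _ => v)); lim_arith. }
      refine (is_lim_seq_le _ (fun _ => 0) _ 0 _ Hlim (is_lim_seq_const 0)).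
      intros n. destruct (Hw (g n)) as [_ [Hadm _]]. specialize (Hadm u v Huv).
      unfold excess. destruct (snd (w (g n))) as [[c1 c2] [e1 e2]]. simpl in *. lra.
    + intros d' a b Hd' Hadm.
      destruct (Rle_lt_dec d' d0) as [Hle|Hlt]; [|lra].
      assert (- d' <= m); [|lra].
      apply Hub. exists a, b. rewrite Ropp_involutive. split; [lra|exact Hadm].
Qed.

Lemma admissible_conj (K : R -> R -> Prop) (l d : R) (p q : C) :
  (forall u v, K u v -> K u (- v)) ->
  admissible K l d p q -> admissible K l d (Cconj p) (Cconj q).
Proof.
  intros HK H u v Huv. specialize (H u (- v) (HK u v Huv)).
  destruct p as [p1 p2], q as [q1 q2].
  unfold numer, denom, symX, symY, Cconj in *; cbn [Re Im fst snd] in *.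
  match type of H with ?x <= _ * ?y => match goal with |- ?x' <= _ * ?y' =>
    replace x' with x by ring; replace y' with y by ring end end.
  exact H.
Qed.

(* A unique minimizer is fixed by the conjugation symmetry, hence real. *)
Lemma best_approx_exists_unique (K : R -> R -> Prop) (l d0 B : R) (p0 q0 : C)
  (ua va ub vb : R) :
  seq_compact K -> K ua va -> K ub vb -> (ua, va) <> (ub, vb) ->
  (forall u v, K u v -> 0 < u) -> (forall u v, K u v -> K u (- v)) ->
  0 <= d0 -> admissible K l d0 p0 q0 ->
  (forall p q, admissible K l d0 p q -> coef_bounded B p q /\
     forall u v, K u v -> 0 < symX p q u v * u + symY p q u v * v) ->
  exists d p q : R, 0 <= d <= d0 /\ admissible K l d (RtoC p) (RtoC q) /\
    (forall d' a b, 0 <= d' -> admissible K l d' a b -> d <= d') /\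
    (forall a b, admissible K l d a b -> a = RtoC p /\ b = RtoC q).
Proof.
  intros HK Ha Hb Hab Hpos Hconj Hd0 H0 HB.
  destruct (minimizer_exists K l d0 B p0 q0 Hd0 H0) as [d [p [q [Hd [Hadm Hmin]]]]].
  { intros p q Hpq. apply HB, Hpq. }
  assert (Huniq : forall a b, admissible K l d a b -> a = p /\ b = q).
  { intros a b Hadm'.
    apply (minimizer_unique K l d a b p q ua va ub vb); auto; try lra;
      apply HB; apply admissible_mono with d; auto. }
  destruct (Huniq _ _ (admissible_conj K l d p q Hconj Hadm)) as [Ep Eq].
  assert (Hreal : forall z : C, Cconj z = z -> z = RtoC (Re z)).
  { intros [x y] E. injection E as E. unfold RtoC. simpl. f_equal. lra. }
  apply Hreal in Ep, Eq.
  exists d, (Re p), (Re q). rewrite <- Ep, <- Eq. auto.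
Qed.

(** * Asymptotics in the scale [s = L^(1/5)] *)

(* [A], [v1], [U1], [V1], [tau], [C0], [c0] are independent of the scale [s].  The slope [tau]
   is the extreme value of [|v| / u] for large [u]: [1] if the time step is of order [h^2],
   [0] if it is of order [h]. *)
Record scaled_set (A v1 U1 V1 tau C0 c0 s : R) (K : R -> R -> Prop) : Prop := {
  ss_min : forall u v, K u v -> A / 4 <= u /\ Rabs v <= u;
  ss_conj : forall u v, K u v -> K u (- v);
  ss_low : K (A / 4) v1;
  ss_fix : K U1 V1;
  ss_mid : forall u, U1 <= u -> u * u * s ^ 5 <= c0 ->
    exists v, K u v /\ 0 <= v /\ Rabs (v - u) <= C0;
  ss_far : forall u, U1 <= u -> u * s ^ 5 <= c0 ->
    exists v, K u v /\ 0 <= v /\ Rabs (v - tau * u) <= C0;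
  ss_slope : forall u v, K u v -> Rabs v <= tau * u + C0 * (/ (s ^ 5 * u) + 1) }.

Lemma small_mul (C e : R) : 0 < e -> at_right 0 (fun s => 0 < s /\ C * s <= e).
Proof.
  intros He. pose proof (Rabs_pos C). pose proof (Rle_abs C).
  assert (Hd : 0 < e / (Rabs C + 1)) by (apply Rdiv_lt_0_compat; lra).
  exists (mkposreal _ Hd). intros s Hs Hs0. split; [exact Hs0|].
  unfold ball in Hs; simpl in Hs. unfold AbsRing_ball, abs, minus, plus, opp in Hs. simpl in Hs.
  apply Rabs_lt_between in Hs. destruct Hs as [_ Hs].
  assert (Hs' : s < e / (Rabs C + 1)) by lra.
  apply (Rmult_lt_compat_r (Rabs C + 1)) in Hs'; [|lra].
  unfold Rdiv in Hs'. rewrite Rmult_assoc, Rinv_l in Hs'; [nra|lra].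
Qed.

Lemma pow_S_le_self (s : R) (n : nat) : 0 <= s <= 1 -> s ^ S n <= s.
Proof.
  intros Hs. simpl. apply Rle_trans with (s * 1); [|lra]. apply Rmult_le_compat_l; [lra|].
  rewrite <- (pow1 n). apply pow_incr, Hs.
Qed.

Lemma exp_neg_le (y : R) : 0 <= y -> exp (- y) <= 1 - y + y ^ 2.
Proof.
  intros Hy. rewrite exp_Ropp.
  pose proof (exp_ineq1_le y). apply (Rmult_le_reg_l (exp y)); [apply exp_pos|].
  rewrite Rinv_r by (apply Rgt_not_eq, exp_pos).
  assert (0 < 1 - y + y ^ 2) by nra. nra.
Qed.

Lemma gap_of_numer_le (p q : C) (u v y : R) :
  0 <= y -> numer p q u v <= exp (- y) * denom p q u v ->
  (y - y ^ 2) * denom p q u v <= 4 * (symX p q u v * u + symY p q u v * v).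
Proof.
  intros Hy H. rewrite <- denom_sub_numer.
  pose proof (exp_neg_le y Hy). pose proof (denom_ge0 p q u v). nra.
Qed.

Lemma real_pairing (p q u v : R) :
  symX (RtoC p) (RtoC q) u v * u + symY (RtoC p) (RtoC q) u v * v
  = u * (p + q * (u * u + v * v)).
Proof. unfold symX, symY, RtoC; simpl; ring. Qed.

Lemma real_numer_le (p q u v l y : R) :
  0 < p -> 0 < q -> 0 < u ->
  let m := p + q * (u * u + v * v) in
  let B := m * m + (u * u + v * v) + 2 * u * m in
  y <= 4 * u * m / B + l * u ->
  numer (RtoC p) (RtoC q) u v <= exp (- y) * exp (l * u) * denom (RtoC p) (RtoC q) u v.
Proof.
  intros Hp Hq Hu m B Hy.
  assert (Hr2 : 0 < u * u + v * v) by nra.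
  assert (Hqr : 0 < q * (u * u + v * v)) by (apply Rmult_lt_0_compat; lra).
  assert (Hm : 0 < m) by (unfold m; lra).
  assert (HB : 0 < B) by (unfold B; clearbody m; nra).
  assert (E := denom_sub_numer (RtoC p) (RtoC q) u v). rewrite real_pairing in E. fold m in E.
  assert (HdB : denom (RtoC p) (RtoC q) u v <= B).
  { unfold denom, symX, symY, RtoC, B, m; simpl.
    assert (0 <= p * q * (v * v)) by (apply Rmult_le_pos; nra).
    match goal with |- ?x <= ?y => assert (y - x = 4 * (p * q * (v * v))) by ring end. lra. }
  pose proof (numer_ge0 (RtoC p) (RtoC q) u v).
  set (N := numer _ _ _ _) in *. set (M := denom _ _ _ _) in *.
  assert (Hum : 0 < u * m) by nra.
  assert (HM : 0 < M) by nra.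
  replace N with (M * (1 + - (4 * (u * m) / M))) by (transitivity (M - 4 * (u * m)); [field|]; lra).
  rewrite (Rmult_comm _ M). apply Rmult_le_compat_l; [lra|].
  rewrite <- exp_plus. eapply Rle_trans; [apply exp_ineq1_le|].
  assert (Hle : - (4 * (u * m) / M) <= - y + l * u).
  { assert (4 * u * m / B <= 4 * (u * m) / M).
    { unfold Rdiv. replace (4 * u * m) with (4 * (u * m)) by ring.
      apply Rmult_le_compat_l; [lra|]. apply Rinv_le_contravar; lra. }
    lra. }
  destruct Hle as [Hle|Hle]; [apply Rlt_le, exp_increasing, Hle|rewrite Hle; lra].
Qed.

Lemma Rle_of_sq_le (x y : R) : 0 <= y -> x * x <= y * y -> x <= y.
Proof. intros Hy H. apply Rnot_lt_le. intros Hlt. nra. Qed.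

(* For [|f|] small compared with [p], the symbol is nearly the constant [p]. *)
Lemma upper_low_regime (e P Q D A s u r : R) :
  0 < e <= / 8 -> 0 < P -> 0 < Q -> 0 < D -> 0 < s -> 2 * (D * P) = A ->
  A / 4 <= u -> 0 < u <= r -> r <= e * (P / s) -> Q * P * s ^ 2 <= 1 ->
  let m := P / s + Q * s ^ 3 * (r * r) in
  (1 - 8 * e) * D * s * (m * m + r * r + 2 * u * m) <= 2 * u * m.
Proof.
  intros He HP HQ HD Hs HA HAu Hu Hr Hsm m.
  set (p := P / s) in *.
  assert (Hp : 0 < p) by (apply Rdiv_lt_0_compat; lra).
  assert (Hps : p * s = P) by (unfold p; field; lra).
  assert (Hqr : Q * s ^ 3 * (r * r) <= e * p).
  { assert (H1 : r * r <= (e * p) * (e * p)) by nra.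
    apply Rle_trans with (Q * s ^ 3 * ((e * p) * (e * p))).
    - apply Rmult_le_compat_l; [|exact H1]. apply Rmult_le_pos; [lra|apply pow_le; lra].
    - replace (Q * s ^ 3 * (e * p * (e * p))) with (e * p * (e * (Q * (p * s) * s ^ 2))) by ring.
      rewrite Hps. rewrite <- (Rmult_1_r (e * p)) at 2.
      apply Rmult_le_compat_l; [nra|]. nra. }
  assert (0 <= Q * s ^ 3 * (r * r)).
  { apply Rmult_le_pos; [apply Rmult_le_pos; [lra|apply pow_le; lra]|nra]. }
  assert (Hm1 : p <= m) by (unfold m; lra).
  assert (Hm2 : m <= p * (1 + e)) by (unfold m; lra).
  assert (HB : m * m + r * r + 2 * u * m <= m * p * (1 + 4 * e)).
  { assert (m * m <= m * (p * (1 + e))) by nra.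
    assert (r * r <= (e * p) * (e * p)) by nra.
    assert ((e * p) * (e * p) <= e * p * m) by (apply Rmult_le_compat_l; nra).
    assert (u * m <= e * p * m) by nra. lra. }
  destruct (Rle_lt_dec (1 - 8 * e) 0) as [Hneg|Hposi].
  { assert (0 <= m * m + r * r + 2 * u * m) by nra.
    assert (0 < u * m) by nra.
    assert (0 <= D * s * (m * m + r * r + 2 * u * m)).
    { apply Rmult_le_pos; nra. }
    nra. }
  apply Rle_trans with ((1 - 8 * e) * D * s * (m * p * (1 + 4 * e))).
  { apply Rmult_le_compat_l; [|exact HB]. apply Rmult_le_pos; [nra|lra]. }
  replace ((1 - 8 * e) * D * s * (m * p * (1 + 4 * e)))
    with ((1 - 8 * e) * (1 + 4 * e) * (m * (D * (p * s)))) by ring.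
  rewrite Hps. assert (0 < m * (D * P)) by (apply Rmult_lt_0_compat; nra).
  assert (m * (D * P) <= 2 * u * m) by nra.
  assert ((1 - 8 * e) * (1 + 4 * e) <= 1) by nra. nra.
Qed.

Lemma upper_mid_regime (e T P Q D s u r : R) :
  0 < e < 1 -> 0 < T -> 0 < P -> 0 < Q -> 0 < D -> 0 < s -> D * D = 8 * P * Q ->
  0 < u -> 0 < r -> r * r <= 2 * (u * u) -> D * (T + 1) * s <= e ->
  let m := P / s + Q * s ^ 3 * (r * r) in
  m <= T * r ->
  (1 - e) * D * s * (m * m + r * r + 2 * u * m) <= 2 * u * m.
Proof.
  intros He HT HP HQ HD Hs HDD Hu Hr Hru Hsm m Hm.
  assert (Hp : 0 < P / s) by (apply Rdiv_lt_0_compat; lra).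
  assert (Hs3 : 0 < s ^ 3) by (apply pow_lt; lra).
  assert (Hq : 0 < Q * s ^ 3 * (r * r)) by (apply Rmult_lt_0_compat; nra).
  assert (Hm0 : 0 < m) by (unfold m; lra).
  assert (Hr2 : r <= 2 * u) by nra.
  assert (Hmm : 4 * (P * Q * s ^ 2) * (r * r) <= m * m).
  { replace (4 * (P * Q * s ^ 2) * (r * r)) with (4 * (P / s) * (Q * s ^ 3 * (r * r)))
      by (field; lra).
    pose proof (Rle_0_sqr (P / s - Q * s ^ 3 * (r * r))). unfold Rsqr in *. unfold m. lra. }
  assert (Hum : 0 < u * m) by (apply Rmult_lt_0_compat; lra).
  assert (H1 : D * s * (r * r) <= 2 * (u * m)).
  { apply Rle_of_sq_le; [lra|].
    replace (D * s * (r * r) * (D * s * (r * r))) with (D * D * s ^ 2 * (r * r) * (r * r)) by ring.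
    rewrite HDD.
    replace (8 * P * Q * s ^ 2 * (r * r) * (r * r))
      with (2 * (r * r) * (4 * (P * Q * s ^ 2) * (r * r))) by ring.
    apply Rle_trans with (2 * (r * r) * (m * m)).
    - apply Rmult_le_compat_l; [nra|exact Hmm].
    - replace (2 * (u * m) * (2 * (u * m))) with (2 * (2 * (u * u)) * (m * m)) by ring.
      apply Rmult_le_compat_r; [apply Rle_0_sqr|lra]. }
  assert (H2 : m * m <= 2 * T * (u * m)).
  { replace (2 * T * (u * m)) with (T * (2 * u) * m) by ring.
    apply Rmult_le_compat_r; [lra|]. eapply Rle_trans; [exact Hm|].
    apply Rmult_le_compat_l; lra. }
  assert (H3 : D * s * (m * m) <= D * s * (2 * T * (u * m))).
  { apply Rmult_le_compat_l; [nra|exact H2]. }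
  assert (H4 : (D * (T + 1) * s) * (2 * (u * m)) <= e * (2 * (u * m))).
  { apply Rmult_le_compat_r; [lra|exact Hsm]. }
  assert (H5 : D * s * (m * m + r * r + 2 * u * m) <= (1 + e) * (2 * (u * m))) by lra.
  replace ((1 - e) * D * s * (m * m + r * r + 2 * u * m))
    with ((1 - e) * (D * s * (m * m + r * r + 2 * u * m))) by ring.
  nra.
Qed.

(* For large [|f|] the two effects [2 u / (q |f|^2)] (transmission) and [s^5 u / (2 nu)]
   (overlap) compete; AM-GM gives the bound. *)
Lemma upper_far_regime (e nu tau P Q D s u v r : R) :
  0 < e <= / 8 -> 0 < nu -> 0 <= tau <= 1 -> 0 < P -> 0 < Q -> 0 < D -> 0 < s ->
  D * D * (nu * Q) * (1 + tau * tau) = 4 ->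
  0 < u <= r -> r * r = u * u + v * v -> e * (P / s) < r -> Rabs v <= (tau + e) * u ->
  let m := P / s + Q * s ^ 3 * (r * r) in
  / (e * e) * r < m ->
  (1 - 8 * e) * D * s <= 2 * u * m / (m * m + r * r + 2 * u * m) + s ^ 5 / (2 * nu) * u.
Proof.
  intros He Hnu Htau HP HQ HD Hs HDD Hu Hr Hrp Hv m Hm.
  assert (Hp : 0 < P / s) by (apply Rdiv_lt_0_compat; lra).
  assert (Hs3 : 0 < s ^ 3) by (apply pow_lt; lra).
  assert (Hs5 : 0 < s ^ 5) by (apply pow_lt; lra).
  assert (Hee : 0 < e * e) by nra.
  assert (Hrm : r < e * e * m).
  { apply (Rmult_lt_compat_l (e * e)) in Hm; [|exact Hee].
    rewrite <- Rmult_assoc, Rinv_r in Hm; lra. }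
  assert (Hrr : 0 < r * r) by nra.
  set (q := Q * s ^ 3) in *.
  assert (Hq : 0 < q) by (unfold q; nra).
  assert (Hm0 : 0 < m) by (unfold m; nra).
  assert (Hpm : P / s < e * m).
  { apply (Rmult_lt_reg_l e); [lra|]. nra. }
  assert (Hqm : (1 - e) * m < q * (r * r)) by (unfold m in *; lra).
  assert (HB : m * m + r * r + 2 * u * m <= m * m * (1 + e)).
  { assert (r * r <= e * e * m * (e * e * m)) by (apply Rmult_le_compat; lra).
    assert (u * m <= e * e * m * m) by (apply Rmult_le_compat_r; lra).
    assert (He2 : e * e <= / 8 * e) by (apply Rmult_le_compat_r; lra).
    assert (e * e * (e * e) <= / 8 * e * 1) by (apply Rmult_le_compat; lra).
    assert (He3 : e * e * (e * e) + 2 * (e * e) <= e) by lra.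
    apply (Rmult_le_compat_r (m * m)) in He3; [|apply Rle_0_sqr]. lra. }
  assert (Hmm : 0 < m * m) by (apply Rmult_lt_0_compat; lra).
  assert (Hum : 0 < u * m) by (apply Rmult_lt_0_compat; lra).
  assert (HB0 : 0 < m * m + r * r + 2 * u * m) by lra.
  set (a := 2 * u / (q * (r * r))).
  set (b := s ^ 5 / (2 * nu) * u).
  assert (Hqr : 0 < q * (r * r)) by nra.
  assert (Ha : 0 < a) by (apply Rdiv_lt_0_compat; lra).
  assert (Hb : 0 < b) by (apply Rmult_lt_0_compat; [apply Rdiv_lt_0_compat|]; lra).
  assert (H1 : (1 - e) / (1 + e) * a <= 2 * u * m / (m * m + r * r + 2 * u * m)).
  { apply Rle_trans with (2 * u * m / (m * m * (1 + e))).
    - replace (2 * u * m / (m * m * (1 + e))) with (2 * u * (/ m / (1 + e))) by (field; lra).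
      replace ((1 - e) / (1 + e) * a) with (2 * u * ((1 - e) / (q * (r * r)) / (1 + e)))
        by (unfold a; field; nra).
      apply Rmult_le_compat_l; [lra|]. unfold Rdiv at 1 3.
      apply Rmult_le_compat_r; [apply Rlt_le, Rinv_0_lt_compat; lra|].
      apply Rle_div_l; [lra|]. rewrite Rmult_comm. apply Rle_div_r; [exact Hm0|]. lra.
    - unfold Rdiv. apply Rmult_le_compat_l; [nra|]. apply Rinv_le_contravar; assumption. }
  assert (Hr2 : r * r <= u * u * ((1 + tau * tau) * (1 + 3 * e))).
  { assert (v * v <= (tau + e) * u * ((tau + e) * u)).
    { pose proof (Rabs_pos v).
      replace (v * v) with (Rabs v * Rabs v)
        by (rewrite <- Rabs_mult; apply Rabs_pos_eq; nra).
      apply Rmult_le_compat; assumption. }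
    assert (Ht : 1 + (tau + e) * (tau + e) <= (1 + tau * tau) * (1 + 3 * e)) by nra.
    apply (Rmult_le_compat_l (u * u)) in Ht; [|apply Rle_0_sqr]. lra. }
  assert (Hab : (D * s) * (D * s) <= (1 + 3 * e) * (4 * (a * b))).
  { replace (4 * (a * b)) with (4 * (u * u * s ^ 5) / (nu * q * (r * r)))
      by (unfold a, b; field; lra).
    rewrite <- HDD. unfold q.
    replace ((1 + 3 * e) * (D * D * (nu * Q) * (1 + tau * tau) * (u * u * s ^ 5) /
      (nu * (Q * s ^ 3) * (r * r))))
      with ((D * s) * (D * s) * ((u * u * ((1 + tau * tau) * (1 + 3 * e))) / (r * r)))
      by (field; repeat split; lra).
    rewrite <- (Rmult_1_r (D * s * (D * s))) at 1.
    apply Rmult_le_compat_l; [nra|]. apply Rle_div_r; lra. }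
  assert (H2 : D * s <= (1 + 3 * e) * (a + b)).
  { apply Rle_of_sq_le; [nra|]. eapply Rle_trans; [exact Hab|].
    assert (4 * (a * b) <= (a + b) * (a + b)) by (pose proof (Rle_0_sqr (a - b)); unfold Rsqr in *; lra).
    assert (0 < (a + b) * (a + b)) by nra.
    assert (0 < a * b) by (apply Rmult_lt_0_compat; lra).
    replace ((1 + 3 * e) * (a + b) * ((1 + 3 * e) * (a + b)))
      with ((1 + 3 * e) * ((1 + 3 * e) * ((a + b) * (a + b)))) by ring.
    apply Rmult_le_compat_l; [lra|]. nra. }
  apply Rle_trans with ((1 - e) / (1 + e) * (a + b)).
  - apply (Rmult_le_reg_l (1 + e)); [lra|].
    replace ((1 + e) * ((1 - e) / (1 + e) * (a + b))) with ((1 - e) * (a + b)) by (field; lra).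
    assert ((1 + e) * (1 - 8 * e) * (1 + 3 * e) <= 1 - e) by nra.
    assert (0 <= 1 - 8 * e) by lra.
    apply Rle_trans with ((1 + e) * (1 - 8 * e) * ((1 + 3 * e) * (a + b))).
    + replace ((1 + e) * ((1 - 8 * e) * D * s)) with ((1 + e) * (1 - 8 * e) * (D * s)) by ring.
      apply Rmult_le_compat_l; [nra|exact H2].
    + rewrite <- Rmult_assoc. apply Rmult_le_compat_r; lra.
  - assert ((1 - e) / (1 + e) <= 1) by (apply Rle_div_l; lra).
    fold b. nra.
Qed.

Lemma Rabs_sq (v : R) : Rabs v * Rabs v = v * v.
Proof. rewrite <- Rabs_mult. apply Rabs_pos_eq, Rle_0_sqr. Qed.

Lemma real_symbol_admissible (nu A v1 U1 V1 tau C0 c0 P Q D eps : R) :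
  0 < nu -> 0 < A -> 0 <= tau <= 1 -> 0 < C0 -> 0 < P -> 0 < Q -> 0 < D ->
  2 * (D * P) = A -> D * D = 8 * P * Q -> D * D * (nu * Q) * (1 + tau * tau) = 4 ->
  0 < eps <= 1 ->
  at_right 0 (fun s => forall K, scaled_set A v1 U1 V1 tau C0 c0 s K ->
    admissible K (s ^ 5 / nu) (exp (- ((1 - eps) * D * s))) (RtoC (P / s)) (RtoC (Q * s ^ 3))).
Proof.
  intros Hnu HA Htau HC0 HP HQ HD HDP HDD HDQ Heps.
  set (e := eps / 8). assert (He : 0 < e <= / 8) by (unfold e; lra).
  replace eps with (8 * e) by (unfold e; field).
  set (T := / (e * e)). assert (HT : 0 < T) by (apply Rinv_0_lt_compat; nra).
  set (k := (1 - e) * T / (2 * Q)).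
  assert (Hk : 0 < k) by (apply Rdiv_lt_0_compat; [apply Rmult_lt_0_compat|]; lra).
  eapply filter_imp; [|apply filter_and; [exact (small_mul 1 1 Rlt_0_1)|
    apply filter_and; [exact (small_mul (Q * P) 1 Rlt_0_1)|
    apply filter_and; [exact (small_mul (D * (T + 1)) e (proj1 He))|
    apply filter_and; [apply (small_mul (2 * C0) (e * (k * k))); apply Rmult_lt_0_compat; [lra|apply Rmult_lt_0_compat; exact Hk]|
                       apply (small_mul (2 * C0) (e * k)); apply Rmult_lt_0_compat; lra]]]]].
  cbv beta. intros s [[Hs Hs1] [[_ HsQ] [[_ HsT] [[_ HsC] [_ HsC']]]]] K HK u v Huv.
  destruct (ss_min _ _ _ _ _ _ _ _ _ HK u v Huv) as [Hu4 Hvu].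
  assert (Hslope := ss_slope _ _ _ _ _ _ _ _ _ HK u v Huv).
  assert (Hu : 0 < u) by lra.
  assert (Hs3 : 0 < s ^ 3) by (apply pow_lt; lra).
  assert (Hs5 : 0 < s ^ 5) by (apply pow_lt; lra).
  assert (Hvv : v * v <= u * u).
  { rewrite <- Rabs_sq. pose proof (Rabs_pos v). apply Rmult_le_compat; assumption. }
  set (r := sqrt (u * u + v * v)).
  assert (Hr : r * r = u * u + v * v) by (apply sqrt_sqrt; nra).
  assert (Hr0 : 0 <= r) by apply sqrt_pos.
  assert (Hur : u <= r) by (apply Rle_of_sq_le; nra).
  rewrite <- exp_plus.
  replace (- ((1 - 8 * e) * D * s) + - ((1 - 8 * e) * D * s))
    with (- (2 * ((1 - 8 * e) * D * s))) by ring.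
  apply real_numer_le; [apply Rdiv_lt_0_compat; lra|nra|exact Hu|].
  rewrite <- Hr. set (m := P / s + Q * s ^ 3 * (r * r)).
  assert (Hm : 0 < m).
  { assert (0 < P / s) by (apply Rdiv_lt_0_compat; lra).
    assert (0 < Q * s ^ 3 * (r * r)); [|unfold m; lra].
    apply Rmult_lt_0_compat; nra. }
  set (B := m * m + r * r + 2 * u * m).
  assert (HB : 0 < B).
  { unfold B. clearbody m. nra. }
  assert (Hl : 0 < s ^ 5 / nu * u).
  { apply Rmult_lt_0_compat; [apply Rdiv_lt_0_compat|]; lra. }
  assert (Hgoal : (1 - 8 * e) * D * s <= 2 * u * m / B + s ^ 5 / (2 * nu) * u).
  { destruct (Rle_lt_dec r (e * (P / s))) as [Hlow|Hhigh];
      [|destruct (Rle_lt_dec m (T * r)) as [Hmid|Hfar]].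
    - assert (H := upper_low_regime e P Q D A s u r He HP HQ HD Hs HDP Hu4 (conj Hu Hur) Hlow).
      assert (Hss : Q * P * s ^ 2 <= 1).
      { eapply Rle_trans; [|exact HsQ]. apply Rmult_le_compat_l; [nra|].
        apply pow_S_le_self; lra. }
      specialize (H Hss). cbv zeta in H. fold m B in H.
      apply Rle_trans with (2 * u * m / B); [apply (Rle_div_r _ _ _ HB); exact H|].
      replace (s ^ 5 / (2 * nu) * u) with (/ 2 * (s ^ 5 / nu * u)) by (field; lra). lra.
    - assert (H := upper_mid_regime e T P Q D s u r).
      cbv zeta in H. fold m B in H.
      assert (H' : (1 - e) * D * s * B <= 2 * u * m) by (apply H; lra).
      apply Rle_trans with (2 * u * m / B).
      + apply (Rle_div_r _ _ _ HB).
        eapply Rle_trans; [|exact H'].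
        apply Rmult_le_compat_r; [lra|]. apply Rmult_le_compat_r; [lra|].
        apply Rmult_le_compat_r; lra.
      + replace (s ^ 5 / (2 * nu) * u) with (/ 2 * (s ^ 5 / nu * u)) by (field; lra). lra.
    - apply (upper_far_regime e nu tau P Q D s u v r); auto.
      assert (Hus : k <= u * s ^ 3).
      { assert (Hp : e * m > P / s).
        { assert (e * e * m > r).
          { apply (Rmult_lt_compat_l (e * e)) in Hfar; [|nra].
            unfold T in Hfar. rewrite <- Rmult_assoc, Rinv_r in Hfar; nra. }
          apply (Rmult_lt_reg_l e); [lra|]. nra. }
        assert (Hq : (1 - e) * m < Q * s ^ 3 * (r * r)) by (unfold m in *; lra).
        assert (Hq' : (1 - e) * (T * r) < Q * s ^ 3 * (r * r)).
        { eapply Rle_lt_trans; [|exact Hq]. apply Rmult_le_compat_l; lra. }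
        assert (Hq2 : (1 - e) * T < Q * s ^ 3 * r).
        { apply (Rmult_lt_reg_r r); lra. }
        assert (r <= 2 * u) by nra.
        unfold k. apply Rle_div_l; [lra|].
        assert (Q * s ^ 3 * r <= Q * s ^ 3 * (2 * u)) by (apply Rmult_le_compat_l; nra).
        lra. }
      assert (H1 : C0 * / (s ^ 5 * u) <= e * u / 2).
      { apply Rle_div_l; [nra|].
        assert (k * k <= u * s ^ 3 * (u * s ^ 3)) by (apply Rmult_le_compat; lra).
        assert (2 * C0 * s <= e * (u * s ^ 3 * (u * s ^ 3))).
        { eapply Rle_trans; [exact HsC|]. apply Rmult_le_compat_l; lra. }
        apply (Rmult_le_reg_r (2 * s)); [lra|].
        replace (e * u / 2 * (s ^ 5 * u) * (2 * s)) with (e * (u * s ^ 3 * (u * s ^ 3))) by field.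
        lra. }
      assert (H2 : C0 <= e * u / 2).
      { assert (s ^ 3 <= s) by (apply pow_S_le_self; lra).
        assert (u * s ^ 3 <= u * s) by (apply Rmult_le_compat_l; lra).
        assert (2 * C0 * s <= e * (u * s)).
        { eapply Rle_trans; [exact HsC'|]. apply Rmult_le_compat_l; lra. }
        apply (Rmult_le_reg_r s); lra. }
      lra. }
  replace (4 * u * m / B) with (2 * (2 * u * m / B)) by (field; lra).
  replace (s ^ 5 / nu * u) with (2 * (s ^ 5 / (2 * nu) * u)) by (field; lra).
  lra.
Qed.

Lemma Cmod_sq (a b : R) : Cmod (a, b) * Cmod (a, b) = a * a + b * b.
Proof.
  unfold Cmod; cbn [fst snd]. rewrite sqrt_sqrt; [ring|].
  apply Rplus_le_le_0_compat; apply pow2_ge_0.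
Qed.

Lemma dot_le_Cmod (a b c d : R) : Rabs (a * c + b * d) <= Cmod (a, b) * Cmod (c, d).
Proof.
  apply Rle_of_sq_le; [apply Rmult_le_pos; apply Cmod_ge_0|].
  rewrite Rabs_sq.
  replace (Cmod (a, b) * Cmod (c, d) * (Cmod (a, b) * Cmod (c, d)))
    with ((Cmod (a, b) * Cmod (a, b)) * (Cmod (c, d) * Cmod (c, d))) by ring.
  rewrite !Cmod_sq. pose proof (Rle_0_sqr (a * d - b * c)). unfold Rsqr in *. lra.
Qed.

Lemma Cmod_le_of_comp (a b B : R) : Rabs a <= B -> Rabs b <= B -> Cmod (a, b) <= 2 * B.
Proof.
  intros Ha Hb. pose proof (Rabs_pos a). apply Rle_of_sq_le; [lra|].
  rewrite Cmod_sq, <- (Rabs_sq a), <- (Rabs_sq b).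
  assert (Rabs a * Rabs a <= B * B) by (apply Rmult_le_compat; lra).
  assert (Rabs b * Rabs b <= B * B) by (apply Rmult_le_compat; try lra; apply Rabs_pos).
  nra.
Qed.

Lemma pairing_gap (K : R -> R -> Prop) (nu eta s : R) (p q : C) (u v : R) :
  0 < nu -> 0 < s -> 0 < eta -> eta * s <= / 2 ->
  admissible K (s ^ 5 / nu) (exp (- (eta * s))) p q -> K u v -> u * s ^ 4 <= eta * nu ->
  let X := symX p q u v in let Y := symY p q u v in
  eta * s / 8 * (X * X + Y * Y + (u * u + v * v)) <= X * u + Y * v.
Proof.
  intros Hnu Hs Heta Hsm Hadm Huv Hu X Y.
  specialize (Hadm u v Huv).
  assert (Hy : 0 <= eta * s) by nra.
  assert (Hnum : numer p q u v <= exp (- (eta * s)) * denom p q u v).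
  { eapply Rle_trans; [exact Hadm|]. apply Rmult_le_compat_r; [apply denom_ge0|].
    rewrite <- !exp_plus.
    assert (Hle : s ^ 5 / nu * u <= eta * s).
    { replace (s ^ 5 / nu * u) with (u * s ^ 4 * s / nu) by (field; lra).
      apply Rle_div_l; [lra|]. nra. }
    assert (H : - (eta * s) + - (eta * s) + s ^ 5 / nu * u <= - (eta * s)) by lra.
    destruct H as [H|H]; [apply Rlt_le, exp_increasing, H|rewrite H; lra]. }
  assert (Hgap := gap_of_numer_le p q u v (eta * s) Hy Hnum).
  fold X Y in Hgap.
  assert (Hden : denom p q u v = X * X + Y * Y + (u * u + v * v) + 2 * (X * u + Y * v)).
  { unfold denom. fold X Y. ring. }
  pose proof (denom_ge0 p q u v) as Hd0.
  set (y := eta * s) in *.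
  assert (Hy2 : y / 2 <= y - y ^ 2) by nra.
  assert (H1 : y / 2 * denom p q u v <= 4 * (X * u + Y * v)).
  { eapply Rle_trans; [|exact Hgap]. apply Rmult_le_compat_r; assumption. }
  assert (0 <= y / 2 * denom p q u v) by (apply Rmult_le_pos; lra).
  assert (0 <= X * u + Y * v) by lra.
  rewrite Hden in H1.
  assert (0 <= y * (X * u + Y * v)) by (apply Rmult_le_pos; lra).
  lra.
Qed.

Lemma gap_upper (sg X Y u v : R) :
  0 < sg -> Rabs v <= u -> sg * (X * X + Y * Y + (u * u + v * v)) <= X * u + Y * v ->
  Rabs X <= 2 * u / sg /\ Rabs Y <= 2 * u / sg.
Proof.
  intros Hsg Hv H.
  assert (Hu : 0 <= u) by (pose proof (Rabs_pos v); lra).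
  assert (Hvv : v * v <= u * u).
  { rewrite <- Rabs_sq. pose proof (Rabs_pos v). apply Rmult_le_compat; assumption. }
  assert (Hsq : (sg * X) * (sg * X) + (sg * Y) * (sg * Y) <= 2 * u * (2 * u)).
  { pose proof (Rle_0_sqr (sg * X - u)). pose proof (Rle_0_sqr (sg * Y - v)). unfold Rsqr in *.
    apply (Rmult_le_compat_l sg) in H; [|lra].
    assert (0 <= sg * sg * (u * u + v * v)) by (apply Rmult_le_pos; nra). nra. }
  assert (Hz : forall z, (sg * z) * (sg * z) <= 2 * u * (2 * u) -> Rabs z <= 2 * u / sg).
  { intros z Hz. apply (Rle_div_r _ _ _ Hsg).
    apply Rle_of_sq_le; [lra|].
    replace (Rabs z * sg * (Rabs z * sg)) with ((Rabs z * Rabs z) * (sg * sg)) by ring.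
    rewrite Rabs_sq. lra. }
  pose proof (Rle_0_sqr (sg * X)). pose proof (Rle_0_sqr (sg * Y)). unfold Rsqr in *.
  split; apply Hz; lra.
Qed.

Lemma gap_lower (sg X Y u v : R) :
  0 < sg -> sg * (X * X + Y * Y + (u * u + v * v)) <= X * u + Y * v ->
  sg * Cmod (u, v) <= Cmod (X, Y) /\
  2 * sg * (Cmod (X, Y) * Cmod (u, v)) <= X * u + Y * v.
Proof.
  intros Hsg H.
  pose proof (Rle_trans _ _ _ (Rle_abs _) (dot_le_Cmod X Y u v)) as Hdot.
  rewrite <- (Cmod_sq X Y), <- (Cmod_sq u v) in H.
  pose proof (Cmod_ge_0 (X, Y)) as Ha. pose proof (Cmod_ge_0 (u, v)) as Hb.
  set (a := Cmod (X, Y)) in *. set (b := Cmod (u, v)) in *.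
  split.
  - apply Rnot_lt_le. intros Hlt.
    destruct Hb as [Hb|Hb]; [|rewrite <- Hb in Hlt; lra].
    apply (Rmult_lt_compat_r b) in Hlt; [|exact Hb].
    assert (0 <= sg * (a * a)) by (apply Rmult_le_pos; [lra|apply Rle_0_sqr]). lra.
  - eapply Rle_trans; [|exact H]. pose proof (Rle_0_sqr (a - b)). unfold Rsqr in *. nra.
Qed.

Lemma symbol_Cmod (p1 p2 q1 q2 u v : R) :
  let X := symX (p1, p2) (q1, q2) u v in let Y := symY (p1, p2) (q1, q2) u v in
  Cmod (q1, q2) * (u * u + v * v) <= Cmod (X, Y) + Cmod (p1, p2) /\
  Cmod (X, Y) <= Cmod (q1, q2) * (u * u + v * v) + Cmod (p1, p2).
Proof.
  intros X Y.
  set (w := (q1 * (u * u - v * v) - q2 * (2 * u * v), q1 * (2 * u * v) + q2 * (u * u - v * v))).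
  assert (Hw : Cmod w = Cmod (q1, q2) * (u * u + v * v)).
  { replace (u * u + v * v) with (Cmod (u * u - v * v, 2 * u * v)).
    - rewrite <- Cmod_mult. f_equal.
    - assert (0 <= u * u + v * v) by nra.
      pose proof (Cmod_ge_0 (u * u - v * v, 2 * u * v)).
      apply Rle_antisym; apply Rle_of_sq_le; auto; rewrite Cmod_sq; lra. }
  assert (HP : (X, Y) = Cplus (p1, p2) w).
  { unfold X, Y, w, symX, symY, Cplus; simpl. f_equal; ring. }
  rewrite <- Hw, HP. split.
  - replace w with (Cplus (Cplus (p1, p2) w) (Copp (p1, p2))) at 1
      by (unfold w, Cplus, Copp; simpl; f_equal; ring).
    rewrite <- (Cmod_opp (p1, p2)). apply Cmod_triangle.
  - rewrite Rplus_comm. apply Cmod_triangle.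
Qed.

Lemma pairing_expand (p1 p2 q1 q2 u v : R) :
  symX (p1, p2) (q1, q2) u v * u + symY (p1, p2) (q1, q2) u v * v
  = p1 * u + p2 * v + (u * u + v * v) * (q1 * u - q2 * v).
Proof. unfold symX, symY; simpl; ring. Qed.

(* Where the constant term [p] is negligible, positivity of [Re (P conj f)] with a margin is
   positivity of [Re (q f)] with a margin. *)
Lemma gap_direction (sg p1 p2 q1 q2 u v : R) :
  0 < sg <= / 2 -> 0 < u ->
  let X := symX (p1, p2) (q1, q2) u v in let Y := symY (p1, p2) (q1, q2) u v in
  sg * (X * X + Y * Y + (u * u + v * v)) <= X * u + Y * v ->
  5 * Cmod (p1, p2) + 1 <= sg * sg * u ->
  4 * Cmod (p1, p2) + 1 <= sg * (Cmod (q1, q2) * (u * u + v * v)) /\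
  sg * Cmod (q1, q2) * u <= q1 * u - q2 * v.
Proof.
  intros Hsg Hu X Y H Hp.
  destruct (gap_lower sg X Y u v (proj1 Hsg) H) as [Hlow Hpair].
  destruct (symbol_Cmod p1 p2 q1 q2 u v) as [Hsym1 Hsym2]. fold X Y in Hsym1, Hsym2.
  assert (Hexp := pairing_expand p1 p2 q1 q2 u v). fold X Y in Hexp. rewrite Hexp in Hpair.
  assert (Hdot := Rle_trans _ _ _ (Rle_abs _) (dot_le_Cmod p1 p2 u v)).
  assert (Hr := Cmod_sq u v).
  pose proof (Cmod_ge_0 (p1, p2)) as Hp0. pose proof (Cmod_ge_0 (q1, q2)) as Hq0.
  assert (Hru : u <= Cmod (u, v)).
  { apply Rle_of_sq_le; [apply Cmod_ge_0|]. rewrite Hr. nra. }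
  rewrite <- Hr in *.
  set (r := Cmod (u, v)) in *. set (nP := Cmod (X, Y)) in *.
  set (np := Cmod (p1, p2)) in *. set (nq := Cmod (q1, q2)) in *.
  assert (HE : 4 * np + 1 <= sg * (nq * (r * r))).
  { assert (sg * r - np <= nq * (r * r)) by lra.
    assert (sg * (sg * r - np) <= sg * (nq * (r * r))) by (apply Rmult_le_compat_l; lra).
    assert (sg * sg * u <= sg * sg * r) by (apply Rmult_le_compat_l; nra). nra. }
  split; [exact HE|].
  set (w := q1 * u - q2 * v) in *.
  assert (H1 : 2 * sg * (nq * (r * r) - np) <= 2 * sg * nP).
  { apply Rmult_le_compat_l; lra. }
  assert (H2 : 2 * sg * (nq * (r * r) - np) * r <= 2 * sg * (nP * r)).
  { rewrite <- (Rmult_assoc (2 * sg)). apply Rmult_le_compat_r; lra. }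
  assert (H3 : (2 * sg * (nq * (r * r) - np) - np) * r <= (r * w) * r) by lra.
  apply Rmult_le_reg_r in H3; [|lra].
  assert (H4 : sg * (nq * (r * r)) <= r * w).
  { assert (sg * np <= / 2 * np) by (apply Rmult_le_compat_r; lra). lra. }
  assert (H5 : (sg * nq * r) * r <= w * r) by lra.
  apply Rmult_le_reg_r in H5; [|lra].
  assert (sg * nq * u <= sg * nq * r); [|lra].
  apply Rmult_le_compat_l; [|exact Hru]. apply Rmult_le_pos; lra.
Qed.

Lemma conj_pair_bounds (p1 p2 q1 q2 U V b : R) :
  0 < U -> 0 < V ->
  Rabs (symX (p1, p2) (q1, q2) U V) <= b -> Rabs (symY (p1, p2) (q1, q2) U V) <= b ->
  Rabs (symX (p1, p2) (q1, q2) U (- V)) <= b -> Rabs (symY (p1, p2) (q1, q2) U (- V)) <= b ->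
  let B := b * (1 + Rabs (U * U - V * V) / (2 * U * V)) in
  Rabs p1 <= B /\ Rabs p2 <= B.
Proof.
  intros HU HV H1 H2 H3 H4 B.
  unfold symX, symY in H1, H2, H3, H4; cbn [Re Im fst snd] in H1, H2, H3, H4.
  apply Rabs_le_between in H1, H2, H3, H4.
  set (a := U * U - V * V) in *.
  replace (U * U - - V * - V) with a in * by (unfold a; ring).
  set (t := 2 * U * V) in *.
  replace (2 * U * - V) with (- t) in * by (unfold t; ring).
  assert (Ht : 0 < t) by (unfold t; apply Rmult_lt_0_compat; lra).
  assert (Hq : forall x, - b <= x * t <= b -> Rabs (x * a) <= b * (Rabs a / t)).
  { intros x Hx. rewrite Rabs_mult.
    replace (b * (Rabs a / t)) with (b / t * Rabs a) by (field; lra).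
    apply Rmult_le_compat_r; [apply Rabs_pos|].
    apply (Rle_div_r _ _ _ Ht). rewrite <- (Rabs_pos_eq t) at 1 by lra.
    rewrite <- Rabs_mult. apply Rabs_le_between. lra. }
  assert (Hq1 := Hq q1 ltac:(lra)). assert (Hq2 := Hq q2 ltac:(lra)).
  apply Rabs_le_between in Hq1, Hq2.
  unfold B. fold a t. split; apply Rabs_le_between; lra.
Qed.

(* Far out, where the weight makes the constraint non-convex, positivity of [Re (P conj f)] is
   inherited from the two extreme directions [(ug, vg)] and [(ug, - vg)]. *)
Lemma pairing_pos_far (sg tau C0 s p1 p2 q1 q2 ug vg u v : R) :
  0 < sg -> 0 <= tau -> 0 < C0 -> 0 < s -> 0 < ug -> 2 * ug <= u ->
  Rabs vg <= ug -> Rabs v <= u -> tau * ug - C0 <= vg ->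
  Rabs v <= tau * u + C0 * (/ (s ^ 5 * u) + 1) ->
  C0 * (u / ug + / (s ^ 5 * u) + 1) <= sg / 2 * u ->
  4 * Cmod (p1, p2) + 1 <= sg * (Cmod (q1, q2) * (ug * ug + vg * vg)) ->
  sg * Cmod (q1, q2) * ug <= q1 * ug - Rabs q2 * vg ->
  0 < p1 * u + p2 * v + (u * u + v * v) * (q1 * u - q2 * v).
Proof.
  intros Hsg Htau HC0 Hs Hug Hu Hvg Hvu Htg Hsl Hsmall HE Hdir.
  assert (Hu0 : 0 < u) by lra.
  pose proof (Cmod_ge_0 (p1, p2)) as Hp0. pose proof (Cmod_ge_0 (q1, q2)) as Hq0.
  assert (Hq2 : Rabs q2 <= Cmod (q1, q2)).
  { apply Rle_of_sq_le; [exact Hq0|]. rewrite Cmod_sq, Rabs_sq. nra. }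
  pose proof (Rabs_pos q2) as Hq20.
  assert (Hdot := dot_le_Cmod p1 p2 u v). apply Rabs_le_between in Hdot.
  assert (Hr := Cmod_sq u v).
  assert (Hru : u <= Cmod (u, v)).
  { apply Rle_of_sq_le; [apply Cmod_ge_0|]. rewrite Hr. nra. }
  assert (Hvv : v * v <= u * u).
  { rewrite <- Rabs_sq. pose proof (Rabs_pos v). apply Rmult_le_compat; assumption. }
  assert (Hvvg : vg * vg <= ug * ug).
  { rewrite <- (Rabs_sq vg). pose proof (Rabs_pos vg). apply Rmult_le_compat; assumption. }
  assert (Hr2 : Cmod (u, v) <= 2 * u).
  { apply Rle_of_sq_le; [lra|]. rewrite Hr. nra. }
  set (np := Cmod (p1, p2)) in *. set (nq := Cmod (q1, q2)) in *. set (r := Cmod (u, v)) in *.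
  set (w := q1 * u - q2 * v).
  assert (Hw : sg / 2 * nq * u <= w).
  { assert (Hqv : q2 * v <= Rabs q2 * Rabs v) by (rewrite <- Rabs_mult; apply Rle_abs).
    assert (Hqv' : Rabs q2 * Rabs v <= Rabs q2 * (tau * u + C0 * (/ (s ^ 5 * u) + 1)))
      by (apply Rmult_le_compat_l; assumption).
    assert (Hqg : Rabs q2 * (tau * ug - C0) <= Rabs q2 * vg)
      by (apply Rmult_le_compat_l; assumption).
    assert (H1 : (sg * nq + Rabs q2 * tau) * ug - Rabs q2 * C0 <= q1 * ug) by lra.
    apply (Rmult_le_compat_r (u / ug)) in H1; [|apply Rlt_le, Rdiv_lt_0_compat; lra].
    replace (q1 * ug * (u / ug)) with (q1 * u) in H1 by (field; lra).
    replace (((sg * nq + Rabs q2 * tau) * ug - Rabs q2 * C0) * (u / ug))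
      with ((sg * nq + Rabs q2 * tau) * u - Rabs q2 * (C0 * (u / ug))) in H1 by (field; lra).
    assert (H2 : Rabs q2 * (C0 * (u / ug + / (s ^ 5 * u) + 1)) <= nq * (sg / 2 * u)).
    { assert (0 < s ^ 5 * u) by (apply Rmult_lt_0_compat; [apply pow_lt|]; lra).
      assert (0 < / (s ^ 5 * u)) by (apply Rinv_0_lt_compat; lra).
      assert (0 < u / ug) by (apply Rdiv_lt_0_compat; lra).
      apply Rmult_le_compat; auto. apply Rmult_le_pos; lra. }
    unfold w. lra. }
  assert (Hrr : 2 * (ug * ug + vg * vg) <= r * r) by (rewrite Hr; nra).
  assert (Hbig : 2 * np + / 2 <= sg / 4 * nq * (r * r)).
  { assert (sg * nq / 4 * (2 * (ug * ug + vg * vg)) <= sg * nq / 4 * (r * r)).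
    { apply Rmult_le_compat_l; [|exact Hrr]. apply Rmult_le_pos; [nra|lra]. }
    lra. }
  assert (Hw2 : sg / 4 * nq * r <= w).
  { eapply Rle_trans; [|exact Hw].
    replace (sg / 2 * nq * u) with (sg / 4 * nq * (2 * u)) by field.
    apply Rmult_le_compat_l; [|exact Hr2]. apply Rmult_le_pos; lra. }
  assert (Hrw : r * r * (sg / 4 * nq * r) <= r * r * w).
  { apply Rmult_le_compat_l; [apply Rle_0_sqr|exact Hw2]. }
  assert (Hfin : (2 * np + / 2) * r <= r * r * w).
  { eapply Rle_trans; [|exact Hrw].
    replace (r * r * (sg / 4 * nq * r)) with (sg / 4 * nq * (r * r) * r) by ring.
    apply Rmult_le_compat_r; lra. }
  rewrite Hr in Hfin.
  assert (0 <= np * r) by (apply Rmult_le_pos; lra). lra.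
Qed.

Lemma near_optimal_control (nu A v1 U1 V1 tau C0 c0 eta : R) :
  0 < nu -> 0 < A -> 0 <= tau <= 1 -> 0 < C0 -> 0 < c0 -> 0 < U1 -> 0 < V1 -> 0 < eta ->
  exists Cb : R, 0 < Cb /\ at_right 0 (fun s => forall K, scaled_set A v1 U1 V1 tau C0 c0 s K ->
    forall p q, admissible K (s ^ 5 / nu) (exp (- (eta * s))) p q ->
    (Rabs (Re p) <= Cb / s /\ Rabs (Im p) <= Cb / s /\
     Rabs (Re q) <= Cb * s ^ 3 /\ Rabs (Im q) <= Cb * s ^ 3) /\
    forall u v, K u v -> 0 < symX p q u v * u + symY p q u v * v).
Proof.
  intros Hnu HA Htau HC0 Hc0 HU1 HV1 Heta.
  set (th := eta * nu / 2). assert (Hth : 0 < th) by (unfold th; nra).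
  set (Cp := 16 * U1 / eta * (1 + Rabs (U1 * U1 - V1 * V1) / (2 * U1 * V1))).
  assert (HCp : 0 < Cp).
  { apply Rmult_lt_0_compat; [apply Rdiv_lt_0_compat; lra|].
    assert (0 <= Rabs (U1 * U1 - V1 * V1) / (2 * U1 * V1)); [|lra].
    apply Rmult_le_pos; [apply Rabs_pos|apply Rlt_le, Rinv_0_lt_compat; nra]. }
  set (Cq := 2 * (16 / (eta * th)) + 2 * Cp / (th * th)).
  assert (Hetath : 0 < eta * th) by nra. assert (Hthth : 0 < th * th) by nra.
  assert (HCq : 0 < Cq).
  { unfold Cq. assert (0 < 16 / (eta * th)) by (apply Rdiv_lt_0_compat; lra).
    assert (0 < 2 * Cp / (th * th)) by (apply Rdiv_lt_0_compat; lra). lra. }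
  exists (Cp + 2 * Cq). split; [lra|].
  assert (Hz1 : 0 < eta * eta * th / 64).
  { apply Rdiv_lt_0_compat; [apply Rmult_lt_0_compat; [nra|exact Hth]|lra]. }
  eapply filter_imp; [|apply filter_and; [exact (small_mul 1 1 Rlt_0_1)|
    apply filter_and; [apply (small_mul eta (/ 2)); lra|
    apply filter_and; [exact (small_mul U1 th Hth)|
    apply filter_and; [exact (small_mul th c0 Hc0)|
    apply filter_and; [exact (small_mul (10 * Cp + 1) _ Hz1)|
    apply filter_and; [exact (small_mul U1 (eta * nu) ltac:(nra))|
      apply (small_mul (C0 * (2 / th + / (th * th))) (eta / 16)); lra]]]]]]].
  cbv beta.
  intros s [[Hs Hs1] [[_ Hseta] [[_ HsU] [[_ Hsc] [[_ HsCp] [[_ HsU'] [_ HsC0]]]]]]] K HK p q Hadm.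
  assert (Hgap := fun u v => pairing_gap K nu eta s p q u v Hnu Hs Heta Hseta Hadm).
  cbv zeta in Hgap.
  destruct p as [p1 p2], q as [q1 q2].
  set (sg := eta * s / 8) in *. assert (Hsg : 0 < sg <= / 2) by (unfold sg; nra).
  assert (Hs4 : 0 < s ^ 4) by (apply pow_lt; lra).
  assert (Hs4s : s ^ 4 <= s) by (apply pow_S_le_self; lra).
  assert (Hmin := ss_min _ _ _ _ _ _ _ _ _ HK).
  assert (Hconj := ss_conj _ _ _ _ _ _ _ _ _ HK).
  assert (Hp : Rabs p1 <= Cp / s /\ Rabs p2 <= Cp / s).
  { assert (Hfix := ss_fix _ _ _ _ _ _ _ _ _ HK). assert (Hfix' := Hconj _ _ Hfix).
    assert (HU : U1 * s ^ 4 <= eta * nu) by nra.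
    destruct (Hmin _ _ Hfix) as [_ Hb1]. destruct (Hmin _ _ Hfix') as [_ Hb2].
    destruct (gap_upper _ _ _ _ _ (proj1 Hsg) Hb1 (Hgap _ _ Hfix HU)) as [G1 G2].
    destruct (gap_upper _ _ _ _ _ (proj1 Hsg) Hb2 (Hgap _ _ Hfix' HU)) as [G3 G4].
    destruct (conj_pair_bounds p1 p2 q1 q2 U1 V1 (2 * U1 / sg) HU1 HV1 G1 G2 G3 G4) as [B1 B2].
    replace (Cp / s)
      with (2 * U1 / sg * (1 + Rabs (U1 * U1 - V1 * V1) / (2 * U1 * V1)))
      by (unfold Cp, sg; field; repeat split; lra).
    split; assumption. }
  assert (Hnp : Cmod (p1, p2) <= 2 * (Cp / s)) by (apply Cmod_le_of_comp; apply Hp).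
  set (ug := th / s ^ 4).
  assert (Hug : ug * s ^ 4 = th) by (unfold ug; field; lra).
  assert (Hug0 : 0 < ug) by (apply Rdiv_lt_0_compat; assumption).
  destruct (ss_far _ _ _ _ _ _ _ _ _ HK ug) as [vg [Hg [Hvg0 Hvgt]]].
  { apply (Rle_div_r _ _ _ Hs4). nra. }
  { replace (ug * s ^ 5) with (ug * s ^ 4 * s) by ring. rewrite Hug. exact Hsc. }
  apply Rabs_le_between in Hvgt.
  assert (Hg' := Hconj _ _ Hg).
  assert (Hugle : ug * s ^ 4 <= eta * nu) by (rewrite Hug; unfold th; nra).
  assert (Hmag : 5 * Cmod (p1, p2) + 1 <= sg * sg * ug).
  { apply Rle_trans with (5 * (2 * (Cp / s)) + 1); [lra|].
    replace (sg * sg * ug) with (eta * eta * th / 64 / (s * s))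
      by (unfold sg, ug; field; lra).
    apply Rle_div_r; [nra|].
    replace ((5 * (2 * (Cp / s)) + 1) * (s * s)) with (10 * Cp * s + s * s) by (field; lra).
    nra. }
  destruct (gap_direction sg p1 p2 q1 q2 ug vg Hsg Hug0 (Hgap _ _ Hg Hugle) Hmag) as [HE D1].
  destruct (gap_direction sg p1 p2 q1 q2 ug (- vg) Hsg Hug0 (Hgap _ _ Hg' Hugle) Hmag) as [_ D2].
  destruct (Hmin _ _ Hg) as [_ Hvgu].
  assert (Hdir : sg * Cmod (q1, q2) * ug <= q1 * ug - Rabs q2 * vg).
  { unfold Rabs. destruct (Rcase_abs q2); lra. }
  split.
  - cbn [Re Im fst snd].
    assert (Hqq : Cmod (q1, q2) <= 2 * Cq * s ^ 3).
    { destruct (gap_upper _ _ _ _ _ (proj1 Hsg) Hvgu (Hgap _ _ Hg Hugle)) as [G1 G2].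
      destruct (symbol_Cmod p1 p2 q1 q2 ug vg) as [Hsym _].
      assert (HnP := Cmod_le_of_comp _ _ _ G1 G2).
      assert (H1 : Cmod (q1, q2) * (ug * ug) <= 2 * (2 * ug / sg) + 2 * (Cp / s)).
      { assert (Cmod (q1, q2) * (ug * ug) <= Cmod (q1, q2) * (ug * ug + vg * vg)).
        { apply Rmult_le_compat_l; [apply Cmod_ge_0|]. pose proof (Rle_0_sqr vg).
          unfold Rsqr in *; lra. }
        lra. }
      assert (Hugug : 0 < ug * ug) by nra.
      apply (Rle_div_r _ _ _ Hugug) in H1. eapply Rle_trans; [exact H1|].
      replace ((2 * (2 * ug / sg) + 2 * (Cp / s)) / (ug * ug))
        with (2 * (16 / (eta * th)) * s ^ 3 + 2 * (Cp / (th * th)) * (s ^ 3 * s ^ 4))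
        by (unfold ug, sg; field; lra).
      assert (Hs3 : 0 < s ^ 3) by (apply pow_lt; lra).
      assert (H2 : s ^ 3 * s ^ 4 <= s ^ 3 * 1) by (apply Rmult_le_compat_l; lra).
      assert (H3 : 0 < Cp / (th * th)) by (apply Rdiv_lt_0_compat; lra).
      apply (Rmult_le_compat_l (Cp / (th * th))) in H2; [|lra].
      replace (2 * Cq * s ^ 3)
        with (2 * (2 * (16 / (eta * th))) * s ^ 3 + 4 * (Cp / (th * th) * (s ^ 3 * 1)))
        by (unfold Cq; field; lra).
      assert (0 < 16 / (eta * th) * s ^ 3)
        by (apply Rmult_lt_0_compat; [apply Rdiv_lt_0_compat|]; lra).
      assert (0 < Cp / (th * th) * (s ^ 3 * 1)) by (apply Rmult_lt_0_compat; lra).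
      lra. }
    assert (Hs3 : 0 < s ^ 3) by (apply pow_lt; lra).
    assert (Hcs : 0 < Cp * s ^ 3) by (apply Rmult_lt_0_compat; lra).
    assert (Hqs : 0 < Cq / s) by (apply Rdiv_lt_0_compat; lra).
    assert (Hcomp : forall x, x * x <= q1 * q1 + q2 * q2 -> Rabs x <= (Cp + 2 * Cq) * s ^ 3).
    { intros x Hx. apply Rle_trans with (Cmod (q1, q2)); [|lra].
      apply Rle_of_sq_le; [apply Cmod_ge_0|]. rewrite Cmod_sq, Rabs_sq. exact Hx. }
    replace ((Cp + 2 * Cq) / s) with (Cp / s + 2 * (Cq / s)) by (field; lra).
    repeat split; try lra; apply Hcomp; nra.
  - intros u v Huv. destruct (Hmin _ _ Huv) as [Hu4 Hvu].
    assert (Hu0 : 0 < u) by lra.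
    destruct (Rle_lt_dec (u * s ^ 4) (eta * nu)) as [Hle|Hlt].
    + eapply Rlt_le_trans; [|exact (Hgap _ _ Huv Hle)].
      apply Rmult_lt_0_compat; [lra|].
      pose proof (Rle_0_sqr (symX (p1, p2) (q1, q2) u v)).
      pose proof (Rle_0_sqr (symY (p1, p2) (q1, q2) u v)). unfold Rsqr in *. nra.
    + rewrite pairing_expand.
      assert (Hu2 : 2 * ug <= u).
      { apply (Rmult_le_reg_r (s ^ 4)); [lra|]. unfold th in Hug. lra. }
      apply (pairing_pos_far sg tau C0 s p1 p2 q1 q2 ug vg u v); try lra; auto.
      * apply (ss_slope _ _ _ _ _ _ _ _ _ HK u v Huv).
      * assert (Hu1 : ug <= u) by lra.
        assert (Hs5 : 0 < s ^ 5) by (apply pow_lt; lra).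
        assert (Hinv : / ug = s ^ 4 / th) by (unfold ug; field; lra).
        assert (H1 : / u <= s ^ 4 / th).
        { rewrite <- Hinv. apply Rinv_le_contravar; lra. }
        assert (Hiu : 0 < / u) by (apply Rinv_0_lt_compat; lra).
        assert (H2 : / u * / u <= s ^ 4 / th * (s ^ 4 / th)) by (apply Rmult_le_compat; lra).
        assert (H3 : C0 * (/ ug + / s ^ 5 * (/ u * / u) + / u) <= sg / 2).
        { rewrite Hinv.
          assert (/ s ^ 5 * (/ u * / u) <= / s ^ 5 * (s ^ 4 / th * (s ^ 4 / th))).
          { apply Rmult_le_compat_l; [apply Rlt_le, Rinv_0_lt_compat; lra|exact H2]. }
          replace (/ s ^ 5 * (s ^ 4 / th * (s ^ 4 / th))) with (s ^ 3 / (th * th)) in H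
            by (field; lra).
          apply Rle_trans with (C0 * (s ^ 4 / th + s ^ 3 / (th * th) + s ^ 4 / th)).
          { apply Rmult_le_compat_l; lra. }
          apply Rle_trans with (C0 * (2 / th + / (th * th)) * (s * s)).
          { replace (C0 * (s ^ 4 / th + s ^ 3 / (th * th) + s ^ 4 / th))
              with (C0 * (s * s) * (2 / th * (s * s) + / (th * th) * s)) by (field; lra).
            replace (C0 * (2 / th + / (th * th)) * (s * s))
              with (C0 * (s * s) * (2 / th * 1 + / (th * th) * 1)) by (field; lra).
            assert (0 < 2 / th) by (apply Rdiv_lt_0_compat; lra).
            assert (0 < / (th * th)) by (apply Rinv_0_lt_compat; lra).
            assert (0 <= s * s <= 1) by (clear -Hs Hs1; nra).
            apply Rmult_le_compat_l; [apply Rmult_le_pos; lra|].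
            apply Rplus_le_compat; apply Rmult_le_compat_l; lra. }
          unfold sg. rewrite <- Rmult_assoc.
          apply Rle_trans with (eta / 16 * s); [apply Rmult_le_compat_r; lra|lra]. }
        apply (Rmult_le_compat_r u) in H3; [|lra].
        replace (C0 * (/ ug + / s ^ 5 * (/ u * / u) + / u) * u)
          with (C0 * (u / ug + / (s ^ 5 * u) + 1)) in H3 by (field; repeat split; lra).
        exact H3.
Qed.

Lemma real_gap (K : R -> R -> Prop) (l d0 eps y p q u v : R) :
  admissible K l (exp (- d0)) (RtoC p) (RtoC q) -> K u v ->
  0 <= y <= eps -> y <= 2 * d0 - l * u ->
  (1 - eps) * y * denom (RtoC p) (RtoC q) u v <= 4 * (u * (p + q * (u * u + v * v))).
Proof.
  intros Hadm Huv Hy Hyl. specialize (Hadm u v Huv).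
  assert (H : numer (RtoC p) (RtoC q) u v <= exp (- y) * denom (RtoC p) (RtoC q) u v).
  { eapply Rle_trans; [exact Hadm|]. apply Rmult_le_compat_r; [apply denom_ge0|].
    rewrite <- !exp_plus.
    assert (Hle : - d0 + - d0 + l * u <= - y) by lra.
    destruct Hle as [Hle|Hle]; [apply Rlt_le, exp_increasing, Hle|rewrite Hle; lra]. }
  apply gap_of_numer_le in H; [|lra]. rewrite real_pairing in H.
  eapply Rle_trans; [|exact H]. apply Rmult_le_compat_r; [apply denom_ge0|]. nra.
Qed.

Lemma quadratic_bound (eps x : R) :
  0 < eps <= / 20 -> (1 - 3 * eps) * (x * x) - x <= eps -> x <= 1 + 10 * eps.
Proof.
  intros He H. apply Rnot_lt_le. intros Hx.
  assert (H1 : (1 - 3 * eps) * (1 + 10 * eps) <= (1 - 3 * eps) * x)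
    by (apply Rmult_le_compat_l; lra).
  assert (H2 : 5 * eps <= (1 - 3 * eps) * x - 1) by nra.
  assert (H3 : 1 * (5 * eps) <= x * ((1 - 3 * eps) * x - 1)) by (apply Rmult_le_compat; lra).
  lra.
Qed.

Lemma Rabs_mult_le (a b B C : R) : Rabs a <= B -> Rabs b <= C -> Rabs (a * b) <= B * C.
Proof.
  intros Ha Hb. rewrite Rabs_mult. apply Rmult_le_compat; auto using Rabs_pos.
Qed.

Lemma test_low (P Q D A s x y u v eps Cx Cy : R) :
  0 < eps <= / 20 -> 0 < P -> 0 < Q -> 0 < D -> 0 < s <= 1 -> 0 < u ->
  2 * (D * P) = A -> A = 4 * u -> Rabs x <= Cx -> Rabs y <= Cy ->
  (Cy * Q * (u * u + v * v) + 2 * Cx * (u + Cy * Q * (u * u + v * v))) * s <= P * eps ->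
  (1 - 3 * eps) * (2 * D * s) * denom (RtoC (x * P / s)) (RtoC (y * (Q * s ^ 3))) u v
    <= 4 * (u * (x * P / s + y * (Q * s ^ 3) * (u * u + v * v))) ->
  x <= 1 + 10 * eps.
Proof.
  intros He HP HQ HD Hs Hu HDP HAu Hx Hy Hsm H.
  set (R2 := u * u + v * v) in *.
  assert (HR : 0 < R2) by (unfold R2; nra).
  set (al := s * u + y * Q * s ^ 4 * (u * u - v * v)).
  assert (Hs4 : 0 < s ^ 4) by (apply pow_lt; lra).
  assert (Hs4s : s ^ 4 <= s) by (apply pow_S_le_self; lra).
  assert (Hd : (x * P + al) * (x * P + al) <= s * s *
            denom (RtoC (x * P / s)) (RtoC (y * (Q * s ^ 3))) u v).
  { unfold denom. rewrite (Rmult_plus_distr_l (s * s)).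
    replace (s * s * ((symX (RtoC (x * P / s)) (RtoC (y * (Q * s ^ 3))) u v + u) *
             (symX (RtoC (x * P / s)) (RtoC (y * (Q * s ^ 3))) u v + u)))
      with ((x * P + al) * (x * P + al)) by (unfold symX, al, RtoC; simpl; field; lra).
    match goal with |- ?a <= ?a + ?b => assert (0 <= b); [|lra] end.
    apply Rmult_le_pos; apply Rle_0_sqr. }
  apply (Rmult_le_compat_l s) in H; [|lra].
  replace (s * (4 * (u * (x * P / s + y * (Q * s ^ 3) * R2))))
    with (A * (x * P + y * Q * s ^ 4 * R2)) in H by (rewrite HAu; field; lra).
  assert (H1 : (1 - 3 * eps) * (2 * D) * ((x * P + al) * (x * P + al))
               <= A * (x * P + y * Q * s ^ 4 * R2)).
  { eapply Rle_trans; [|exact H].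
    apply (Rmult_le_compat_l ((1 - 3 * eps) * (2 * D))) in Hd; [|apply Rmult_le_pos; lra]. lra. }
  rewrite <- HDP in H1.
  assert (H2 : (1 - 3 * eps) * ((x * P + al) * (x * P + al)) <= P * (x * P + y * Q * s ^ 4 * R2)).
  { apply (Rmult_le_reg_l (2 * D)); lra. }
  assert (Hyq : Rabs (y * Q * s ^ 4) <= Cy * Q * s).
  { apply Rabs_mult_le; [apply Rabs_mult_le|]; auto; rewrite Rabs_pos_eq; lra. }
  assert (Hal : Rabs al <= s * (u + Cy * Q * R2)).
  { unfold al. eapply Rle_trans; [apply Rabs_triang|].
    rewrite (Rabs_pos_eq (s * u)) by nra.
    assert (Hd2 : Rabs (u * u - v * v) <= R2) by (apply Rabs_le_between; unfold R2; nra).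
    pose proof (Rabs_mult_le _ _ _ _ Hyq Hd2). lra. }
  assert (Hbe : Rabs (y * Q * s ^ 4 * R2) <= Cy * Q * s * R2).
  { apply Rabs_mult_le; [exact Hyq|]. rewrite Rabs_pos_eq; lra. }
  assert (Hxal := Rabs_mult_le _ _ _ _ Hx Hal).
  apply Rabs_le_between in Hbe, Hxal.
  apply quadratic_bound; [exact He|].
  apply (Rmult_le_reg_l (P * P)); [nra|].
  assert (Hal2 := Rle_0_sqr al). unfold Rsqr in Hal2.
  assert (H3 : (x * P) * (x * P) + 2 * P * (x * al) <= (x * P + al) * (x * P + al)) by lra.
  apply (Rmult_le_compat_l (1 - 3 * eps)) in H3; [|lra].
  assert (H4 : (1 - 3 * eps) * (- (2 * P * (x * al))) <= 2 * P * (Cx * (s * (u + Cy * Q * R2)))).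
  { apply Rle_trans with (1 * (2 * P * (Cx * (s * (u + Cy * Q * R2))))); [|lra].
    apply Rle_trans with ((1 - 3 * eps) * (2 * P * (Cx * (s * (u + Cy * Q * R2))))).
    - apply Rmult_le_compat_l; [lra|].
      assert (Hx1 := Rmult_le_compat_l (2 * P) _ _ ltac:(lra) (proj1 Hxal)). lra.
    - apply Rmult_le_compat_r; [|lra].
      assert (0 <= Cx * (s * (u + Cy * Q * R2))) by lra.
      apply Rmult_le_pos; lra. }
  assert (H5 : P * (y * Q * s ^ 4 * R2) <= P * (Cy * Q * s * R2)) by (apply Rmult_le_compat_l; lra).
  apply (Rmult_le_compat_l P) in Hsm; [|lra]. lra.
Qed.

Lemma test_far (P Q D nu tau C0 s x y u v eps Cx Cy : R) :
  0 < eps <= / 20 -> 0 < P -> 0 < Q -> 0 < D -> 0 < nu -> 0 <= tau <= 1 -> 0 < C0 ->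
  0 < s <= 1 -> u = nu * D / s ^ 4 ->
  D * D * (nu * Q) * (1 + tau * tau) = 4 -> Rabs x <= Cx -> Rabs y <= Cy ->
  Rabs (v - tau * u) <= C0 ->
  Q * (2 * nu * D * C0 + C0 * C0) * s <= 4 * nu * (eps / 4) ->
  (8 * nu * (2 * Cx * Cy * P) + 4 * nu * (Cx * P)) * s <= 16 * nu * nu * eps ->
  (1 - 3 * eps) * (D * s) * denom (RtoC (x * P / s)) (RtoC (y * (Q * s ^ 3))) u v
    <= 4 * (u * (x * P / s + y * (Q * s ^ 3) * (u * u + v * v))) ->
  y <= 1 + 11 * eps.
Proof.
  intros He HP HQ HD Hnu Htau HC0 Hs Hu HDQ Hx Hy Hv Hsm1 Hsm2 H.
  assert (Hs4 : 0 < s ^ 4) by (apply pow_lt; lra).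
  assert (Hs4s : s ^ 4 <= s) by (apply pow_S_le_self; lra).
  assert (HnuD : 0 < nu * D) by nra.
  assert (Hu0 : 0 < u) by (rewrite Hu; apply Rdiv_lt_0_compat; lra).
  assert (Hus : u * s ^ 4 = nu * D) by (rewrite Hu; field; lra).
  set (R2 := u * u + v * v) in *.
  assert (HR : 0 < R2) by (unfold R2; nra).
  set (rho := Q * (s ^ 4 * s ^ 4 * R2)).
  assert (Hrho : Rabs (rho - 4 * nu) <= 4 * nu * (eps / 4)).
  { set (dl := v - tau * u) in *.
    assert (E : rho - 4 * nu = Q * (2 * nu * D * tau * dl + dl * dl * s ^ 4) * s ^ 4).
    { replace (4 * nu) with (nu * (D * D * (nu * Q) * (1 + tau * tau))) by (rewrite HDQ; ring).
      unfold rho, R2. replace v with (tau * u + dl) by (unfold dl; ring).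
      transitivity (Q * ((u * s ^ 4) * (u * s ^ 4) * (1 + tau * tau)
        + 2 * (u * s ^ 4) * s ^ 4 * tau * dl + dl * dl * s ^ 4 * s ^ 4)
        - nu * (D * D * (nu * Q) * (1 + tau * tau))); [ring|]. rewrite Hus. ring. }
    assert (Hdl2 : Rabs (dl * dl * s ^ 4) <= C0 * C0 * 1).
    { apply Rabs_mult_le; [apply Rabs_mult_le; assumption|]. rewrite Rabs_pos_eq; lra. }
    assert (Hdl1 : Rabs (2 * nu * D * tau * dl) <= 2 * nu * D * 1 * C0).
    { apply Rabs_mult_le; [|assumption]. rewrite Rabs_pos_eq; nra. }
    assert (Hsum : Rabs (2 * nu * D * tau * dl + dl * dl * s ^ 4) <= 2 * nu * D * C0 + C0 * C0).
    { eapply Rle_trans; [apply Rabs_triang|]. lra. }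
    rewrite E. eapply Rle_trans; [|exact Hsm1].
    apply Rabs_mult_le; [apply Rabs_mult_le; [rewrite Rabs_pos_eq; lra|exact Hsum]|].
    rewrite Rabs_pos_eq; lra. }
  apply Rabs_le_between in Hrho.
  assert (Hrho1 : rho <= 8 * nu) by nra.
  assert (Hrho0 : 0 < rho) by nra.
  set (Yv := y * rho).
  assert (Hd : Yv * Yv - 2 * (Rabs x * Rabs y * P) * rho * s ^ 4
               <= s ^ 5 * s ^ 5 * denom (RtoC (x * P / s)) (RtoC (y * (Q * s ^ 3))) u v).
  { assert (Hpair := real_pairing (x * P / s) (y * (Q * s ^ 3)) u v). fold R2 in Hpair.
    set (X := symX (RtoC (x * P / s)) (RtoC (y * (Q * s ^ 3))) u v) in *.
    set (Y := symY (RtoC (x * P / s)) (RtoC (y * (Q * s ^ 3))) u v) in *.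
    assert (Hge : 0 <= 4 * (u * (x * P / s + y * (Q * s ^ 3) * R2))).
    { eapply Rle_trans; [|exact H].
      apply Rmult_le_pos; [apply Rmult_le_pos; nra|apply denom_ge0]. }
    apply Rle_trans with (s ^ 5 * s ^ 5 * (X * X + Y * Y)).
    - replace (s ^ 5 * s ^ 5 * (X * X + Y * Y))
        with (x * P * s ^ 4 * (x * P * s ^ 4) + Yv * Yv
              + 2 * (x * y) * P * Q * s ^ 4 * (s ^ 4 * s ^ 4 * (u * u - v * v))).
      + pose proof (Rle_0_sqr (x * P * s ^ 4)) as Hsq. unfold Rsqr in Hsq.
        assert (Hxy : Rabs (x * y * (u * u - v * v)) <= Rabs x * Rabs y * R2).
        { apply Rabs_mult_le; [rewrite Rabs_mult; lra|].
          apply Rabs_le_between. unfold R2. nra. }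
        apply Rabs_le_between in Hxy.
        assert (Hpos : 0 <= 2 * P * Q * s ^ 4 * (s ^ 4 * s ^ 4)).
        { repeat apply Rmult_le_pos; lra. }
        assert (Hxy' := Rmult_le_compat_l _ _ _ Hpos (proj1 Hxy)).
        unfold rho. lra.
      + unfold X, Y, Yv, rho, R2, symX, symY, RtoC; simpl; field; lra.
    - apply Rmult_le_compat_l; [apply Rmult_le_pos; apply pow_le; lra|].
      unfold denom. fold X Y.
      assert (0 < R2) by exact HR. unfold R2 in *. nra. }
  apply (Rmult_le_compat_l (s ^ 4 * s ^ 5)) in H;
    [|apply Rmult_le_pos; apply pow_le; lra].
  replace (s ^ 4 * s ^ 5 * (4 * (u * (x * P / s + y * (Q * s ^ 3) * R2))))
    with (4 * (u * s ^ 4) * (x * P * s ^ 4 + Yv)) in H by (unfold Yv, rho; field; lra).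
  rewrite Hus in H.
  assert (H1 : (1 - 3 * eps) * (Yv * Yv - 2 * (Rabs x * Rabs y * P) * rho * s ^ 4)
               <= 4 * nu * (x * P * s ^ 4 + Yv)).
  { apply (Rmult_le_reg_l D); [lra|].
    apply (Rmult_le_compat_l ((1 - 3 * eps) * D)) in Hd; [|apply Rmult_le_pos; lra].
    lra. }
  set (g := rho / (4 * nu)).
  assert (Hg : rho = 4 * nu * g) by (unfold g; field; lra).
  assert (Hg1 : 1 - eps / 4 <= g).
  { apply (Rmult_le_reg_l (4 * nu)); lra. }
  assert (Hyg : y * g <= 1 + 10 * eps).
  { apply quadratic_bound; [exact He|].
    apply (Rmult_le_reg_l (16 * nu * nu)); [nra|].
    replace (16 * nu * nu * ((1 - 3 * eps) * (y * g * (y * g)) - y * g))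
      with ((1 - 3 * eps) * (Yv * Yv) - 4 * nu * Yv) by (unfold Yv; rewrite Hg; ring).
    assert (Hxs : x * P * s ^ 4 <= Cx * P * s).
    { eapply Rle_trans; [apply Rle_abs|].
      apply Rabs_mult_le; [apply Rabs_mult_le|]; auto; rewrite Rabs_pos_eq; lra. }
    assert (Hxy : Rabs x * Rabs y * P * rho * s ^ 4 <= Cx * Cy * P * (8 * nu) * s).
    { rewrite <- Rabs_mult. eapply Rle_trans; [apply Rle_abs|].
      apply Rabs_mult_le; [apply Rabs_mult_le; [apply Rabs_mult_le|]|];
        try (rewrite Rabs_pos_eq; lra).
      rewrite Rabs_Rabsolu. apply Rabs_mult_le; assumption. }
    assert (Hxy0 : 0 <= Rabs x * Rabs y * P * rho * s ^ 4).
    { apply Rmult_le_pos; [apply Rmult_le_pos; [apply Rmult_le_pos|]|]; try lra.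
      apply Rmult_le_pos; apply Rabs_pos. }
    assert (Hxy1 : 0 <= 3 * eps * (Rabs x * Rabs y * P * rho * s ^ 4))
      by (apply Rmult_le_pos; lra).
    apply (Rmult_le_compat_l (4 * nu)) in Hxs; [|lra].
    lra. }
  apply Rnot_lt_le. intros Hlt.
  assert ((1 + 11 * eps) * (1 - eps / 4) <= y * g) by (apply Rmult_le_compat; lra).
  nra.
Qed.

Lemma test_mid (P Q D C0 th s x y u v eps Cx Cy : R) :
  0 < eps <= / 20 -> 0 < P -> 0 < Q -> 0 < D -> 0 < C0 -> 0 < th -> 0 < s <= 1 ->
  2 * Q * (th * th) = P -> D * th = 2 * P -> u = th / s ^ 2 ->
  Rabs x <= Cx -> Rabs y <= Cy -> 0 <= v <= u -> Rabs (v - u) <= C0 ->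
  (C0 + Cx * P + 2 * Cy * Q * (th * th)) * s <= th ->
  (2 * D * (C0 + Cx * P + 2 * Cy * Q * (th * th)) + 2 * Cy * Q * C0 * th) * s <= P * eps ->
  (1 - 3 * eps) * (2 * D * s) * denom (RtoC (x * P / s)) (RtoC (y * (Q * s ^ 3))) u v
    <= 4 * (u * (x * P / s + y * (Q * s ^ 3) * (u * u + v * v))) ->
  2 - 7 * eps <= x + y.
Proof.
  intros He HP HQ HD HC0 Hth Hs HQth HDth Hu Hx Hy Hv Hvu Hsm1 Hsm2 H.
  set (c4 := C0 + Cx * P + 2 * Cy * Q * (th * th)) in *.
  assert (Hs2 : 0 < s ^ 2) by (apply pow_lt; lra).
  assert (Hs2s : s ^ 2 <= s) by (apply pow_S_le_self; lra).
  assert (Hu0 : 0 < u) by (rewrite Hu; apply Rdiv_lt_0_compat; lra).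
  assert (Hus : u * s ^ 2 = th) by (rewrite Hu; field; lra).
  assert (Hvs : 0 <= v * s ^ 2 <= th) by (rewrite <- Hus; split; nra).
  apply Rabs_le_between in Hvu.
  assert (Hvs' : th - C0 * s <= v * s ^ 2).
  { assert (C0 * s ^ 2 <= C0 * s) by (apply Rmult_le_compat_l; lra).
    assert ((u - C0) * s ^ 2 <= v * s ^ 2) by (apply Rmult_le_compat_r; lra). lra. }
  set (us := u * s ^ 2) in *. set (vs := v * s ^ 2) in *.
  assert (Hys : Rabs (y * Q * s) <= Cy * Q * s).
  { apply Rabs_mult_le; [apply Rabs_mult_le|]; auto; rewrite Rabs_pos_eq; lra. }
  assert (Hxs : Rabs (x * P * s) <= Cx * P * s).
  { apply Rabs_mult_le; [apply Rabs_mult_le|]; auto; rewrite Rabs_pos_eq; lra. }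
  set (X := symX (RtoC (x * P / s)) (RtoC (y * (Q * s ^ 3))) u v).
  set (Y := symY (RtoC (x * P / s)) (RtoC (y * (Q * s ^ 3))) u v).
  assert (HX : th - c4 * s <= s ^ 2 * (X + u)).
  { assert (E : s ^ 2 * (X + u) = us + x * P * s + y * Q * s * (us * us - vs * vs)).
    { unfold X, us, vs, symX, RtoC; simpl; field; lra. }
    assert (B : Rabs (us * us - vs * vs) <= th * th).
    { rewrite Hus. apply Rabs_le_between. nra. }
    assert (B' := Rabs_mult_le _ _ _ _ Hys B).
    apply Rabs_le_between in B', Hxs. rewrite E, Hus.
    assert (0 < C0 * s) by nra.
    assert (0 <= Cy * Q * s * (th * th)) by lra.
    rewrite Hus in B'. unfold c4. lra. }
  assert (HY : th - c4 * s <= s ^ 2 * (Y + v)).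
  { assert (E : s ^ 2 * (Y + v) = vs + y * Q * s * (2 * us * vs)).
    { unfold Y, us, vs, symY, RtoC; simpl; field; lra. }
    assert (B : Rabs (2 * us * vs) <= 2 * (th * th)).
    { rewrite Hus. apply Rabs_le_between. nra. }
    assert (B' := Rabs_mult_le _ _ _ _ Hys B).
    apply Rabs_le_between in B', Hxs. rewrite E.
    unfold c4. lra. }
  assert (Hc4 : 0 <= th - c4 * s) by lra.
  assert (Hd : 2 * (th * th - 2 * th * (c4 * s)) <= s ^ 2 * s ^ 2 *
            denom (RtoC (x * P / s)) (RtoC (y * (Q * s ^ 3))) u v).
  { unfold denom. fold X Y.
    assert (H1 : (th - c4 * s) * (th - c4 * s) <= s ^ 2 * (X + u) * (s ^ 2 * (X + u)))
      by (apply Rmult_le_compat; lra).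
    assert (H2 : (th - c4 * s) * (th - c4 * s) <= s ^ 2 * (Y + v) * (s ^ 2 * (Y + v)))
      by (apply Rmult_le_compat; lra).
    pose proof (Rle_0_sqr (c4 * s)) as H3. unfold Rsqr in H3. lra. }
  apply (Rmult_le_compat_l (s ^ 2 * s)) in H; [|apply Rmult_le_pos; lra].
  replace (s ^ 2 * s * (4 * (u * (x * P / s + y * (Q * s ^ 3) * (u * u + v * v)))))
    with (4 * us * (x * P + y * Q * (us * us + vs * vs))) in H
    by (unfold us, vs; field; lra).
  rewrite Hus in H.
  apply (Rmult_le_compat_l ((1 - 3 * eps) * (2 * D))) in Hd; [|apply Rmult_le_pos; lra].
  assert (H1 : (1 - 3 * eps) * (2 * D) * (2 * (th * th - 2 * th * (c4 * s)))
               <= 4 * th * (x * P + y * Q * (th * th + vs * vs))) by lra.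
  assert (H2 : (1 - 3 * eps) * (D * th - 2 * D * (c4 * s))
               <= x * P + y * Q * (th * th + vs * vs)).
  { apply (Rmult_le_reg_l (4 * th)); lra. }
  rewrite HDth in H2.
  assert (Hz : Rabs (y * Q * (th * th - vs * vs)) <= Cy * Q * (2 * C0 * th * s)).
  { apply Rabs_mult_le; [apply Rabs_mult_le; [exact Hy|rewrite Rabs_pos_eq; lra]|].
    apply Rabs_le_between.
    assert ((th - vs) * (th + vs) <= C0 * s * (2 * th)) by (apply Rmult_le_compat; lra).
    assert (0 <= (th - vs) * (th + vs)) by (apply Rmult_le_pos; lra). lra. }
  apply Rabs_le_between in Hz.
  assert (H3 : 0 <= D * (c4 * s)) by (apply Rmult_le_pos; [lra|];
    pose proof (Rabs_pos x); pose proof (Rabs_pos y); unfold c4; apply Rmult_le_pos; [|lra];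
    repeat apply Rplus_le_le_0_compat; repeat apply Rmult_le_pos; lra).
  assert (H3' : 0 <= eps * (D * (c4 * s))) by (apply Rmult_le_pos; lra).
  apply (Rmult_le_reg_l P); [lra|].
  assert (H4 : y * P = y * Q * (th * th + vs * vs) + y * Q * (th * th - vs * vs)).
  { rewrite <- HQth. ring. }
  lra.
Qed.

Lemma near_optimal_asymptotics (nu A v1 U1 V1 tau C0 c0 P Q D eps : R) :
  0 < nu -> 0 < A -> 0 <= tau <= 1 -> 0 < C0 -> 0 < c0 -> 0 < U1 -> 0 < V1 ->
  0 < P -> 0 < Q -> 0 < D ->
  2 * (D * P) = A -> D * D = 8 * P * Q -> D * D * (nu * Q) * (1 + tau * tau) = 4 ->
  0 < eps <= / 20 ->
  at_right 0 (fun s => forall K, scaled_set A v1 U1 V1 tau C0 c0 s K ->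
    forall p q : R,
    admissible K (s ^ 5 / nu) (exp (- ((1 - eps) * D * s))) (RtoC p) (RtoC q) ->
    Rabs (p * s / P - 1) <= 18 * eps /\ Rabs (q / (Q * s ^ 3) - 1) <= 18 * eps).
Proof.
  intros Hnu HA Htau HC0 Hc0 HU1 HV1 HP HQ HD HDP HDD HDQ He.
  destruct (near_optimal_control nu A v1 U1 V1 tau C0 c0 (D / 2)) as [Cb [HCb Hctl]];
    try lra.
  set (Cx := Cb / P). set (Cy := Cb / Q). set (u1 := A / 4).
  set (th := sqrt (P / (2 * Q))).
  assert (Hth2 : th * th = P / (2 * Q)) by (apply sqrt_sqrt, Rlt_le, Rdiv_lt_0_compat; lra).
  assert (Hth : 0 < th) by (apply sqrt_lt_R0, Rdiv_lt_0_compat; lra).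
  assert (HQth : 2 * Q * (th * th) = P) by (rewrite Hth2; field; lra).
  assert (HDth : D * th = 2 * P).
  { assert (E : (D * th) * (D * th) = (2 * P) * (2 * P)).
    { transitivity (D * D * (th * th)); [ring|]. rewrite HDD, <- HQth. field_simplify. ring. }
    assert (0 < D * th) by nra. nra. }
  assert (HnuD : 0 < nu * D) by nra.
  assert (HPe : 0 < P * eps) by nra.
  assert (Hx1 : 0 < 4 * nu * (eps / 4)) by nra.
  assert (Hx2 : 0 < 16 * nu * nu * eps) by (apply Rmult_lt_0_compat; nra).
  assert (HDe : 0 < 2 * eps * D) by nra.
  eapply filter_imp; [|apply filter_and; [exact Hctl|
    apply filter_and; [exact (small_mul 1 1 Rlt_0_1)|
    apply filter_and; [exact (small_mul (2 * D) eps (proj1 He))|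
    apply filter_and; [exact (small_mul (A / (4 * nu)) _ HDe)|
    apply filter_and; [exact (small_mul
      (Cy * Q * (u1 * u1 + v1 * v1) + 2 * Cx * (u1 + Cy * Q * (u1 * u1 + v1 * v1))) _ HPe)|
    apply filter_and; [exact (small_mul U1 _ HnuD)|
    apply filter_and; [exact (small_mul (nu * D) _ Hc0)|
    apply filter_and; [exact (small_mul (Q * (2 * nu * D * C0 + C0 * C0)) _ Hx1)|
    apply filter_and; [exact (small_mul (8 * nu * (2 * Cx * Cy * P) + 4 * nu * (Cx * P)) _ Hx2)|
    apply filter_and; [exact (small_mul U1 _ Hth)|
    apply filter_and; [exact (small_mul (th * th) _ Hc0)|
    apply filter_and; [exact (small_mul (th / nu) _ HDe)|
    apply filter_and; [exact (small_mul (C0 + Cx * P + 2 * Cy * Q * (th * th)) _ Hth)|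
    exact (small_mul (2 * D * (C0 + Cx * P + 2 * Cy * Q * (th * th)) + 2 * Cy * Q * C0 * th)
             _ HPe)]]]]]]]]]]]]]].
  cbv beta.
  intros s [Hc [[Hs Hs1] [[_ HsD] [[_ S1] [[_ S2] [[_ S3] [[_ S4] [[_ S5] [[_ S6] [[_ S7]
    [[_ S8] [[_ S9] [[_ S10] [_ S11]]]]]]]]]]]]]] K HK p q Hadm.
  assert (Hs1' : 0 < s <= 1) by lra.
  assert (HDs : 0 < D * s) by nra.
  destruct (Hc K HK (RtoC p) (RtoC q)) as [[Bp [_ [Bq _]]] _].
  { apply admissible_mono with (exp (- ((1 - eps) * D * s))); [|exact Hadm].
    split; [apply Rlt_le, exp_pos|].
    apply Rlt_le, exp_increasing.
    assert (eps * (D * s) <= / 20 * (D * s)) by (apply Rmult_le_compat_r; lra). lra. }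
  cbn [Re fst RtoC] in Bp, Bq.
  assert (Hs3 : 0 < s ^ 3) by (apply pow_lt; lra).
  assert (HQs : 0 < Q * s ^ 3) by (apply Rmult_lt_0_compat; lra).
  set (x := p * s / P). set (y := q / (Q * s ^ 3)).
  assert (Ep : p = x * P / s) by (unfold x; field; lra).
  assert (Eq : q = y * (Q * s ^ 3)) by (unfold y; field; lra).
  assert (Hx : Rabs x <= Cx).
  { unfold x, Cx, Rdiv. rewrite 2!Rabs_mult, (Rabs_pos_eq (/ P)), (Rabs_pos_eq s);
      [|lra|apply Rlt_le, Rinv_0_lt_compat; lra].
    apply Rmult_le_compat_r; [apply Rlt_le, Rinv_0_lt_compat; lra|].
    apply (Rle_div_r _ _ _ Hs). exact Bp. }
  assert (Hy : Rabs y <= Cy).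
  { unfold y, Cy, Rdiv. rewrite Rabs_mult, (Rabs_pos_eq (/ _));
      [|apply Rlt_le, Rinv_0_lt_compat; lra].
    apply (Rle_div_l (Rabs q) _ _ HQs). unfold Rdiv.
    replace (Cb * / Q * (Q * s ^ 3)) with (Cb * s ^ 3) by (field; lra). exact Bq. }
  assert (Hgap := fun u v y0 => real_gap K (s ^ 5 / nu) ((1 - eps) * D * s) eps y0 p q u v Hadm).
  rewrite Ep, Eq in Hgap.
  assert (Hy0 : 0 <= (1 - 2 * eps) * (D * s)) by (apply Rmult_le_pos; lra).
  assert (HeD : 0 <= eps * (D * s)) by (apply Rmult_le_pos; lra).
  assert (HeeD : 0 <= eps * (eps * (D * s))) by (apply Rmult_le_pos; lra).
  assert (Hy1 : 0 <= 2 * ((1 - 2 * eps) * (D * s)) <= eps) by (split; lra).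
  assert (Hy2 : 0 <= (1 - 2 * eps) * (D * s) <= eps) by (split; lra).
  assert (Hy3 : (1 - 3 * eps) * (D * s) <= (1 - eps) * ((1 - 2 * eps) * (D * s))) by lra.
  assert (Hmin := ss_min _ _ _ _ _ _ _ _ _ HK).
  assert (Hs4 : 0 < s ^ 4) by (apply pow_lt; lra).
  assert (Hs2 : 0 < s ^ 2) by (apply pow_lt; lra).
  assert (Hs2s : s ^ 2 <= s) by (apply pow_S_le_self; lra).
  assert (Hs4s : s ^ 4 <= s) by (apply pow_S_le_self; lra).
  assert (T1 : x <= 1 + 10 * eps).
  { apply (test_low P Q D A s x y u1 v1 eps Cx Cy); auto; try (unfold u1; lra).
    assert (Hl := ss_low _ _ _ _ _ _ _ _ _ HK). fold u1 in Hl.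
    eapply Rle_trans; [|apply (Hgap u1 v1 (2 * ((1 - 2 * eps) * (D * s))) Hl Hy1)].
    - apply Rmult_le_compat_r; [apply denom_ge0|]. lra.
    - replace (s ^ 5 / nu * u1) with (A / (4 * nu) * s * s ^ 4) by (unfold u1; field; lra).
      assert (A / (4 * nu) * s * s ^ 4 <= 2 * eps * D * s); [|lra].
      apply Rmult_le_compat; try lra. apply Rmult_le_pos; [|lra].
      apply Rlt_le, Rdiv_lt_0_compat; lra. }
  assert (T3 : y <= 1 + 11 * eps).
  { set (u := nu * D / s ^ 4).
    destruct (ss_far _ _ _ _ _ _ _ _ _ HK u) as [v [Hk [Hv0 Hv]]].
    - apply (Rle_div_r _ _ _ Hs4). eapply Rle_trans; [|exact S3]. apply Rmult_le_compat_l; lra.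
    - replace (u * s ^ 5) with (nu * D * s) by (unfold u; field; lra). exact S4.
    - apply (test_far P Q D nu tau C0 s x y u v eps Cx Cy); auto.
      eapply Rle_trans; [|apply (Hgap u v ((1 - 2 * eps) * (D * s)) Hk Hy2)].
      + apply Rmult_le_compat_r; [apply denom_ge0|]. lra.
      + replace (s ^ 5 / nu * u) with (D * s) by (unfold u; field; lra). lra. }
  assert (T2 : 2 - 7 * eps <= x + y).
  { set (u := th / s ^ 2).
    destruct (ss_mid _ _ _ _ _ _ _ _ _ HK u) as [v [Hk [Hv0 Hv]]].
    - apply (Rle_div_r _ _ _ Hs2). eapply Rle_trans; [|exact S7]. apply Rmult_le_compat_l; lra.
    - replace (u * u * s ^ 5) with (th * th * s) by (unfold u; field; lra). exact S8.
    - assert (Hvu : v <= u).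
      { destruct (Hmin _ _ Hk) as [_ Hvu]. eapply Rle_trans; [apply Rle_abs|exact Hvu]. }
      apply (test_mid P Q D C0 th s x y u v eps Cx Cy); auto.
      eapply Rle_trans; [|apply (Hgap u v (2 * ((1 - 2 * eps) * (D * s))) Hk Hy1)].
      + apply Rmult_le_compat_r; [apply denom_ge0|]. lra.
      + replace (s ^ 5 / nu * u) with (th / nu * s * s ^ 2) by (unfold u; field; lra).
        assert (th / nu * s * s ^ 2 <= 2 * eps * D * s); [|lra].
        apply Rmult_le_compat; try lra. apply Rmult_le_pos; [|lra].
        apply Rlt_le, Rdiv_lt_0_compat; lra. }
  split; apply Rabs_le_between; lra.
Qed.

Lemma near_optimal_value (nu A v1 U1 V1 tau C0 c0 P Q eps : R) :
  0 < nu -> 0 < A -> 0 < P -> 0 < Q -> 0 < eps ->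
  at_right 0 (fun s => forall K, scaled_set A v1 U1 V1 tau C0 c0 s K ->
    forall d p q : R, 0 <= d <= 1 ->
    Rabs (p * s / P - 1) <= / 2 -> Rabs (q / (Q * s ^ 3) - 1) <= / 2 ->
    admissible K (s ^ 5 / nu) d (RtoC p) (RtoC q) -> 1 - eps <= d).
Proof.
  intros Hnu HA HP HQ He.
  set (u := A / 4). set (R2 := u * u + v1 * v1).
  assert (Hu : 0 < u) by (unfold u; lra).
  assert (HR : 0 < R2) by (unfold R2; nra).
  assert (HP4 : 0 < P / 4) by lra.
  assert (He2 : 0 < eps / 2) by lra.
  eapply filter_imp; [|apply filter_and; [exact (small_mul 1 1 Rlt_0_1)|
    apply filter_and; [exact (small_mul (2 * Q * R2) _ HP4)|
    apply filter_and; [exact (small_mul (32 * A / P) _ He2)|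
      exact (small_mul (u / nu) _ He2)]]]].
  cbv beta. intros s [[Hs Hs1] [[_ S1] [[_ S2] [_ S3]]]] K HK d p q Hd Hx Hy Hadm.
  assert (Hs3 : 0 < s ^ 3) by (apply pow_lt; lra).
  assert (HQs : 0 < Q * s ^ 3) by (apply Rmult_lt_0_compat; lra).
  set (x := p * s / P) in *. set (y := q / (Q * s ^ 3)) in *.
  assert (Ep : p = x * P / s) by (unfold x; field; lra).
  assert (Eq : q = y * (Q * s ^ 3)) by (unfold y; field; lra).
  apply Rabs_le_between in Hx, Hy.
  assert (HxP : / 2 * P <= x * P) by (apply Rmult_le_compat_r; lra).
  assert (HxP' : x * P <= 3 / 2 * P) by (apply Rmult_le_compat_r; lra).
  assert (Hl := ss_low _ _ _ _ _ _ _ _ _ HK). fold u in Hl.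
  specialize (Hadm u v1 Hl).
  assert (Hs4 : 0 < s ^ 4) by (apply pow_lt; lra).
  assert (Hs4s : s ^ 4 <= s) by (apply pow_S_le_self; lra).
  assert (Hsub := denom_sub_numer (RtoC p) (RtoC q) u v1). rewrite real_pairing in Hsub.
  fold R2 in Hsub.
  assert (Hqs : 0 <= y * Q * s ^ 4 * R2 <= P / 4).
  { assert (0 <= y * (Q * R2) <= 2 * (Q * R2)) by (split; [apply Rmult_le_pos|apply Rmult_le_compat_r]; nra).
    assert (0 <= s ^ 4 * (y * (Q * R2)) <= s * (2 * (Q * R2)))
      by (split; [apply Rmult_le_pos|apply Rmult_le_compat]; lra).
    lra. }
  assert (Hden : P * P / 16 <= s * s * denom (RtoC p) (RtoC q) u v1).
  { unfold denom. rewrite (Rmult_plus_distr_l (s * s)).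
    assert (E : s * (symX (RtoC p) (RtoC q) u v1 + u)
                = x * P + s * u + y * Q * s ^ 4 * (u * u - v1 * v1)).
    { unfold symX, RtoC; simpl. rewrite Ep, Eq. field. lra. }
    assert (B : - (P / 4) <= y * Q * s ^ 4 * (u * u - v1 * v1)).
    { assert (0 <= y * Q * s ^ 4) by (apply Rmult_le_pos; [apply Rmult_le_pos|]; lra).
      assert (y * Q * s ^ 4 * (- R2) <= y * Q * s ^ 4 * (u * u - v1 * v1)).
      { apply Rmult_le_compat_l; [lra|]. pose proof (Rle_0_sqr u). unfold R2, Rsqr in *. lra. }
      lra. }
    assert (H1 : P / 4 <= s * (symX (RtoC p) (RtoC q) u v1 + u)).
    { rewrite E. assert (0 <= s * u) by nra. lra. }
    assert (H2 : P / 4 * (P / 4) <= s * (symX (RtoC p) (RtoC q) u v1 + u) *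
                   (s * (symX (RtoC p) (RtoC q) u v1 + u))) by (apply Rmult_le_compat; lra).
    match goal with |- _ <= _ + ?b => assert (0 <= b) by (apply Rmult_le_pos; apply Rle_0_sqr) end.
    lra. }
  set (N := numer _ _ _ _) in *. set (M := denom _ _ _ _) in *.
  assert (HM : 0 < M).
  { assert (0 < P * P / 16) by nra. assert (0 < s * s) by nra.
    apply Rnot_le_lt. intros Hle. nra. }
  assert (Hm : s * (4 * (u * (p + q * R2))) <= A * (2 * P)).
  { replace (s * (4 * (u * (p + q * R2)))) with (A * (x * P + y * Q * s ^ 4 * R2))
      by (rewrite Ep, Eq; unfold u; field; lra).
    apply Rmult_le_compat_l; lra. }
  assert (Hratio : 4 * (u * (p + q * R2)) <= 32 * A / P * s * M).
  { apply (Rmult_le_reg_l s); [lra|]. eapply Rle_trans; [exact Hm|].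
    replace (s * (32 * A / P * s * M)) with (32 * A / P * (s * s * M)) by ring.
    apply Rle_trans with (32 * A / P * (P * P / 16)); [right; field; lra|].
    apply Rmult_le_compat_l; [|exact Hden]. apply Rlt_le, Rdiv_lt_0_compat; lra. }
  assert (HN : (1 - eps / 2) * M <= N) by nra.
  assert (Hde : 1 - eps / 2 <= d * d * exp (s ^ 5 / nu * u)).
  { apply (Rmult_le_reg_r M); [exact HM|]. lra. }
  assert (Hexp : 1 - eps / 2 <= exp (- (s ^ 5 / nu * u))).
  { eapply Rle_trans; [|apply exp_ineq1_le].
    replace (s ^ 5 / nu * u) with (u / nu * s * s ^ 4) by (field; lra).
    assert (0 <= u / nu * s) by (apply Rmult_le_pos; [apply Rlt_le, Rdiv_lt_0_compat|]; lra).
    assert (u / nu * s * s ^ 4 <= eps / 2 * 1) by (apply Rmult_le_compat; lra). lra. }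
  destruct (Rle_lt_dec 1 (eps / 2)) as [Hbig|Hsmall]; [lra|].
  assert (Hd2 : (1 - eps / 2) * (1 - eps / 2) <= d * d).
  { replace (d * d) with (d * d * exp (s ^ 5 / nu * u) * exp (- (s ^ 5 / nu * u))).
    - apply Rmult_le_compat; lra.
    - rewrite Rmult_assoc, <- exp_plus, Rplus_opp_r, exp_0. ring. }
  nra.
Qed.

(** * The set of values of the square root *)

Definition freq_set (nu a b c km wm h dt u v : R) : Prop :=
  0 < u /\ exists w k, inD km wm h dt w k /\
    u * u - v * v = x02 nu a b + 4 * nu ^ 2 * k ^ 2 /\ u * v = 2 * nu * (w + c * k).

Lemma x02_ge0 nu a b : 0 < nu -> 0 <= b -> 0 <= x02 nu a b.
Proof. intros. unfold x02. assert (0 <= nu * b) by nra. pose proof (pow2_ge_0 a). lra. Qed.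

(* [half_plane_root X Y] is the real part of the principal square root of [X + i Y]. *)
Definition half_plane_root (X Y : R) : R := sqrt ((sqrt (X * X + Y * Y) + X) / 2).

Lemma half_plane_root_spec (X Y : R) :
  0 <= X -> 0 < X * X + Y * Y ->
  let u := half_plane_root X Y in
  0 < u /\ u * u - Y / (2 * u) * (Y / (2 * u)) = X.
Proof.
  intros HX HXY u.
  assert (Hr := sqrt_lt_R0 _ HXY). assert (Hrr := sqrt_sqrt _ (Rlt_le _ _ HXY)).
  set (r := sqrt (X * X + Y * Y)) in *.
  assert (Hu2 : u * u = (r + X) / 2) by (apply sqrt_sqrt; lra).
  assert (Hu : 0 < u) by (apply sqrt_lt_R0; fold r; lra).
  split; [exact Hu|].
  replace (Y / (2 * u) * (Y / (2 * u))) with (Y * Y / (4 * (u * u))) by (field; lra).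
  rewrite Hu2. replace (Y * Y) with (r * r - X * X) by lra. field. lra.
Qed.

Lemma Csqrt_eq (u v : R) : 0 < u -> Csqrt (u * u - v * v, 2 * u * v) = (u, v).
Proof.
  intros Hu.
  assert (Hmod : Cmod (u * u - v * v, 2 * u * v) = u * u + v * v).
  { assert (0 <= u * u + v * v) by nra.
    pose proof (Cmod_ge_0 (u * u - v * v, 2 * u * v)).
    apply Rle_antisym; apply Rle_of_sq_le; auto; rewrite Cmod_sq; lra. }
  unfold Csqrt. rewrite Hmod. cbn [Re Im fst snd]. f_equal.
  - replace ((u * u + v * v + (u * u - v * v)) / 2) with (u * u) by field.
    apply sqrt_square. lra.
  - replace ((u * u + v * v - (u * u - v * v)) / 2) with (Rsqr v) by (unfold Rsqr; field).
    rewrite sqrt_Rsqr_abs. unfold Rabs.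
    destruct (Rlt_dec (2 * u * v) 0), (Rcase_abs v); nra.
Qed.

Lemma freq_point (nu a b c wm w k : R) :
  0 < nu -> 0 <= b -> 0 < wm -> wm <= Rabs w ->
  let u := half_plane_root (x02 nu a b + 4 * nu ^ 2 * k ^ 2) (4 * nu * (w + c * k)) in
  0 < u /\ exists v, u * u - v * v = x02 nu a b + 4 * nu ^ 2 * k ^ 2 /\
                     u * v = 2 * nu * (w + c * k).
Proof.
  intros Hnu Hb Hwm Hw u.
  pose proof (x02_ge0 nu a b Hnu Hb) as Hx.
  assert (Hk : 0 <= nu ^ 2 * k ^ 2) by (apply Rmult_le_pos; apply pow2_ge_0).
  assert (HX : 0 <= x02 nu a b + 4 * nu ^ 2 * k ^ 2) by lra.
  set (X := x02 nu a b + 4 * nu ^ 2 * k ^ 2) in *. set (Y := 4 * nu * (w + c * k)) in *.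
  assert (HXY : 0 < X * X + Y * Y).
  { apply Rnot_le_lt. intros Hle.
    assert (HX0 : X = 0 /\ Y = 0) by (apply sum_sq_eq0; pose proof (pow2_ge_0 X); pose proof (pow2_ge_0 Y); simpl in *; lra).
    destruct HX0 as [HX0 HY0].
    assert (Hk0 : nu ^ 2 * k ^ 2 = 0) by (unfold X in HX0; lra).
    apply Rmult_integral in Hk0. destruct Hk0 as [Hk0|Hk0]; [simpl in Hk0; nra|].
    assert (k = 0) by (simpl in Hk0; nra). subst k.
    assert (Hw0 : w = 0).
    { unfold Y in HY0. apply Rmult_integral in HY0. destruct HY0; lra. }
    rewrite Hw0, Rabs_R0 in Hw. lra. }
  destruct (half_plane_root_spec X Y HX HXY) as [Hu Hsq]. fold u in Hu, Hsq.
  split; [exact Hu|]. exists (Y / (2 * u)). split; [exact Hsq|].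
  unfold Y. field. lra.
Qed.

Definition shift_p (nu a b : R) (p q : C) : C :=
  (Re p - Re q * (x02 nu a b / (4 * nu)), Im p - Im q * (x02 nu a b / (4 * nu))).
Definition shift_q (nu : R) (q : C) : C := (Re q / (4 * nu), Im q / (4 * nu)).

Lemma Cmod_rho_eq (nu a b c w k L u v : R) (p q : C) :
  0 < nu -> 0 < u -> u * u - v * v = x02 nu a b + 4 * nu ^ 2 * k ^ 2 ->
  u * v = 2 * nu * (w + c * k) ->
  0 < denom (shift_p nu a b p q) (shift_q nu q) u v ->
  Cmod (rho nu a b c w k p q L) =
    sqrt (numer (shift_p nu a b p q) (shift_q nu q) u v) /
    sqrt (denom (shift_p nu a b p q) (shift_q nu q) u v) * exp (- (L / nu * u) / 2).
Proof.
  intros Hnu Hu H1 H2 Hden.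
  unfold rho.
  replace (Cplus (RtoC (x02 nu a b)) (Cmult (RtoC (4 * nu)) (zsym nu c w k)))
    with (u * u - v * v, 2 * u * v).
  2:{ unfold zsym, Cplus, Cmult, RtoC; simpl. f_equal; [simpl in H1; lra|lra]. }
  rewrite Csqrt_eq by exact Hu.
  set (X := symX (shift_p nu a b p q) (shift_q nu q) u v).
  set (Y := symY (shift_p nu a b p q) (shift_q nu q) u v).
  replace (Cplus p (Cmult q (zsym nu c w k))) with (X, Y).
  2:{ assert (Ek : nu * k ^ 2 = (u * u - v * v - x02 nu a b) / (4 * nu)).
      { rewrite H1. field. lra. }
      assert (Ew : w + c * k = u * v / (2 * nu)) by (rewrite H2; field; lra).
      unfold zsym. rewrite Ek, Ew. destruct p as [p1 p2], q as [q1 q2].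
      unfold X, Y, symX, symY, shift_p, shift_q, Cplus, Cmult; cbn [Re Im fst snd].
      f_equal; field; lra. }
  assert (EN : Cmod (Cminus (X, Y) (u, v)) = sqrt (numer (shift_p nu a b p q) (shift_q nu q) u v)).
  { unfold Cmod, numer. fold X Y. f_equal. unfold Cminus, Cplus, Copp; simpl. ring. }
  assert (EM : Cmod (Cplus (X, Y) (u, v)) = sqrt (denom (shift_p nu a b p q) (shift_q nu q) u v)).
  { unfold Cmod, denom. fold X Y. f_equal. unfold Cplus; simpl. ring. }
  rewrite Cmod_mult. f_equal.
  - unfold Cdiv. rewrite Cmod_mult, Cmod_inv, EN, EM; [reflexivity|].
    intros E. rewrite E, Cmod_0 in EM. symmetry in EM. apply sqrt_eq_0 in EM; lra.
  - unfold Cexp, Cmod; cbn [fst snd].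
    match goal with |- sqrt ?x = _ => replace x with
      (exp (Re (Cmult (RtoC (- L / (2 * nu))) (u, v))) ^ 2 *
        (Rsqr (sin (Im (Cmult (RtoC (- L / (2 * nu))) (u, v)))) +
         Rsqr (cos (Im (Cmult (RtoC (- L / (2 * nu))) (u, v)))))) by (unfold Rsqr; ring) end.
    rewrite sin2_cos2, Rmult_1_r, sqrt_pow2 by (apply Rlt_le, exp_pos).
    f_equal. unfold Cmult, RtoC; simpl. field. lra.
Qed.

Lemma Cmult_eq0 (x y : C) : Cmult x y = RtoC 0 -> x = RtoC 0 \/ y = RtoC 0.
Proof.
  intros H. assert (E : Cmod x * Cmod y = 0) by (rewrite <- Cmod_mult, H; apply Cmod_0).
  apply Rmult_integral in E. destruct E as [E|E]; [left|right]; apply Cmod_eq_0, E.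
Qed.

Lemma denom_eq0_C (p q : C) (u v : R) :
  denom p q u v = 0 -> Cplus p (Cplus (Cmult q (Cmult (u, v) (u, v))) (u, v)) = RtoC 0.
Proof.
  intros H. unfold denom in H.
  destruct (sum_sq_eq0 (symX p q u v + u) (symY p q u v + v)) as [H1 H2]; [lra|].
  destruct p as [p1 p2], q as [q1 q2]. unfold symX, symY in *; cbn [Re Im fst snd] in *.
  unfold Cplus, Cmult, RtoC; cbn [fst snd]. f_equal; lra.
Qed.

Lemma no_three_poles (p q f0 f1 f2 : C) :
  f0 <> f1 -> f0 <> f2 -> f1 <> f2 ->
  Cplus p (Cplus (Cmult q (Cmult f0 f0)) f0) = RtoC 0 ->
  Cplus p (Cplus (Cmult q (Cmult f1 f1)) f1) = RtoC 0 ->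
  Cplus p (Cplus (Cmult q (Cmult f2 f2)) f2) = RtoC 0 -> False.
Proof.
  intros D01 D02 D12 H0 H1 H2.
  assert (Hsub : forall x y : C, Cminus x y = RtoC 0 -> x = y).
  { intros x y H. replace x with (Cplus (Cminus x y) y) by ring. rewrite H. ring. }
  assert (Hfac : forall x y : C, x <> y ->
            Cplus p (Cplus (Cmult q (Cmult x x)) x) = RtoC 0 ->
            Cplus p (Cplus (Cmult q (Cmult y y)) y) = RtoC 0 ->
            Cplus (Cmult q (Cplus x y)) (RtoC 1) = RtoC 0).
  { intros x y Hxy Hx Hy.
    assert (E : Cmult (Cminus x y) (Cplus (Cmult q (Cplus x y)) (RtoC 1)) = RtoC 0).
    { transitivity (Cminus (Cplus p (Cplus (Cmult q (Cmult x x)) x))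
                           (Cplus p (Cplus (Cmult q (Cmult y y)) y))); [ring|].
      rewrite Hx, Hy. ring. }
    apply Cmult_eq0 in E. destruct E as [E|E]; [|exact E].
    exfalso. apply Hxy, Hsub, E. }
  assert (E1 := Hfac f0 f1 D01 H0 H1). assert (E2 := Hfac f0 f2 D02 H0 H2).
  assert (Eq : Cmult q (Cminus f1 f2) = RtoC 0).
  { transitivity (Cminus (Cplus (Cmult q (Cplus f0 f1)) (RtoC 1))
                         (Cplus (Cmult q (Cplus f0 f2)) (RtoC 1))); [ring|].
    rewrite E1, E2. ring. }
  apply Cmult_eq0 in Eq. destruct Eq as [Eq|Eq]; [|apply D12, Hsub, Eq].
  rewrite Eq in E1. assert (E3 : RtoC 1 = RtoC 0) by (rewrite <- E1; ring).
  injection E3. lra.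
Qed.

Lemma Rabs_mix_same_sign (w M t : R) :
  w <> 0 -> 0 <= M -> 0 <= t <= 1 ->
  Rabs (w * (1 - t + t * (M / Rabs w))) = (1 - t) * Rabs w + t * M.
Proof.
  intros Hw HM Ht. assert (Hpos := Rabs_pos_lt w Hw).
  rewrite Rabs_mult, (Rabs_pos_eq (1 - t + _)).
  - field. lra.
  - apply Rplus_le_le_0_compat; [lra|]. apply Rmult_le_pos; [lra|].
    apply Rmult_le_pos; [exact HM|apply Rlt_le, Rinv_0_lt_compat, Hpos].
Qed.

Lemma half_plane_sq_close (u v u0 v0 D : R) :
  0 < u -> 0 < u0 -> u * u - v * v = u0 * u0 - v0 * v0 -> u * v - u0 * v0 = D ->
  Rabs (u - u0) <= 2 * Rabs D / u0 /\ Rabs (v - v0) <= 2 * Rabs D / u0.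
Proof.
  intros Hu Hu0 H1 H2.
  assert (E : ((u - u0) * (u - u0) + (v - v0) * (v - v0)) *
              ((u + u0) * (u + u0) + (v + v0) * (v + v0)) = 2 * D * (2 * D)).
  { transitivity ((u * u - v * v - (u0 * u0 - v0 * v0)) ^ 2 + 4 * (u * v - u0 * v0) ^ 2);
      [ring|]. rewrite H1, H2. ring. }
  assert (Hs : forall z, z * z <= (u - u0) * (u - u0) + (v - v0) * (v - v0) ->
             Rabs z <= 2 * Rabs D / u0).
  { intros z Hz. apply (Rle_div_r _ _ _ Hu0).
    apply Rle_of_sq_le; [pose proof (Rabs_pos D); lra|].
    replace (Rabs z * u0 * (Rabs z * u0)) with ((Rabs z * Rabs z) * (u0 * u0)) by ring.
    replace (2 * Rabs D * (2 * Rabs D)) with (4 * (Rabs D * Rabs D)) by ring.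
    rewrite !Rabs_sq. replace (4 * (D * D)) with (2 * D * (2 * D)) by ring. rewrite <- E.
    pose proof (Rle_0_sqr (v + v0)). unfold Rsqr in *.
    apply Rmult_le_compat; try apply Rle_0_sqr; nra. }
  pose proof (Rle_0_sqr (u - u0)). pose proof (Rle_0_sqr (v - v0)). unfold Rsqr in *.
  split; apply Hs; lra.
Qed.

Lemma is_lim_seq_of_bound (x : nat -> R) (a B : R) :
  (forall n, Rabs (x n - a) <= B * / (INR n + 2)) -> is_lim_seq x a.
Proof.
  intros H.
  assert (L : is_lim_seq (fun n => B * / (INR n + 2)) 0).
  { replace (Finite 0) with (Finite (B * 0)) by (f_equal; ring).
    apply (is_lim_seq_mult' (fun _ => B) _ B 0); [apply is_lim_seq_const|apply is_lim_seq_inv_nat2]. }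
  apply is_lim_seq_le_le with (fun n => a - B * / (INR n + 2)) (fun n => a + B * / (INR n + 2)).
  - intros n. specialize (H n). apply Rabs_le_between in H. lra.
  - replace (Finite a) with (Finite (a - 0)) by (f_equal; ring).
    apply (is_lim_seq_minus' (fun _ => a) _ a 0); [apply is_lim_seq_const|exact L].
  - replace (Finite a) with (Finite (a + 0)) by (f_equal; ring).
    apply (is_lim_seq_plus' (fun _ => a) _ a 0); [apply is_lim_seq_const|exact L].
Qed.

Lemma freq_set_not_isolated (nu a b c km wm h dt u0 v0 : R) :
  0 < nu -> 0 <= b -> 0 < wm -> wm < PI / dt -> freq_set nu a b c km wm h dt u0 v0 ->
  exists U V : nat -> R, (forall n, freq_set nu a b c km wm h dt (U n) (V n)) /\
    (forall n, (U n, V n) <> (u0, v0)) /\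
    (forall n m, n <> m -> (U n, V n) <> (U m, V m)) /\
    is_lim_seq U u0 /\ is_lim_seq V v0.
Proof.
  intros Hnu Hb Hwm HW [Hu0 [w [k [[Hw Hk] [H1 H2]]]]].
  assert (Hw0 : w <> 0) by (intros E; rewrite E, Rabs_R0 in Hw; lra).
  assert (Hwp := Rabs_pos_lt w Hw0).
  assert (HM : exists M, wm <= M <= PI / dt /\ M <> Rabs w).
  { destruct (Req_dec (Rabs w) wm); [exists (PI / dt)|exists wm]; lra. }
  destruct HM as [M [HM1 HM2]].
  set (g := M / Rabs w - 1).
  assert (Hg : w * g <> 0).
  { unfold g. intros E. apply Rmult_integral in E. destruct E as [E|E]; [lra|].
    apply HM2. apply (Rmult_eq_reg_r (/ Rabs w)); [|apply Rinv_neq_0_compat; lra].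
    rewrite Rinv_r; [unfold Rdiv in E; lra|lra]. }
  set (wn := fun n : nat => w * (1 - / (INR n + 2) + / (INR n + 2) * (M / Rabs w))).
  assert (Ewn : forall n, wn n = w + w * g * / (INR n + 2)) by (intros n; unfold wn, g; ring).
  assert (Hwn : forall n, wm <= Rabs (wn n) <= PI / dt).
  { intros n. destruct (inv_nat2_bounds n). unfold wn.
    rewrite Rabs_mix_same_sign; [|exact Hw0|lra|lra]. nra. }
  assert (Hex : forall n, exists f : R * R,
            0 < fst f /\ fst f * fst f - snd f * snd f = x02 nu a b + 4 * nu ^ 2 * k ^ 2 /\
            fst f * snd f = 2 * nu * (wn n + c * k)).
  { intros n. destruct (freq_point nu a b c wm (wn n) k Hnu Hb Hwm (proj1 (Hwn n)))
      as [Hu [v [Hv1 Hv2]]].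
    eexists (_, v). cbn [fst snd]. split; [exact Hu|split; assumption]. }
  apply seq_choice in Hex. destruct Hex as [f Hf].
  exists (fun n => fst (f n)), (fun n => snd (f n)).
  split; [|split; [|split]].
  - intros n. destruct (Hf n) as [F1 [F2 F3]]. split; [exact F1|].
    exists (wn n), k. split; [split; [apply Hwn|exact Hk]|split; assumption].
  - intros n E. injection E as E1 E2. destruct (Hf n) as [F1 [F2 F3]].
    rewrite E1, E2, H2, Ewn in F3. destruct (inv_nat2_bounds n) as [I _].
    assert (E : w * g * / (INR n + 2) = 0) by (apply (Rmult_eq_reg_l (2 * nu)); lra).
    apply Rmult_integral in E. destruct E; lra.
  - intros n m Hnm E. injection E as E1 E2. destruct (Hf n) as [F1 [F2 F3]].
    destruct (Hf m) as [G1 [G2 G3]].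
    rewrite E1, E2, G3, !Ewn in F3.
    assert (E : w * g * (/ (INR n + 2) - / (INR m + 2)) = 0)
      by (apply (Rmult_eq_reg_l (2 * nu)); lra).
    apply Rmult_integral in E. destruct E as [E|E]; [lra|].
    apply Hnm, INR_eq.
    assert (E3 : INR n + 2 = INR m + 2); [|lra].
    apply Rinv_eq_reg. lra.
  - assert (Hcl : forall n, Rabs (fst (f n) - u0) <= 4 * nu * Rabs (w * g) / u0 * / (INR n + 2) /\
                          Rabs (snd (f n) - v0) <= 4 * nu * Rabs (w * g) / u0 * / (INR n + 2)).
    { intros n. destruct (Hf n) as [F1 [F2 F3]]. destruct (inv_nat2_bounds n) as [I _].
      replace (4 * nu * Rabs (w * g) / u0 * / (INR n + 2))
        with (2 * Rabs (2 * nu * (w * g * / (INR n + 2))) / u0).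
      - apply half_plane_sq_close; auto; [lra|]. rewrite F3, H2, Ewn. ring.
      - rewrite Rabs_mult, (Rabs_pos_eq (2 * nu)) by lra.
        rewrite (Rabs_mult (w * g)), (Rabs_pos_eq (/ (INR n + 2))) by lra.
        pose proof (pos_INR n). field. lra. }
    split; eapply is_lim_seq_of_bound; intros n; apply Hcl.
Qed.

Lemma numer_denom_pos (p q : C) (u v : R) :
  0 < u -> numer p q u v <= 0 -> denom p q u v <= 0 -> False.
Proof.
  intros Hu HN HM. unfold numer, denom in *.
  set (X := symX p q u v) in *. set (Y := symY p q u v) in *.
  pose proof (Rle_0_sqr X). pose proof (Rle_0_sqr Y). pose proof (Rle_0_sqr v). unfold Rsqr in *.
  nra.
Qed.

Lemma supRho_le_iff (nu a b c km wm h dt L d : R) (p q : C) :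
  0 < nu -> 0 <= b -> 0 < wm -> wm < PI / dt -> 0 <= d ->
  Rbar_le (supRho nu a b c km wm h dt L p q) (Finite d) <->
  admissible (freq_set nu a b c km wm h dt) (L / nu) d (shift_p nu a b p q) (shift_q nu q).
Proof.
  intros Hnu Hb Hwm HW Hd.
  set (p' := shift_p nu a b p q). set (q' := shift_q nu q).
  unfold supRho. set (E := fun r => _).
  destruct (Lub_Rbar_correct E) as [Hub Hlub].
  split.
  - intros Hsup.
    assert (Hreg : forall u v, freq_set nu a b c km wm h dt u v -> denom p' q' u v <> 0 ->
              numer p' q' u v <= d * d * exp (L / nu * u) * denom p' q' u v).
    { intros u v [Hu [w [k [HD [H1 H2]]]]] Hne.
      assert (Hden : 0 < denom p' q' u v) by (pose proof (denom_ge0 p' q' u v); lra).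
      assert (Hrho : Cmod (rho nu a b c w k p q L) <= d).
      { assert (Rbar_le (Finite (Cmod (rho nu a b c w k p q L))) (Finite d)); [|assumption].
        eapply Rbar_le_trans; [|exact Hsup]. apply Hub. exists w, k. auto. }
      rewrite (Cmod_rho_eq nu a b c w k L u v p q Hnu Hu H1 H2 Hden) in Hrho.
      fold p' q' in Hrho.
      set (e := exp (- (L / nu * u) / 2)) in *.
      assert (He : 0 < e) by apply exp_pos.
      assert (Hee : e * e * exp (L / nu * u) = 1).
      { unfold e. rewrite <- !exp_plus, <- exp_0. f_equal. field. lra. }
      assert (Hsd := sqrt_lt_R0 _ Hden).
      assert (Hsdd := sqrt_sqrt _ (Rlt_le _ _ Hden)).
      assert (Hsnn := sqrt_sqrt _ (numer_ge0 p' q' u v)).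
      assert (Hsn := sqrt_pos (numer p' q' u v)).
      set (sn := sqrt (numer p' q' u v)) in *. set (sd := sqrt (denom p' q' u v)) in *.
      assert (H3 : sn * e <= d * sd).
      { apply (Rmult_le_compat_r sd) in Hrho; [|lra].
        replace (sn / sd * e * sd) with (sn * e) in Hrho by (field; lra). exact Hrho. }
      assert (H4 : sn * e * (sn * e) <= d * sd * (d * sd)) by (apply Rmult_le_compat; nra).
      rewrite <- Hsnn, <- Hsdd.
      replace (sn * sn) with (sn * e * (sn * e) * exp (L / nu * u)).
      - replace (d * d * exp (L / nu * u) * (sd * sd))
          with (d * sd * (d * sd) * exp (L / nu * u)) by ring.
        apply Rmult_le_compat_r; [apply Rlt_le, exp_pos|exact H4].
      - transitivity (sn * sn * (e * e * exp (L / nu * u))); [ring|rewrite Hee; ring]. }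
    intros u v Huv.
    destruct (Req_dec (denom p' q' u v) 0) as [H0|H0]; [|apply Hreg; assumption].
    (* A pole would be approached by regular points, where the constraint holds. *)
    exfalso.
    destruct (freq_set_not_isolated nu a b c km wm h dt u v Hnu Hb Hwm HW Huv)
      as [U [V [HK [Hd0 [Hdist [HU HV]]]]]].
    assert (Hone : forall n m, denom p' q' (U n) (V n) = 0 -> denom p' q' (U m) (V m) = 0 -> n = m).
    { intros n m Hn Hm. destruct (Nat.eq_dec n m) as [Enm|Enm]; [exact Enm|exfalso].
      apply (no_three_poles p' q' (u, v) (U n, V n) (U m, V m)); auto using denom_eq0_C. }
    assert (Hev : exists n0, forall n, (n0 <= n)%nat -> denom p' q' (U n) (V n) <> 0).
    { destruct (classic (exists n1, denom p' q' (U n1) (V n1) = 0)) as [[n1 Hn1]|Hno].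
      - exists (S n1). intros n Hn Hz. specialize (Hone n n1 Hz Hn1). lia.
      - exists O. intros n _ Hz. apply Hno. eauto. }
    destruct Hev as [n0 Hn0].
    assert (Hle : excess (L / nu) d p' q' u v <= 0).
    { destruct p' as [p1 p2], q' as [q1 q2].
      assert (Hlim : is_lim_seq (fun n => excess (L / nu) d (p1, p2) (q1, q2)
                        (U (n + n0)%nat) (V (n + n0)%nat)) (excess (L / nu) d (p1, p2) (q1, q2) u v)).
      { apply (is_lim_seq_incr_n (fun n => excess (L / nu) d (p1, p2) (q1, q2) (U n) (V n))).
        apply (excess_lim (L / nu) (fun _ => d) (fun _ => p1) (fun _ => p2) (fun _ => q1)
                 (fun _ => q2) U V); lim_arith. }
      refine (is_lim_seq_le _ (fun _ => 0) _ 0 _ Hlim (is_lim_seq_const 0)).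
      intros n. unfold excess. specialize (Hreg _ _ (HK (n + n0)%nat) (Hn0 (n + n0)%nat ltac:(lia))).
      lra. }
    unfold excess in Hle. rewrite H0 in Hle. destruct Huv as [Hu _].
    apply (numer_denom_pos p' q' u v Hu); lra.
  - intros Hadm. apply Hlub. intros r [w [k [HD ->]]].
    destruct (freq_point nu a b c wm w k Hnu Hb Hwm (proj1 (proj1 HD))) as [Hu [v [H1 H2]]].
    set (u := half_plane_root _ _) in *.
    assert (Huv : freq_set nu a b c km wm h dt u v) by (split; [exact Hu|exists w, k; auto]).
    specialize (Hadm u v Huv).
    assert (Hden : 0 < denom p' q' u v).
    { apply Rnot_le_lt. intros Hle. apply (numer_denom_pos p' q' u v Hu); [|exact Hle].
      assert (E0 : denom p' q' u v = 0) by (pose proof (denom_ge0 p' q' u v); lra).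
      rewrite E0 in Hadm. lra. }
    rewrite (Cmod_rho_eq nu a b c w k L u v p q Hnu Hu H1 H2 Hden). fold p' q'. simpl.
    set (e := exp (- (L / nu * u) / 2)) in *.
    assert (He : 0 < e) by apply exp_pos.
    assert (Hee : e * e * exp (L / nu * u) = 1).
    { unfold e. rewrite <- !exp_plus, <- exp_0. f_equal. field. lra. }
    assert (Hsd := sqrt_lt_R0 _ Hden).
    assert (Hsdd := sqrt_sqrt _ (Rlt_le _ _ Hden)).
    assert (Hsnn := sqrt_sqrt _ (numer_ge0 p' q' u v)).
    set (sn := sqrt (numer p' q' u v)) in *. set (sd := sqrt (denom p' q' u v)) in *.
    replace (sn / sd * e) with (sn * e / sd) by (field; lra).
    apply (Rle_div_l _ _ _ Hsd).
    apply Rle_of_sq_le; [apply Rmult_le_pos; lra|].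
    apply (Rmult_le_compat_l (e * e)) in Hadm; [|nra].
    replace (sn * e * (sn * e)) with (e * e * (sn * sn)) by ring. rewrite Hsnn.
    eapply Rle_trans; [exact Hadm|]. right. rewrite <- Hsdd.
    transitivity (e * e * exp (L / nu * u) * (d * d * (sd * sd))); [ring|rewrite Hee; ring].
Qed.

Lemma freq_set_conj (nu a b c km wm h dt u v : R) :
  freq_set nu a b c km wm h dt u v -> freq_set nu a b c km wm h dt u (- v).
Proof.
  intros [Hu [w [k [HD [H1 H2]]]]]. split; [exact Hu|].
  exists (- w), (- k). split; [|split].
  - unfold inD in *. rewrite !Rabs_Ropp. exact HD.
  - replace ((- k) ^ 2) with (k ^ 2) by ring. lra.
  - lra.
Qed.

Lemma freq_set_slope_le1 (nu a b c km wm h dt u v : R) :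
  0 < nu -> 0 <= b -> freq_set nu a b c km wm h dt u v -> Rabs v <= u.
Proof.
  intros Hnu Hb [Hu [w [k [HD [H1 H2]]]]].
  pose proof (x02_ge0 nu a b Hnu Hb).
  assert (0 <= nu ^ 2 * k ^ 2) by (apply Rmult_le_pos; apply pow2_ge_0).
  apply Rle_of_sq_le; [lra|]. rewrite Rabs_sq. lra.
Qed.

Lemma is_lim_seq_between (x : nat -> R) (a lo hi : R) :
  (forall n, lo <= x n <= hi) -> is_lim_seq x a -> lo <= a <= hi.
Proof.
  intros H L. split.
  - apply is_lim_seq_le_const with x; [intros n; apply H|exact L].
  - exact (is_lim_seq_le x (fun _ => hi) a hi (fun n => proj2 (H n)) L (is_lim_seq_const hi)).
Qed.

Lemma is_lim_seq_eq (x y : nat -> R) (a b : R) :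
  (forall n, x n = y n) -> is_lim_seq x a -> is_lim_seq y b -> a = b.
Proof.
  intros H Hx Hy. apply (is_lim_seq_ext x y a H) in Hx.
  apply is_lim_seq_unique in Hx, Hy. congruence.
Qed.

Lemma freq_set_compact (nu a b c km wm h dt : R) :
  0 < nu -> 0 <= b -> 0 < wm -> seq_compact (freq_set nu a b c km wm h dt).
Proof.
  intros Hnu Hb Hwm U V HK.
  pose proof (x02_ge0 nu a b Hnu Hb) as Hx.
  assert (Hex : forall n, exists f : R * R, inD km wm h dt (fst f) (snd f) /\
            U n * U n - V n * V n = x02 nu a b + 4 * nu ^ 2 * snd f ^ 2 /\
            U n * V n = 2 * nu * (fst f + c * snd f)).
  { intros n. destruct (HK n) as [_ [w [k H]]]. exists (w, k). exact H. }
  apply seq_choice in Hex. destruct Hex as [f Hf].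
  set (W := Rabs (PI / dt)). set (Kk := Rabs (PI / h)).
  assert (HW : forall n, Rabs (fst (f n)) <= W + Kk).
  { intros n. destruct (Hf n) as [[[_ H] _] _]. pose proof (Rabs_pos (PI / h)).
    pose proof (Rle_abs (PI / dt)). unfold W, Kk. lra. }
  assert (HKk : forall n, Rabs (snd (f n)) <= W + Kk).
  { intros n. destruct (Hf n) as [[_ [_ H]] _]. pose proof (Rabs_pos (PI / dt)).
    pose proof (Rle_abs (PI / h)). unfold W, Kk. lra. }
  set (B0 := W + Kk) in *.
  assert (HB0 : 0 <= B0) by (pose proof (Rabs_pos (PI / dt)); pose proof (Rabs_pos (PI / h)); unfold B0, W, Kk; lra).
  set (B1 := 2 * nu * (B0 + Rabs c * B0)).
  assert (HB1 : 0 <= B1) by (unfold B1; pose proof (Rabs_pos c); apply Rmult_le_pos; nra).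
  set (B2 := 1 + (x02 nu a b + 4 * nu ^ 2 * (B0 * B0) + B1)).
  assert (Hnb : 0 <= nu ^ 2 * (B0 * B0)) by (apply Rmult_le_pos; [apply pow2_ge_0|nra]).
  assert (HUV : forall n, Rabs (U n) <= B2 /\ Rabs (V n) <= B2).
  { intros n. destruct (Hf n) as [_ [F1 F2]]. destruct (HK n) as [Hun _].
    assert (Hvu := freq_set_slope_le1 nu a b c km wm h dt _ _ Hnu Hb (HK n)).
    assert (Hfk : snd (f n) ^ 2 <= B0 * B0).
    { rewrite <- (Rabs_sq B0), <- Rsqr_pow2, Rsqr_abs. unfold Rsqr.
      rewrite (Rabs_pos_eq B0) by lra. pose proof (Rabs_pos (snd (f n))).
      apply Rmult_le_compat; auto. }
    assert (Huv : Rabs (U n * V n) <= B1).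
    { rewrite F2. unfold B1. rewrite Rabs_mult, (Rabs_pos_eq (2 * nu)) by lra.
      apply Rmult_le_compat_l; [lra|]. eapply Rle_trans; [apply Rabs_triang|].
      apply Rplus_le_compat; [apply HW|]. rewrite Rabs_mult.
      apply Rmult_le_compat_l; [apply Rabs_pos|apply HKk]. }
    assert (Hvv : V n * V n <= B1).
    { eapply Rle_trans; [|exact Huv]. rewrite Rabs_mult, (Rabs_pos_eq (U n)) by lra.
      rewrite <- Rabs_sq. apply Rmult_le_compat_r; [apply Rabs_pos|exact Hvu]. }
    assert (Huu : U n * U n <= B2 - 1).
    { assert (nu ^ 2 * snd (f n) ^ 2 <= nu ^ 2 * (B0 * B0))
        by (apply Rmult_le_compat_l; [apply pow2_ge_0|exact Hfk]).
      unfold B2. lra. }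
    assert (HU : U n <= B2) by nra.
    rewrite (Rabs_pos_eq (U n)) by lra. split; lra. }
  set (BB := B0 + B2).
  assert (HB2 : 0 <= B2) by (unfold B2; lra).
  destruct (bounded_seq4_cvg_subseq (fun n => fst (f n)) (fun n => snd (f n)) U V BB)
    as [g [w [k [u [v [Hg [Lw [Lk [Lu Lv]]]]]]]]].
  { intros n. specialize (HW n). unfold BB. lra. }
  { intros n. specialize (HKk n). unfold BB. lra. }
  { intros n. destruct (HUV n). unfold BB. lra. }
  { intros n. destruct (HUV n). unfold BB. lra. }
  exists g, u, v. split; [exact Hg|]. split; [|split; assumption].
  assert (HwD : wm <= Rabs w <= PI / dt).
  { apply is_lim_seq_between with (fun n => Rabs (fst (f (g n)))).
    - intros n. apply (Hf (g n)).
    - apply (is_lim_seq_abs _ (Finite w)), Lw. }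
  assert (HkD : km <= Rabs k <= PI / h).
  { apply is_lim_seq_between with (fun n => Rabs (snd (f (g n)))).
    - intros n. apply (Hf (g n)).
    - apply (is_lim_seq_abs _ (Finite k)), Lk. }
  assert (E1 : u * u - v * v = x02 nu a b + 4 * nu ^ 2 * (k * k)).
  { eapply is_lim_seq_eq with (x := fun n => U (g n) * U (g n) - V (g n) * V (g n))
      (y := fun n => x02 nu a b + 4 * nu ^ 2 * (snd (f (g n)) * snd (f (g n)))); [|lim_arith|lim_arith].
    intros n. destruct (Hf (g n)) as [_ [F1 _]]. rewrite F1. ring. }
  assert (E2 : u * v = 2 * nu * (w + c * k)).
  { eapply is_lim_seq_eq with (x := fun n => U (g n) * V (g n))
      (y := fun n => 2 * nu * (fst (f (g n)) + c * snd (f (g n)))); [|lim_arith|lim_arith].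
    intros n. destruct (Hf (g n)) as [_ [_ F2]]. exact F2. }
  assert (Hu0 : 0 <= u).
  { apply is_lim_seq_le_const with (fun n => U (g n)); [|exact Lu].
    intros n. destruct (HK (g n)). lra. }
  assert (E1' : u * u - v * v = x02 nu a b + 4 * nu ^ 2 * k ^ 2) by (rewrite E1; ring).
  split; [|exists w, k; split; [split; assumption|split; assumption]].
  destruct Hu0 as [Hu0|Hu0]; [exact Hu0|exfalso].
  destruct (freq_point nu a b c wm w k Hnu Hb Hwm (proj1 HwD)) as [Hu' [v' [G1 G2]]].
  set (u' := half_plane_root _ _) in *.
  rewrite <- Hu0 in E1', E2.
  assert (Hz : v' = 0).
  { assert (E : u' * v' = 0) by lra. apply Rmult_integral in E. destruct E; lra. }
  rewrite Hz in G1. nra.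
Qed.

Lemma half_plane_root_quartic (nu X xi : R) :
  0 < nu -> 0 <= X -> 0 < X * X + 4 * nu * xi * (4 * nu * xi) ->
  let y := half_plane_root X (4 * nu * xi) in
  0 < y /\ X <= y * y /\ y * y * (y * y - X) = 4 * nu ^ 2 * xi ^ 2.
Proof.
  intros Hnu HX Hpos y.
  destruct (half_plane_root_spec X (4 * nu * xi) HX Hpos) as [Hy E]. fold y in Hy, E.
  set (t := 4 * nu * xi / (2 * y)) in *.
  assert (Ht : t * y = 2 * nu * xi) by (unfold t; field; lra).
  split; [exact Hy|]. split; [pose proof (Rle_0_sqr t); unfold Rsqr in *; lra|].
  replace (y * y - X) with (t * t) by lra.
  transitivity ((t * y) * (t * y)); [ring|]. rewrite Ht. ring.
Qed.

Lemma quartic_le (X T u y : R) :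
  0 < u -> 0 < y -> X <= u * u -> u * u * (u * u - X) = T -> y * y * (y * y - X) <= T -> y <= u.
Proof.
  intros Hu Hy HX HT H. apply Rnot_lt_le. intros Hlt.
  assert (H1 : u * u < y * y) by nra.
  assert (u * u * (u * u - X) <= u * u * (y * y - X)) by (apply Rmult_le_compat_l; nra).
  assert (u * u * (y * y - X) < y * y * (y * y - X)) by (apply Rmult_lt_compat_r; lra).
  lra.
Qed.

Lemma phi_eq (nu a b k xi : R) :
  0 <= x02 nu a b ->
  phi nu a b k xi = 4 * half_plane_root (x02 nu a b + 4 * nu ^ 2 * k ^ 2) (4 * nu * xi).
Proof.
  intros Hx. unfold phi, half_plane_root.
  set (X := x02 nu a b + 4 * nu ^ 2 * k ^ 2).
  assert (HX : 0 <= X).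
  { unfold X. assert (0 <= nu ^ 2 * k ^ 2) by (apply Rmult_le_pos; apply pow2_ge_0). lra. }
  replace (X ^ 2 + 16 * nu ^ 2 * xi ^ 2) with (X * X + 4 * nu * xi * (4 * nu * xi)) by ring.
  set (r := sqrt (X * X + 4 * nu * xi * (4 * nu * xi))).
  replace (r + x02 nu a b + 4 * nu ^ 2 * k ^ 2) with (r + X) by (unfold X; ring).
  assert (Hr : 0 <= r) by apply sqrt_pos.
  rewrite sqrt_div_alt by lra.
  assert (H2 : 0 < sqrt 2) by (apply sqrt_lt_R0; lra).
  assert (H22 : sqrt 2 * sqrt 2 = 2) by (apply sqrt_sqrt; lra).
  apply (Rmult_eq_reg_r (sqrt 2)); [|lra].
  replace (4 * (sqrt (r + X) / sqrt 2) * sqrt 2) with (4 * sqrt (r + X)) by (field; lra).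
  transitivity (2 * (sqrt 2 * sqrt 2) * sqrt (r + X)); [ring|rewrite H22; ring].
Qed.

(* With [G = (sqrt ((c^2 + x0^2)^2 + 16 nu^2 wm^2) + c^2 + x0^2) / 2] one has
   [kbar = |c| wm / G], and the real part of the root there is [sqrt (G - c^2)]. *)
Lemma kbar_spec (nu a b c wm : R) :
  0 < nu -> 0 <= b -> 0 < wm ->
  let kb := kbar nu a b c wm in
  let X := x02 nu a b + 4 * nu ^ 2 * kb ^ 2 in
  let y := half_plane_root X (4 * nu * (- wm + Rabs c * kb)) in
  0 <= kb /\ Rabs c * kb < wm /\ 0 < y /\ kb * (y * y + c * c) = wm * Rabs c /\
  X <= y * y /\ y * y * (y * y - X) = 4 * nu ^ 2 * (- wm + Rabs c * kb) ^ 2.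
Proof.
  intros Hnu Hb Hwm kb X y.
  pose proof (x02_ge0 nu a b Hnu Hb) as Hx.
  set (S := c ^ 2 + x02 nu a b).
  assert (Hc2 : 0 <= c * c) by apply Rle_0_sqr.
  assert (HS : 0 <= S) by (unfold S; simpl; lra).
  set (Z := S ^ 2 + 16 * nu ^ 2 * wm ^ 2).
  assert (Hnw : 0 < nu ^ 2 * wm ^ 2) by (apply Rmult_lt_0_compat; apply pow_lt; lra).
  assert (HZ : 0 < Z) by (unfold Z; pose proof (pow2_ge_0 S); lra).
  assert (HT := sqrt_lt_R0 _ HZ). assert (HTT := sqrt_sqrt _ (Rlt_le _ _ HZ)).
  set (T := sqrt Z) in *.
  assert (HTS : S < T).
  { apply Rnot_le_lt. intros Hle. assert (T * T <= S * S) by (apply Rmult_le_compat; lra).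
    unfold Z in HTT. simpl in *. lra. }
  set (G := (T + S) / 2).
  assert (HG : 0 < G) by (unfold G; lra).
  assert (HGc : c * c < G) by (unfold G, S in *; simpl in *; lra).
  assert (HGG : G * G = S * G + 4 * nu ^ 2 * wm ^ 2).
  { unfold G. unfold Z in HTT. replace ((T + S) / 2 * ((T + S) / 2))
      with ((T * T + 2 * T * S + S * S) / 4) by field. rewrite HTT. field. }
  assert (Ekb : kb = Rabs c * wm / G).
  { unfold kb, kbar. fold S. fold Z. fold T.
    assert (E : (T - S) * (2 * G) = 16 * nu ^ 2 * wm ^ 2).
    { unfold G. transitivity (T * T - S ^ 2); [field|]. rewrite HTT. unfold Z. ring. }
    apply (Rmult_eq_reg_r (2 * G)); [|lra].
    transitivity (Rabs c * ((T - S) * (2 * G)) / (8 * nu ^ 2 * wm)); [field; lra|].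
    rewrite E. field. lra. }
  pose proof (Rabs_pos c) as Hac.
  assert (Hcc : Rabs c * Rabs c = c * c) by apply Rabs_sq.
  assert (Hkb : 0 <= kb).
  { rewrite Ekb. apply Rmult_le_pos; [apply Rmult_le_pos; lra|apply Rlt_le, Rinv_0_lt_compat, HG]. }
  assert (Hckb : Rabs c * kb = c * c * wm / G).
  { rewrite Ekb, <- Hcc. field. lra. }
  assert (Hlt : Rabs c * kb < wm).
  { rewrite Hckb. apply (Rlt_div_l _ _ _ HG). nra. }
  assert (HX : 0 <= X).
  { unfold X. assert (0 <= nu ^ 2 * kb ^ 2) by (apply Rmult_le_pos; apply pow2_ge_0). lra. }
  set (xi := - wm + Rabs c * kb) in *.
  assert (Hxi : xi < 0) by (unfold xi; lra).
  destruct (half_plane_root_quartic nu X xi Hnu HX) as [Hy [Hy1 Hy2]].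
  { assert (0 < (4 * nu * xi) * (4 * nu * xi)).
    { assert (4 * nu * xi < 0) by nra. nra. }
    pose proof (Rle_0_sqr X). unfold Rsqr in *. lra. }
  fold y in Hy, Hy1, Hy2.
  set (z := sqrt (G - c * c)).
  assert (Hz : 0 < z) by (apply sqrt_lt_R0; lra).
  assert (Hzz : z * z = G - c * c) by (apply sqrt_sqrt; lra).
  assert (Hzq : z * z * (z * z - X) = 4 * nu ^ 2 * xi ^ 2).
  { rewrite Hzz. unfold xi. rewrite Hckb. unfold X.
    replace (kb ^ 2) with (c * c * (wm / G) ^ 2) by (rewrite Ekb, <- Hcc; field; lra).
    apply Rminus_diag_uniq.
    transitivity ((G - c * c) * (G * G - (S * G + 4 * nu ^ 2 * wm ^ 2)) / G).
    - unfold S. field. lra.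
    - rewrite HGG. field. lra. }
  assert (HzX : X <= z * z).
  { apply Rnot_lt_le. intros Hneg.
    assert (0 <= nu ^ 2 * xi ^ 2) by (apply Rmult_le_pos; apply pow2_ge_0).
    assert (0 < z * z) by nra. nra. }
  assert (Eyz : y = z).
  { apply Rle_antisym; eapply quartic_le; eauto; lra. }
  repeat split; auto.
  rewrite Eyz, Hzz, Ekb. field. lra.
Qed.

Definition freq_quartic (nu a b c wm y k : R) : R :=
  y * y * (y * y - (x02 nu a b + 4 * nu ^ 2 * k ^ 2)) - 4 * nu ^ 2 * (- wm + Rabs c * k) ^ 2.

(* [freq_quartic] is a concave quadratic function of [k]. *)
Lemma freq_quartic_le0 (nu a b c wm y k0 k : R) :
  0 < nu -> 0 <= k0 -> k0 <= k -> wm * Rabs c <= k0 * (y * y + c * c) ->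
  freq_quartic nu a b c wm y k0 = 0 -> freq_quartic nu a b c wm y k <= 0.
Proof.
  intros Hnu Hk0 Hk Hcrit H0.
  assert (Hcc : Rabs c * Rabs c = c * c) by apply Rabs_sq.
  assert (E : freq_quartic nu a b c wm y k - freq_quartic nu a b c wm y k0
    = - (4 * nu ^ 2 * ((k - k0) * ((y * y + c * c) * (k + k0) - 2 * (wm * Rabs c))))).
  { unfold freq_quartic. rewrite <- Hcc. ring. }
  assert (0 <= (k - k0) * ((y * y + c * c) * (k + k0) - 2 * (wm * Rabs c))).
  { apply Rmult_le_pos; [lra|].
    assert ((y * y + c * c) * (2 * k0) <= (y * y + c * c) * (k + k0))
      by (apply Rmult_le_compat_l; nra). lra. }
  assert (0 <= nu ^ 2 * ((k - k0) * ((y * y + c * c) * (k + k0) - 2 * (wm * Rabs c))))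
    by (apply Rmult_le_pos; [apply pow2_ge_0|assumption]).
  lra.
Qed.

Lemma Aconst_spec (nu a b c km wm : R) :
  0 < nu -> 0 <= b -> 0 <= km -> 0 < wm ->
  let y := Aconst nu a b c km wm / 4 in
  0 < y /\
  (forall w k u v, wm <= Rabs w -> km <= Rabs k -> 0 < u ->
     u * u - v * v = x02 nu a b + 4 * nu ^ 2 * k ^ 2 -> u * v = 2 * nu * (w + c * k) -> y <= u) /\
  (exists w1 k1 v1, wm <= Rabs w1 /\ km <= Rabs k1 /\
     y * y - v1 * v1 = x02 nu a b + 4 * nu ^ 2 * k1 ^ 2 /\ y * v1 = 2 * nu * (w1 + c * k1)).
Proof.
  intros Hnu Hb Hkm Hwm y.
  pose proof (x02_ge0 nu a b Hnu Hb) as Hx. pose proof (Rabs_pos c) as Hac.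
  assert (HXk : forall k, 0 <= x02 nu a b + 4 * nu ^ 2 * k ^ 2).
  { intros k. assert (0 <= nu ^ 2 * k ^ 2) by (apply Rmult_le_pos; apply pow2_ge_0). lra. }
  assert (HXabs : forall k k0, 0 <= k0 <= Rabs k ->
            x02 nu a b + 4 * nu ^ 2 * k0 ^ 2 <= x02 nu a b + 4 * nu ^ 2 * k ^ 2).
  { intros k k0 Hk. assert (k0 ^ 2 <= k ^ 2).
    { rewrite <- (pow2_abs k). simpl. nra. }
    assert (nu ^ 2 * k0 ^ 2 <= nu ^ 2 * k ^ 2) by (apply Rmult_le_compat_l; [apply pow2_ge_0|assumption]).
    lra. }
  destruct (kbar_spec nu a b c wm Hnu Hb Hwm) as [Kb0 [Kb1 [Yb0 [Yb1 [Yb2 Yb3]]]]].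
  set (kb := kbar nu a b c wm) in *. set (Xb := x02 nu a b + 4 * nu ^ 2 * kb ^ 2) in *.
  set (yb := half_plane_root Xb (4 * nu * (- wm + Rabs c * kb))) in *.
  assert (Hqb : freq_quartic nu a b c wm yb kb = 0).
  { unfold freq_quartic. fold Xb. rewrite Yb3. ring. }
  assert (Hred : forall k0, 0 <= k0 -> Rabs c * k0 <= wm -> 0 < y ->
            (forall k, k0 <= k -> freq_quartic nu a b c wm y k <= 0) ->
            forall w k u v, wm <= Rabs w -> k0 <= Rabs k -> 0 < u ->
     u * u - v * v = x02 nu a b + 4 * nu ^ 2 * k ^ 2 -> u * v = 2 * nu * (w + c * k) -> y <= u).
  { intros k0 Hk0 Hck0 Hy Hneg w k u v Hw Hk Hu E1 E2.
    assert (HuX : x02 nu a b + 4 * nu ^ 2 * k ^ 2 <= u * u).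
    { pose proof (Rle_0_sqr v). unfold Rsqr in *. lra. }
    apply quartic_le with (X := x02 nu a b + 4 * nu ^ 2 * k ^ 2) (T := 4 * nu ^ 2 * (w + c * k) ^ 2);
      auto.
    { replace (u * u - (x02 nu a b + 4 * nu ^ 2 * k ^ 2)) with (v * v) by lra.
      transitivity ((u * v) * (u * v)); [ring|]. rewrite E2. ring. }
    assert (Hxi2 : 0 <= nu ^ 2 * (w + c * k) ^ 2) by (apply Rmult_le_pos; apply pow2_ge_0).
    destruct (Rle_lt_dec (Rabs c * Rabs k) wm) as [Hle|Hgt].
    - specialize (Hneg (Rabs k) Hk). unfold freq_quartic in Hneg. rewrite pow2_abs in Hneg.
      assert (Hxi : wm - Rabs c * Rabs k <= Rabs (w + c * k)).
      { replace w with ((w + c * k) - c * k) in Hw by ring.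
        pose proof (Rabs_triang (w + c * k) (- (c * k))) as Htri.
        rewrite Rabs_Ropp, Rabs_mult in Htri. unfold Rminus in Hw. lra. }
      assert (Hsq : (- wm + Rabs c * Rabs k) ^ 2 <= (w + c * k) ^ 2).
      { rewrite <- (pow2_abs (w + c * k)).
        replace ((- wm + Rabs c * Rabs k) ^ 2) with ((wm - Rabs c * Rabs k) ^ 2) by ring.
        apply pow_incr. lra. }
      assert (nu ^ 2 * (- wm + Rabs c * Rabs k) ^ 2 <= nu ^ 2 * (w + c * k) ^ 2)
        by (apply Rmult_le_compat_l; [apply pow2_ge_0|assumption]).
      lra.
    - assert (Hc0 : 0 < Rabs c).
      { destruct Hac as [Hac|Hac]; [exact Hac|]. rewrite <- Hac in Hgt. lra. }
      set (k2 := wm / Rabs c).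
      assert (Hk2 : Rabs c * k2 = wm) by (unfold k2; field; lra).
      assert (Hk02 : k0 <= k2) by (apply (Rmult_le_reg_l (Rabs c)); lra).
      specialize (Hneg k2 Hk02). unfold freq_quartic in Hneg. rewrite Hk2 in Hneg.
      replace ((- wm + wm) ^ 2) with 0 in Hneg by ring.
      assert (Hk2k : 0 <= k2 <= Rabs k).
      { split; [lra|]. apply (Rmult_le_reg_l (Rabs c)); lra. }
      specialize (HXabs k k2 Hk2k).
      assert (y * y * (y * y - (x02 nu a b + 4 * nu ^ 2 * k ^ 2))
              <= y * y * (y * y - (x02 nu a b + 4 * nu ^ 2 * k2 ^ 2)))
        by (apply Rmult_le_compat_l; [apply Rle_0_sqr|lra]).
      lra. }
  assert (Hsgn : forall k, 0 <= k -> exists k1, Rabs k1 = k /\ k1 ^ 2 = k ^ 2 /\ c * k1 = - (Rabs c * k)).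
  { intros k Hk. destruct (Rle_lt_dec 0 c) as [Hc|Hc].
    - exists (- k). rewrite Rabs_Ropp, (Rabs_pos_eq k), (Rabs_pos_eq c) by lra.
      repeat split; ring.
    - exists k. rewrite (Rabs_pos_eq k), (Rabs_left c) by lra. repeat split; ring. }
  assert (Hwit : forall k xi, 0 < y -> y * y * (y * y - (x02 nu a b + 4 * nu ^ 2 * k ^ 2))
       = 4 * nu ^ 2 * xi ^ 2 -> forall w1 k1, k1 ^ 2 = k ^ 2 -> (w1 + c * k1) ^ 2 = xi ^ 2 ->
       exists v1, y * y - v1 * v1 = x02 nu a b + 4 * nu ^ 2 * k1 ^ 2 /\
                  y * v1 = 2 * nu * (w1 + c * k1)).
  { intros k xi Hy E w1 k1 Ek Ew. exists (2 * nu * (w1 + c * k1) / y). split; [|field; lra].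
    rewrite Ek. apply (Rmult_eq_reg_l (y * y)); [|nra].
    transitivity (y * y * (y * y) - 4 * nu ^ 2 * (w1 + c * k1) ^ 2); [field; lra|].
    rewrite Ew, <- E. ring. }
  unfold Aconst in y. fold kb in y.
  destruct (Rle_dec km kb) as [H1|H1]; [|destruct (Rle_dec wm (Rabs c * km)) as [H2|H2]].
  - assert (Ey : y = yb) by (unfold y; rewrite phi_eq by exact Hx; fold Xb yb; field).
    clearbody y. rewrite Ey in *. clear Ey y.
    split; [exact Yb0|split].
    + intros w k u v Hw Hk. apply (Hred 0 (Rle_refl 0)); auto; [lra| |apply Rabs_pos].
      intros k' Hk'.
      assert (E : freq_quartic nu a b c wm yb k' - freq_quartic nu a b c wm yb kb
        = - (4 * nu ^ 2 * ((yb * yb + c * c) * (k' - kb) ^ 2))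
          - 8 * nu ^ 2 * (k' - kb) * (kb * (yb * yb + c * c) - wm * Rabs c)).
      { unfold freq_quartic. rewrite <- (Rabs_sq c). ring. }
      rewrite Yb1, Hqb in E.
      assert (0 <= nu ^ 2 * ((yb * yb + c * c) * (k' - kb) ^ 2)).
      { apply Rmult_le_pos; [apply pow2_ge_0|apply Rmult_le_pos; [nra|apply pow2_ge_0]]. }
      lra.
    + destruct (Hsgn kb Kb0) as [k1 [A1 [A2 A3]]].
      destruct (Hwit kb (- wm + Rabs c * kb) Yb0 Yb3 wm k1 A2) as [v1 Hv1].
      { rewrite A3. ring. }
      exists wm, k1, v1. rewrite (Rabs_pos_eq wm), A1 by lra. split; [lra|split; [lra|exact Hv1]].
  - set (X := x02 nu a b + 4 * nu ^ 2 * km ^ 2).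
    assert (Hc0 : 0 < Rabs c).
    { destruct Hac as [Hac|Hac]; [exact Hac|]. rewrite <- Hac in H2. lra. }
    assert (Hkm0 : 0 < km).
    { destruct Hkm as [Hkm|Hkm]; [exact Hkm|]. rewrite <- Hkm in H2. lra. }
    assert (HX : 0 < X).
    { unfold X. assert (0 < nu ^ 2 * km ^ 2) by (apply Rmult_lt_0_compat; apply pow_lt; lra). lra. }
    destruct (half_plane_root_quartic nu X 0 Hnu (Rlt_le _ _ HX)) as [Hy0 [Hy1 Hy2]].
    { assert (0 < X * X) by nra. lra. }
    assert (Ey : y = half_plane_root X (4 * nu * 0)).
    { unfold y. rewrite phi_eq by exact Hx. fold X. field. }
    rewrite <- Ey in Hy0, Hy1, Hy2.
    assert (HyX : y * y = X).
    { assert (E : (y * y) * (y * y - X) = 0) by (rewrite Hy2; ring).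
      apply Rmult_integral in E. destruct E; nra. }
    split; [exact Hy0|split].
    + intros w k u v Hw Hk Hu E1 E2. apply Rle_of_sq_le; [lra|]. rewrite HyX.
      specialize (HXabs k km (conj Hkm Hk)). fold X in HXabs.
      pose proof (Rle_0_sqr v). unfold Rsqr in *. lra.
    + destruct (Hwit km 0 Hy0 Hy2 (- (c * km)) km eq_refl) as [v1 Hv1]; [ring|].
      exists (- (c * km)), km, v1. rewrite Rabs_Ropp, Rabs_mult, (Rabs_pos_eq km) by lra.
      split; [lra|split; [lra|exact Hv1]].
  - apply Rnot_le_lt in H1, H2.
    set (X := x02 nu a b + 4 * nu ^ 2 * km ^ 2).
    destruct (half_plane_root_quartic nu X (- wm + Rabs c * km) Hnu (HXk km)) as [Hy0 [Hy1 Hy2]].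
    { assert (0 < (4 * nu * (- wm + Rabs c * km)) * (4 * nu * (- wm + Rabs c * km))).
      { assert (4 * nu * (- wm + Rabs c * km) < 0) by nra. nra. }
      pose proof (Rle_0_sqr X). unfold Rsqr in *. lra. }
    assert (Ey : y = half_plane_root X (4 * nu * (- wm + Rabs c * km))).
    { unfold y. rewrite phi_eq by exact Hx. fold X. field. }
    rewrite <- Ey in Hy0, Hy1, Hy2.
    split; [exact Hy0|split].
    + apply (Hred km); auto; [lra|]. intros k Hk.
      apply (freq_quartic_le0 nu a b c wm y km k); auto.
      * assert (Hyb : yb <= y).
        { apply (quartic_le X (4 * nu ^ 2 * (- wm + Rabs c * km) ^ 2)); auto.
          assert (Hq : freq_quartic nu a b c wm yb km <= 0).
          { apply (freq_quartic_le0 nu a b c wm yb kb km); auto; lra. }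
          unfold freq_quartic in Hq. fold X in Hq. lra. }
        rewrite <- Yb1. apply Rmult_le_compat; [lra| |lra|]; nra.
      * unfold freq_quartic. fold X. rewrite Hy2. ring.
    + destruct (Hsgn km Hkm) as [k1 [A1 [A2 A3]]].
      destruct (Hwit km (- wm + Rabs c * km) Hy0 Hy2 wm k1 A2) as [v1 Hv1].
      { rewrite A3. ring. }
      exists wm, k1, v1. rewrite (Rabs_pos_eq wm), A1 by lra. split; [lra|split; [lra|exact Hv1]].
Qed.

Lemma diag_point (nu a b c km wm h dt u : R) :
  0 < nu -> 0 <= b -> 0 <= km -> 0 < wm -> km <= PI / h ->
  let Xm := x02 nu a b + 4 * nu ^ 2 * km ^ 2 in
  1 + Xm + 2 * nu * (wm + Rabs c * km) <= u -> u * u / (2 * nu) + Rabs c * km <= PI / dt ->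
  freq_set nu a b c km wm h dt u (sqrt (u * u - Xm)) /\
  1 <= sqrt (u * u - Xm) <= u /\ Rabs (sqrt (u * u - Xm) - u) <= Xm.
Proof.
  intros Hnu Hb Hkm Hwm Hkh Xm Hu Hdt.
  pose proof (x02_ge0 nu a b Hnu Hb) as Hx. pose proof (Rabs_pos c) as Hac.
  assert (HXm : 0 <= Xm).
  { unfold Xm. assert (0 <= nu ^ 2 * km ^ 2) by (apply Rmult_le_pos; apply pow2_ge_0). lra. }
  assert (Hck : 0 <= Rabs c * km) by (apply Rmult_le_pos; lra).
  assert (Hnc : 0 <= nu * (wm + Rabs c * km)) by (apply Rmult_le_pos; lra).
  assert (HuX : 0 <= u * u - Xm) by nra.
  set (v := sqrt (u * u - Xm)).
  assert (Hvv : v * v = u * u - Xm) by (apply sqrt_sqrt, HuX).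
  assert (Hv0 : 0 <= v) by apply sqrt_pos.
  assert (Hvu : v <= u) by (apply Rle_of_sq_le; lra).
  assert (Huv : u - Xm <= v) by (apply Rle_of_sq_le; [lra|]; nra).
  clearbody v. split; [|split; [lra|apply Rabs_le_between; lra]].
  split; [lra|].
  assert (Hckm : Rabs (c * km) <= Rabs c * km) by (rewrite Rabs_mult, (Rabs_pos_eq km); lra).
  apply Rabs_le_between in Hckm.
  exists (u * v / (2 * nu) - c * km), km. split; [|split].
  - assert (Hlow : wm + Rabs c * km <= u * v / (2 * nu)).
    { apply Rle_div_r; [lra|]. assert (u * 1 <= u * v) by (apply Rmult_le_compat_l; lra). lra. }
    assert (Hup : u * v / (2 * nu) <= u * u / (2 * nu)).
    { apply Rmult_le_compat_r; [apply Rlt_le, Rinv_0_lt_compat; lra|]. apply Rmult_le_compat_l; lra. }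
    unfold inD. rewrite (Rabs_pos_eq km), Rabs_pos_eq by lra. lra.
  - fold Xm. lra.
  - field. lra.
Qed.

Lemma flat_point (nu a b c km wm h dt u : R) :
  0 < nu -> 0 <= b -> 0 <= km -> 0 < wm ->
  let Xm := x02 nu a b + 4 * nu ^ 2 * km ^ 2 in let v := Rabs c + 1 in
  1 + Xm + v * v + 2 * nu * wm <= u ->
  u * (2 * Rabs c + 1) / (2 * nu) <= PI / dt -> u / (2 * nu) <= PI / h ->
  freq_set nu a b c km wm h dt u v.
Proof.
  intros Hnu Hb Hkm Hwm Xm v Hu Hdt Hh.
  pose proof (x02_ge0 nu a b Hnu Hb) as Hx. pose proof (Rabs_pos c) as Hac.
  assert (Hnk : 0 <= nu ^ 2 * km ^ 2) by (apply Rmult_le_pos; apply pow2_ge_0).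
  assert (HXm : 0 <= Xm) by (unfold Xm; lra).
  assert (Hv : 0 <= v * v) by apply Rle_0_sqr.
  assert (Hnw : 0 < nu * wm) by (apply Rmult_lt_0_compat; lra).
  assert (Hu1 : u <= u * u) by nra.
  assert (Hrad : 0 <= u * u - v * v - x02 nu a b) by (unfold Xm in *; lra).
  set (t := sqrt (u * u - v * v - x02 nu a b)).
  assert (Htt : t * t = u * u - v * v - x02 nu a b) by (apply sqrt_sqrt, Hrad).
  assert (Ht0 : 0 <= t) by apply sqrt_pos.
  assert (Htu : t <= u) by (apply Rle_of_sq_le; lra).
  assert (Htk : 2 * nu * km <= t).
  { apply Rle_of_sq_le; [exact Ht0|]. rewrite Htt.
    replace (2 * nu * km * (2 * nu * km)) with (4 * nu ^ 2 * km ^ 2) by ring.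
    unfold Xm in *. lra. }
  clearbody t. set (k := t / (2 * nu)).
  assert (Hk0 : 0 <= k) by (apply Rmult_le_pos; [lra|apply Rlt_le, Rinv_0_lt_compat; lra]).
  assert (Hkt : 2 * nu * k = t) by (unfold k; field; lra).
  split; [lra|].
  assert (Hck : - (Rabs c * u) <= c * t <= Rabs c * u).
  { apply Rabs_le_between. apply Rabs_mult_le; [lra|rewrite Rabs_pos_eq; lra]. }
  set (w := (u * v - c * t) / (2 * nu)).
  assert (Hw : 2 * nu * w = u * v - c * t) by (unfold w; field; lra).
  exists w, k. split; [|split].
  - assert (Hwlow : wm <= w).
    { apply (Rmult_le_reg_l (2 * nu)); [lra|]. rewrite Hw. unfold v. lra. }
    assert (Hwup : w <= u * (2 * Rabs c + 1) / (2 * nu)).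
    { apply (Rle_div_r _ _ (2 * nu)); [lra|]. rewrite (Rmult_comm w), Hw. unfold v. lra. }
    assert (Hklow : km <= k) by (apply (Rmult_le_reg_l (2 * nu)); lra).
    assert (Hkup : k <= u / (2 * nu)).
    { apply (Rle_div_r _ _ (2 * nu)); [lra|]. rewrite (Rmult_comm k), Hkt. exact Htu. }
    unfold inD. rewrite (Rabs_pos_eq k), (Rabs_pos_eq w) by lra. lra.
  - replace (4 * nu ^ 2 * k ^ 2) with ((2 * nu * k) * (2 * nu * k)) by ring.
    rewrite Hkt, Htt. ring.
  - transitivity (2 * nu * w + c * (2 * nu * k)); [rewrite Hw, Hkt; ring|ring].
Qed.

Lemma freq_set_slope_flat (nu a b c km wm h dt u v : R) :
  0 < nu -> 0 <= b -> freq_set nu a b c km wm h dt u v ->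
  Rabs v <= 2 * nu * (PI / dt) / u + Rabs c.
Proof.
  intros Hnu Hb [Hu [w [k [[[_ Hw] _] [H1 H2]]]]].
  pose proof (x02_ge0 nu a b Hnu Hb) as Hx. pose proof (Rabs_pos c) as Hac.
  assert (Hvk : Rabs v <= u).
  { assert (0 <= nu ^ 2 * k ^ 2) by (apply Rmult_le_pos; apply pow2_ge_0).
    apply Rle_of_sq_le; [lra|]. rewrite Rabs_sq. lra. }
  assert (Hk : 2 * nu * Rabs k <= u).
  { apply Rle_of_sq_le; [lra|].
    replace (2 * nu * Rabs k * (2 * nu * Rabs k)) with (4 * nu ^ 2 * (Rabs k * Rabs k)) by ring.
    rewrite Rabs_sq. pose proof (Rle_0_sqr v). unfold Rsqr in *. simpl in *. lra. }
  set (W := PI / dt) in *. clearbody W.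
  replace (2 * nu * W / u + Rabs c) with ((2 * nu * W + Rabs c * u) / u) by (field; lra).
  apply (Rle_div_r _ _ _ Hu).
  replace (Rabs v * u) with (Rabs (u * v)) by (rewrite Rabs_mult, (Rabs_pos_eq u); lra).
  rewrite H2, Rabs_mult, (Rabs_pos_eq (2 * nu)) by lra.
  apply Rle_trans with (2 * nu * (Rabs w + Rabs c * Rabs k)).
  - apply Rmult_le_compat_l; [lra|]. rewrite <- Rabs_mult. apply Rabs_triang.
  - assert (2 * nu * Rabs w <= 2 * nu * W) by (apply Rmult_le_compat_l; lra).
    assert (Rabs c * (2 * nu * Rabs k) <= Rabs c * u) by (apply Rmult_le_compat_l; lra).
    lra.
Qed.

Lemma freq_set_scaled (nu a b c km wm cw kk Cw tau : R) :
  0 < nu -> 0 <= b -> 0 <= km -> 0 < wm -> 0 < cw -> 0 < kk -> 0 < Cw -> tau = 1 \/ tau = 0 ->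
  exists v1 U1 V1 C0 c0, 0 < U1 /\ 0 < V1 /\ 0 < C0 /\ 0 < c0 /\
    at_right 0 (fun s => forall h dt, kk <= s ^ 5 * (PI / h) ->
      (tau = 1 -> cw <= s ^ 10 * (PI / dt)) ->
      (tau = 0 -> cw <= s ^ 5 * (PI / dt) <= Cw) ->
      wm < PI / dt /\
      scaled_set (Aconst nu a b c km wm) v1 U1 V1 tau C0 c0 s (freq_set nu a b c km wm h dt)).
Proof.
  intros Hnu Hb Hkm Hwm Hcw Hkk HCw Htau.
  destruct (Aconst_spec nu a b c km wm Hnu Hb Hkm Hwm) as [HA0 [HAmin [w1 [k1 [v1 [Hw1 [Hk1 [HA1 HA2]]]]]]]].
  set (A := Aconst nu a b c km wm) in *.
  pose proof (x02_ge0 nu a b Hnu Hb) as Hx. pose proof (Rabs_pos c) as Hac.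
  set (Xm := x02 nu a b + 4 * nu ^ 2 * km ^ 2).
  assert (HXm : 0 <= Xm).
  { unfold Xm. assert (0 <= nu ^ 2 * km ^ 2) by (apply Rmult_le_pos; apply pow2_ge_0). lra. }
  assert (Hckm : 0 <= Rabs c * km) by (apply Rmult_le_pos; lra).
  assert (Hnw : 0 <= nu * (wm + Rabs c * km)) by (apply Rmult_le_pos; lra).
  set (vf := Rabs c + 1). assert (Hvf : 0 <= vf * vf) by apply Rle_0_sqr.
  set (U1 := 1 + Xm + vf * vf + 2 * nu * (wm + Rabs c * km)).
  assert (HU1 : 0 < U1) by (unfold U1; lra).
  set (C0 := 1 + Xm + vf + 2 * nu * Cw).
  assert (HnC : 0 < nu * Cw) by (apply Rmult_lt_0_compat; lra).
  assert (HC0 : 0 < C0) by (unfold C0, vf; lra).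
  set (c1 := nu * cw / (2 * Rabs c + 1)).
  assert (Hnc : 0 < nu * cw) by (apply Rmult_lt_0_compat; lra).
  assert (Hnk : 0 < nu * kk) by (apply Rmult_lt_0_compat; lra).
  assert (Hc1 : 0 < c1) by (apply Rdiv_lt_0_compat; lra).
  assert (Hc1' : c1 * (2 * Rabs c + 1) = nu * cw) by (unfold c1; field; lra).
  set (c0 := Rmin 1 (Rmin c1 (nu * kk))).
  assert (Hc0 : 0 < c0) by (repeat apply Rmin_glb_lt; lra).
  assert (Hc01 : c0 <= 1) by apply Rmin_l.
  assert (Hc02 : c0 <= c1) by (eapply Rle_trans; [apply Rmin_r|apply Rmin_l]).
  assert (Hc03 : c0 <= nu * kk) by (eapply Rle_trans; [apply Rmin_r|apply Rmin_r]).
  assert (Hc04 : c0 <= nu * cw) by nra.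
  exists v1, U1, (sqrt (U1 * U1 - Xm)), C0, c0.
  assert (HV1 : 0 < sqrt (U1 * U1 - Xm)).
  { apply sqrt_lt_R0. assert (1 + Xm <= U1) by (unfold U1; lra). nra. }
  split; [exact HU1|]. split; [exact HV1|]. split; [exact HC0|]. split; [exact Hc0|].
  assert (Hcw2 : 0 < cw / 2) by lra.
  eapply filter_imp; [|apply filter_and; [exact (small_mul 1 1 Rlt_0_1)|
    apply filter_and; [exact (small_mul (wm + 1) _ Hcw)|
    apply filter_and; [exact (small_mul (Rabs w1) _ Hcw)|
    apply filter_and; [exact (small_mul (Rabs k1 + km) _ Hkk)|
    apply filter_and; [exact (small_mul (U1 * U1 / (2 * nu)) _ Hcw2)|
      exact (small_mul (Rabs c * km) _ Hcw2)]]]]]].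
  cbv beta. intros s [[Hs Hs1] [[_ S1] [[_ S2] [[_ S3] [[_ S4] [_ S5]]]]]] h dt Hh H1 H0.
  assert (Hs5 : 0 < s ^ 5) by (apply pow_lt; lra).
  assert (Hs5s : s ^ 5 <= s) by (apply pow_S_le_self; lra).
  assert (Hs10 : s ^ 10 = s ^ 5 * s ^ 5) by ring.
  assert (Hdt : cw <= s ^ 5 * (PI / dt)).
  { destruct Htau as [Ht|Ht]; [|apply H0, Ht]. specialize (H1 Ht).
    assert (Hp : 0 < PI / dt).
    { assert (0 < s ^ 10) by (apply pow_lt; lra).
      apply (Rmult_lt_reg_l (s ^ 10)); lra. }
    assert (s ^ 5 * s ^ 5 * (PI / dt) <= s ^ 5 * 1 * (PI / dt)).
    { apply Rmult_le_compat_r; [lra|]. apply Rmult_le_compat_l; lra. }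
    rewrite Hs10 in H1. lra. }
  assert (Hle : forall x y z, 0 <= x -> x * s <= y -> y <= s ^ 5 * z -> x <= z).
  { intros x y z Hx0 Hxy Hyz. apply (Rmult_le_reg_l (s ^ 5)); [lra|].
    eapply Rle_trans; [|exact Hyz]. eapply Rle_trans; [|exact Hxy].
    rewrite (Rmult_comm x). apply Rmult_le_compat_r; lra. }
  assert (Hwm' : wm + 1 <= PI / dt) by (apply (Hle _ cw); lra).
  assert (Hw1' : Rabs w1 <= PI / dt) by (apply (Hle _ cw); auto using Rabs_pos).
  assert (Hk1' : Rabs k1 + km <= PI / h) by (apply (Hle _ kk); auto; pose proof (Rabs_pos k1); lra).
  assert (HUn : 0 <= U1 * U1 / (2 * nu))
    by (apply Rlt_le, Rdiv_lt_0_compat; [apply Rmult_lt_0_compat|]; lra).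
  assert (Hfix : U1 * U1 / (2 * nu) + Rabs c * km <= PI / dt) by (apply (Hle _ cw); lra).
  pose proof (Rabs_pos k1) as Hak1.
  split; [lra|].
  assert (Hdiag : forall u, U1 <= u -> u * u / (2 * nu) + Rabs c * km <= PI / dt ->
            exists v, freq_set nu a b c km wm h dt u v /\ 0 <= v /\ Rabs (v - u) <= C0).
  { intros u HuU Hu2. destruct (diag_point nu a b c km wm h dt u) as [D1 [D2 D3]]; auto; try lra.
    { fold Xm. unfold U1 in HuU. lra. }
    fold Xm in D1, D2, D3. eexists. split; [exact D1|]. split; [lra|].
    eapply Rle_trans; [exact D3|]. unfold C0, vf. lra. }
  constructor.
  - intros u v Huv. split; [|exact (freq_set_slope_le1 nu a b c km wm h dt u v Hnu Hb Huv)].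
    destruct Huv as [Hu [w [k [[Hw Hk] [E1 E2]]]]].
    apply (HAmin w k u v); lra.
  - intros u v. apply freq_set_conj.
  - split; [exact HA0|]. exists w1, k1. split; [split; lra|split; assumption].
  - destruct (diag_point nu a b c km wm h dt U1) as [D1 _]; auto; try lra.
    fold Xm. unfold U1. lra.
  - intros u HuU Hu5. apply Hdiag; [exact HuU|].
    apply (Rmult_le_reg_l (s ^ 5)); [lra|]. eapply Rle_trans; [|exact Hdt].
    assert (E : s ^ 5 * (u * u / (2 * nu)) <= cw / 2).
    { replace (s ^ 5 * (u * u / (2 * nu))) with (u * u * s ^ 5 / (2 * nu)) by (field; lra).
      apply Rle_div_l; lra. }
    assert (s ^ 5 * (Rabs c * km) <= s * (Rabs c * km)) by (apply Rmult_le_compat_r; lra).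
    lra.
  - intros u HuU Hu5. destruct Htau as [Ht|Ht].
    + rewrite Ht, Rmult_1_l. apply Hdiag; [exact HuU|].
      apply (Rmult_le_reg_l (s ^ 10)); [apply pow_lt; lra|].
      eapply Rle_trans; [|exact (H1 Ht)].
      assert (E : s ^ 10 * (u * u / (2 * nu)) <= cw / 2).
      { replace (s ^ 10 * (u * u / (2 * nu))) with (u * s ^ 5 * (u * s ^ 5) / (2 * nu))
          by (field; lra).
        apply Rle_div_l; [lra|].
        assert (0 <= u * s ^ 5) by (apply Rmult_le_pos; lra).
        assert (u * s ^ 5 * (u * s ^ 5) <= c0 * 1) by (apply Rmult_le_compat; lra). lra. }
      assert (s ^ 10 * (Rabs c * km) <= s * (Rabs c * km)) by (apply Rmult_le_compat_r; [lra|apply pow_S_le_self; lra]).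
      lra.
    + exists vf. split; [|split; [unfold vf; lra|]].
      * apply flat_point; auto; fold Xm vf.
        -- unfold U1 in HuU.
           assert (0 <= nu * (Rabs c * km)) by (apply Rmult_le_pos; lra). lra.
        -- apply (Rmult_le_reg_l (s ^ 5)); [lra|]. eapply Rle_trans; [|exact Hdt].
           replace (s ^ 5 * (u * (2 * Rabs c + 1) / (2 * nu)))
             with (u * s ^ 5 * (2 * Rabs c + 1) / (2 * nu)) by (field; lra).
           apply Rle_div_l; [lra|].
           assert (u * s ^ 5 * (2 * Rabs c + 1) <= c1 * (2 * Rabs c + 1))
             by (apply Rmult_le_compat_r; lra). lra.
        -- apply (Rmult_le_reg_l (s ^ 5)); [lra|]. eapply Rle_trans; [|exact Hh].
           replace (s ^ 5 * (u / (2 * nu))) with (u * s ^ 5 / (2 * nu)) by (field; lra).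
           apply Rle_div_l; lra.
      * rewrite Ht, Rmult_0_l, Rminus_0_r, Rabs_pos_eq by (unfold vf; lra). unfold C0. lra.
  - intros u v Huv. assert (Hu : 0 < u) by apply Huv.
    assert (Hsu : 0 < / (s ^ 5 * u)) by (apply Rinv_0_lt_compat, Rmult_lt_0_compat; lra).
    destruct Htau as [Ht|Ht]; rewrite Ht.
    + assert (Hvu := freq_set_slope_le1 nu a b c km wm h dt u v Hnu Hb Huv).
      assert (0 <= C0 * (/ (s ^ 5 * u) + 1)) by (apply Rmult_le_pos; lra). lra.
    + assert (Hv := freq_set_slope_flat nu a b c km wm h dt u v Hnu Hb Huv).
      assert (Hb1 : 2 * nu * (PI / dt) / u <= 2 * nu * Cw * / (s ^ 5 * u)).
      { specialize (H0 Ht). clear -H0 Hs Hs5 Hu Hsu Hnu. set (W := PI / dt) in *. clearbody W.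
        replace (2 * nu * W / u) with (2 * nu * (s ^ 5 * W) * / (s ^ 5 * u)) by (field; lra).
        apply Rmult_le_compat_r; [lra|]. apply Rmult_le_compat_l; lra. }
      assert (2 * nu * Cw * / (s ^ 5 * u) <= C0 * / (s ^ 5 * u)).
      { apply Rmult_le_compat_r; [lra|]. unfold C0, vf. lra. }
      assert (Rabs c <= C0) by (unfold C0, vf; lra).
      lra.
Qed.

(** * The Ventcel problem for small mesh sizes *)

Lemma unique_best_approx_of_minimizer (nu a b c km wm h dt L d p q : R) (K := freq_set nu a b c km wm h dt) :
  0 < nu -> 0 <= b -> 0 < wm -> wm < PI / dt -> (exists u v, K u v) -> 0 <= d ->
  admissible K (L / nu) d (RtoC p) (RtoC q) ->
  (forall d' x y, 0 <= d' -> admissible K (L / nu) d' x y -> d <= d') ->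
  (forall x y, admissible K (L / nu) d x y -> x = RtoC p /\ y = RtoC q) ->
  unique_best_approx nu a b c km wm h dt L
    (RtoC (p + q * x02 nu a b)) (RtoC (4 * nu * q)) d.
Proof.
  intros Hnu Hb Hwm HW [u0 [v0 [Hu0 [w0 [k0 [HD0 _]]]]]] Hd Hadm Hmin Huniq.
  assert (Hiff := fun d' x y => supRho_le_iff nu a b c km wm h dt L d' x y Hnu Hb Hwm HW).
  assert (Hpos : forall x y, Rbar_le (Finite 0) (supRho nu a b c km wm h dt L x y)).
  { intros x y. unfold supRho. set (E := fun r => _).
    destruct (Lub_Rbar_correct E) as [Hub _].
    apply Rbar_le_trans with (Finite (Cmod (rho nu a b c w0 k0 x y L))); [apply Cmod_ge_0|].
    apply Hub. exists w0, k0. auto. }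
  assert (Hge : forall x y, Rbar_le (Finite d) (supRho nu a b c km wm h dt L x y)).
  { intros x y. specialize (Hpos x y).
    destruct (supRho nu a b c km wm h dt L x y) as [d'| |] eqn:E; simpl in *; [|exact I|tauto].
    apply (Hmin d' (shift_p nu a b x y) (shift_q nu y) Hpos).
    apply Hiff; [exact Hpos|]. rewrite E. apply Rle_refl. }
  assert (Ep : shift_p nu a b (RtoC (p + q * x02 nu a b)) (RtoC (4 * nu * q)) = RtoC p).
  { unfold shift_p, RtoC; simpl. f_equal; field; lra. }
  assert (Eq : shift_q nu (RtoC (4 * nu * q)) = RtoC q).
  { unfold shift_q, RtoC; simpl. f_equal; field; lra. }
  assert (Hsup : supRho nu a b c km wm h dt L (RtoC (p + q * x02 nu a b)) (RtoC (4 * nu * q))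
                 = Finite d).
  { apply Rbar_le_antisym; [|apply Hge]. apply Hiff; [exact Hd|]. rewrite Ep, Eq. exact Hadm. }
  split; [exact Hsup|]. split; [intros x y; rewrite Hsup; apply Hge|].
  intros x y Hxy. rewrite Hsup in Hxy.
  assert (Hxa : admissible K (L / nu) d (shift_p nu a b x y) (shift_q nu y)).
  { apply Hiff; [exact Hd|]. rewrite Hxy. apply Rle_refl. }
  apply Huniq in Hxa. destruct Hxa as [Hx Hy].
  destruct x as [x1 x2], y as [y1 y2].
  unfold shift_p, shift_q, RtoC in *; cbn [Re Im fst snd] in *.
  injection Hx as Hx1 Hx2. injection Hy as Hy1 Hy2.
  assert (Ey1 : y1 = 4 * nu * q) by (rewrite <- Hy1; field; lra).
  assert (Ey2 : y2 = 0).
  { replace y2 with (4 * nu * (y2 / (4 * nu))) by (field; lra). rewrite Hy2. ring. }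
  rewrite Ey1 in Hx1. rewrite Ey2 in Hx2.
  split; f_equal; auto; [|lra].
  rewrite <- Hx1. field. lra.
Qed.

Lemma unique_best_approx_inj (nu a b c km wm h dt L : R) (p q p' q' : C) (d d' : R) :
  unique_best_approx nu a b c km wm h dt L p q d ->
  unique_best_approx nu a b c km wm h dt L p' q' d' -> p = p' /\ q = q' /\ d = d'.
Proof.
  intros [H1 [H2 H3]] [G1 [G2 G3]].
  assert (E : supRho nu a b c km wm h dt L p q = supRho nu a b c km wm h dt L p' q').
  { apply Rbar_le_antisym; [apply H2|apply G2]. }
  destruct (G3 p q E) as [-> ->]. rewrite H1 in G1. injection G1. auto.
Qed.

Lemma ventcel_scaled (nu a b c km wm cw kk Cw tau P eps : R) (A := Aconst nu a b c km wm) :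
  0 < nu -> 0 <= b -> 0 <= km -> 0 < wm -> 0 < cw -> 0 < kk -> 0 < Cw -> tau = 1 \/ tau = 0 ->
  0 < P -> 512 * P ^ 5 = nu * A ^ 4 * (1 + tau * tau) -> 0 < eps ->
  at_right 0 (fun s => forall h dt, kk <= s ^ 5 * (PI / h) ->
      (tau = 1 -> cw <= s ^ 10 * (PI / dt)) ->
      (tau = 0 -> cw <= s ^ 5 * (PI / dt) <= Cw) ->
      exists d p q : R,
        unique_best_approx nu a b c km wm h dt (s ^ 5) (RtoC p) (RtoC q) d /\
        Rabs (p / (P / s) - 1) <= eps /\
        Rabs (q / (4 * nu * (A ^ 2 / (32 * P ^ 3)) * s ^ 3) - 1) <= eps /\
        1 - eps <= d <= 1).
Proof.
  intros Hnu Hb Hkm Hwm Hcw Hkk HCw Htau HP HP5 Heps.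
  destruct (Aconst_spec nu a b c km wm Hnu Hb Hkm Hwm) as [HA4 _]. fold A in HA4.
  assert (HA : 0 < A) by lra.
  assert (Htau' : 0 <= tau <= 1) by (destruct Htau; lra).
  assert (HP3 : 0 < P ^ 3) by (apply pow_lt; lra).
  set (Q := A ^ 2 / (32 * P ^ 3)). set (D := A / (2 * P)).
  assert (HQ : 0 < Q) by (apply Rdiv_lt_0_compat; [apply pow_lt|]; lra).
  assert (HD : 0 < D) by (apply Rdiv_lt_0_compat; lra).
  assert (HDP : 2 * (D * P) = A) by (unfold D; field; lra).
  assert (HDD : D * D = 8 * P * Q) by (unfold D, Q; field; lra).
  assert (HDQ : D * D * (nu * Q) * (1 + tau * tau) = 4).
  { unfold D, Q. transitivity (nu * A ^ 4 * (1 + tau * tau) / (128 * P ^ 5)); [field; lra|].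
    rewrite <- HP5. field. lra. }
  set (e := Rmin (/ 36) (eps / 36)).
  assert (He : 0 < e) by (apply Rmin_glb_lt; lra).
  assert (He1 : e <= / 36) by apply Rmin_l. assert (He2 : e <= eps / 36) by apply Rmin_r.
  assert (Hx := x02_ge0 nu a b Hnu Hb).
  destruct (freq_set_scaled nu a b c km wm cw kk Cw tau) as [v1 [U1 [V1 [C0 [c0
    [HU1 [HV1 [HC0 [Hc0 Hss]]]]]]]]]; auto.
  fold A in Hss.
  destruct (near_optimal_control nu A v1 U1 V1 tau C0 c0 (D / 2)) as [Cb [HCb Hctl]];
    try lra.
  assert (Hpe : 0 < P * (eps / 2)) by nra.
  eapply filter_imp; [|apply filter_and; [exact Hss|
    apply filter_and; [exact Hctl|
    apply filter_and; [exact (small_mul 1 1 Rlt_0_1)|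
    apply filter_and; [exact (small_mul (2 * Q * x02 nu a b) _ Hpe)|
    apply filter_and; [apply (real_symbol_admissible nu A v1 U1 V1 tau C0 c0 P Q D e); lra|
    apply filter_and; [apply (near_optimal_asymptotics nu A v1 U1 V1 tau C0 c0 P Q D e); lra|
      apply (near_optimal_value nu A v1 U1 V1 tau C0 c0 P Q eps); lra]]]]]]].
  cbv beta.
  intros s [H1 [H2 [[Hs Hs1] [[_ S1] [H3 [H4 H5]]]]]] h dt Hc1 Hc2 Hc3.
  destruct (H1 h dt Hc1 Hc2 Hc3) as [HW HK].
  set (K := freq_set nu a b c km wm h dt) in *.
  specialize (H2 K HK). specialize (H3 K HK). specialize (H4 K HK). specialize (H5 K HK).
  assert (HDs : 0 < D * s) by (apply Rmult_lt_0_compat; lra).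
  assert (HeD : e * (D * s) <= / 36 * (D * s)) by (apply Rmult_le_compat_r; lra).
  set (d0 := exp (- ((1 - e) * D * s))) in *.
  assert (Hd0 : 0 <= d0 <= exp (- (D / 2 * s))).
  { split; [apply Rlt_le, exp_pos|]. apply Rlt_le, exp_increasing. lra. }
  assert (Hd01 : d0 <= 1).
  { rewrite <- exp_0. apply Rlt_le, exp_increasing. lra. }
  assert (Hs3 : 0 < s ^ 3) by (apply pow_lt; lra).
  destruct (best_approx_exists_unique K (s ^ 5 / nu) d0 (Cb / s + Cb * s ^ 3)
              (RtoC (P / s)) (RtoC (Q * s ^ 3)) U1 V1 U1 (- V1))
    as [d [p [q [Hd [Hadm [Hmin Huniq]]]]]].
  - apply freq_set_compact; assumption.
  - apply (ss_fix _ _ _ _ _ _ _ _ _ HK).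
  - apply (ss_conj _ _ _ _ _ _ _ _ _ HK), (ss_fix _ _ _ _ _ _ _ _ _ HK).
  - intros E. injection E. lra.
  - intros u v Huv. apply Huv.
  - apply (ss_conj _ _ _ _ _ _ _ _ _ HK).
  - lra.
  - exact H3.
  - intros p q Hpq. destruct (H2 p q) as [[B1 [B2 [B3 B4]]] Hpair].
    { apply admissible_mono with d0; assumption. }
    split; [|exact Hpair].
    assert (0 < Cb / s) by (apply Rdiv_lt_0_compat; lra).
    assert (0 < Cb * s ^ 3) by (apply Rmult_lt_0_compat; lra).
    repeat split; lra.
  - assert (Hadm0 : admissible K (s ^ 5 / nu) d0 (RtoC p) (RtoC q))
      by (apply admissible_mono with d; [lra|exact Hadm]).
    destruct (H4 p q Hadm0) as [Hp Hq].
    exists d, (p + q * x02 nu a b), (4 * nu * q). split; [|split; [|split]].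
    + apply unique_best_approx_of_minimizer; auto; [|lra].
      exists U1, V1. apply (ss_fix _ _ _ _ _ _ _ _ _ HK).
    + assert (HQs : 0 < Q * s ^ 3) by (apply Rmult_lt_0_compat; lra).
      set (y := q / (Q * s ^ 3)) in *.
      assert (Eq : q = y * (Q * s ^ 3)) by (unfold y; field; lra).
      replace ((p + q * x02 nu a b) / (P / s) - 1)
        with (p * s / P - 1 + y * Q * x02 nu a b * s ^ 4 / P) by (rewrite Eq; field; lra).
      assert (Hy : Rabs y <= 2).
      { apply Rabs_le_between in Hq. apply Rabs_le_between. lra. }
      assert (Hs4 : Rabs (s ^ 4) <= s).
      { rewrite Rabs_pos_eq by (apply pow_le; lra). apply pow_S_le_self; lra. }
      assert (Hz : Rabs (y * Q * x02 nu a b * s ^ 4 / P) <= eps / 2).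
      { apply Rle_trans with (2 * Q * x02 nu a b * s * / P).
        - apply Rabs_mult_le; [apply Rabs_mult_le; [apply Rabs_mult_le; [apply Rabs_mult_le|]|]|];
            auto; rewrite Rabs_pos_eq; try lra.
          apply Rlt_le, Rinv_0_lt_compat; lra.
        - apply (Rle_div_l _ _ _ HP). lra. }
      eapply Rle_trans; [apply Rabs_triang|]. lra.
    + replace (4 * nu * q / (4 * nu * Q * s ^ 3)) with (q / (Q * s ^ 3)) by (field; lra).
      lra.
    + split; [|lra]. apply (H5 d p q); [lra|lra|lra|exact Hadm].
Qed.

Lemma C_close_at_one (e : R) : 0 < e ->
  locally (RtoC 1) (fun z : C => Rabs (Re z - 1) < e).
Proof. intros He. exists (mkposreal e He). intros z [Hz _]. exact Hz. Qed.

Lemma asymp0_bounds (f : R -> R) (n : nat) :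
  (forall h, 0 < h -> 0 <= f h) -> asymp0 f n ->
  exists c1 c2, 0 < c1 /\ 0 < c2 /\ at_right 0 (fun h => 0 < h /\ c1 * h ^ n <= f h <= c2 * h ^ n).
Proof.
  intros Hf [k [Hk Heq]].
  assert (Hev : at_right 0 (fun h => 0 < h /\ Rabs (f h / (k * h ^ n) - 1) < / 2)).
  { assert (Hh : 0 < / 2) by lra.
    assert (H := Heq _ (C_close_at_one (/ 2) Hh)). unfold filtermap in H.
    eapply filter_imp; [|apply filter_and; [exact H|exact (small_mul 1 1 Rlt_0_1)]].
    cbv beta. intros h [H1 [Hh0 _]]. split; [exact Hh0|].
    assert (0 < h ^ n) by (apply pow_lt; lra).
    rewrite <- RtoC_div in H1; [exact H1|]. apply Rmult_integral_contrapositive. split; lra. }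
  assert (Hkpos : 0 < k).
  { destruct (Rtotal_order k 0) as [Hneg|[H0|H0]]; [exfalso|tauto|exact H0].
    destruct Hev as [del Hdel].
    assert (Hd := cond_pos del).
    destruct (Hdel (del / 2)) as [Hh Hc].
    { unfold ball; simpl; unfold AbsRing_ball, abs, minus, plus, opp; simpl.
      rewrite Ropp_0, Rplus_0_r, Rabs_pos_eq; lra. }
    { lra. }
    set (h := del / 2) in *. assert (Hp : 0 < h ^ n) by (apply pow_lt; lra).
    specialize (Hf h Hh). apply Rabs_lt_between in Hc.
    assert (Hr : f h / (k * h ^ n) <= 0).
    { assert (Hkn : 0 < - k * h ^ n) by (apply Rmult_lt_0_compat; lra).
      replace (f h / (k * h ^ n)) with (- (f h / (- k * h ^ n))) by (field; lra).
      assert (0 <= f h / (- k * h ^ n))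
        by (apply Rmult_le_pos; [lra|apply Rlt_le, Rinv_0_lt_compat, Hkn]).
      lra. }
    lra. }
  exists (k / 2), (3 / 2 * k). split; [lra|]. split; [lra|].
  eapply filter_imp; [|exact Hev]. cbv beta. intros h [Hh Hc]. split; [exact Hh|].
  assert (Hp : 0 < h ^ n) by (apply pow_lt; lra).
  assert (Hkn : 0 < k * h ^ n) by (apply Rmult_lt_0_compat; lra).
  apply Rabs_lt_between in Hc.
  set (x := f h / (k * h ^ n)) in *.
  assert (Ex : f h = x * (k * h ^ n)) by (unfold x; field; lra).
  rewrite Ex. split.
  - replace (k / 2 * h ^ n) with (/ 2 * (k * h ^ n)) by field. apply Rmult_le_compat_r; lra.
  - replace (3 / 2 * k * h ^ n) with (3 / 2 * (k * h ^ n)) by field. apply Rmult_le_compat_r; lra.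
Qed.

Lemma equiv0_real (F G : R -> C) (f g : R -> R) :
  at_right 0 (fun h => F h = RtoC (f h) /\ G h = RtoC (g h) /\ g h <> 0) ->
  (forall e, 0 < e -> at_right 0 (fun h => Rabs (f h / g h - 1) <= e)) ->
  equiv0 F G.
Proof.
  intros HFG Hlim Q [del Hdel].
  assert (Hd := cond_pos del).
  assert (Hd2 : 0 < del / 2) by lra.
  unfold filtermap.
  eapply filter_imp; [|apply filter_and; [exact HFG|exact (Hlim _ Hd2)]].
  cbv beta. intros h [[EF [EG Hg]] Hc]. apply Hdel.
  rewrite EF, EG, <- RtoC_div by exact Hg.
  split; unfold ball; simpl; unfold AbsRing_ball, abs, minus, plus, opp; simpl.
  - change (Rabs (f h / g h - 1) < del). lra.
  - rewrite Ropp_0, Rplus_0_r, Rabs_R0. exact Hd.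
Qed.

Lemma Rpower_fifth (x : R) : 0 < x -> 0 < Rpower x (/ 5) /\ Rpower x (/ 5) ^ 5 = x.
Proof.
  intros Hx. split; [apply exp_pos|].
  rewrite <- Rpower_pow by apply exp_pos. rewrite Rpower_mult.
  replace (/ 5 * INR 5) with 1 by (simpl; field). apply Rpower_1, Hx.
Qed.

Lemma pow5_inj (x y : R) : 0 < x -> 0 < y -> x ^ 5 = y ^ 5 -> x = y.
Proof.
  intros Hx Hy E.
  assert (F : (x - y) * (x ^ 4 + x ^ 3 * y + x ^ 2 * y ^ 2 + x * y ^ 3 + y ^ 4) = 0).
  { transitivity (x ^ 5 - y ^ 5); [ring|lra]. }
  apply Rmult_integral in F. destruct F as [F|F]; [lra|exfalso].
  assert (0 < x ^ 4) by (apply pow_lt; lra). assert (0 < y ^ 4) by (apply pow_lt; lra).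
  assert (0 < x ^ 3 * y) by (apply Rmult_lt_0_compat; [apply pow_lt|]; lra).
  assert (0 < x ^ 2 * y ^ 2) by (apply Rmult_lt_0_compat; apply pow_lt; lra).
  assert (0 < x * y ^ 3) by (apply Rmult_lt_0_compat; [|apply pow_lt]; lra).
  lra.
Qed.

Lemma at_right_fifth_root (L : R -> R) (c2 : R) (Pr : R -> Prop) :
  at_right 0 (fun h => 0 < h /\ 0 < L h <= c2 * h) -> at_right 0 Pr ->
  at_right 0 (fun h => Pr (Rpower (L h) (/ 5))).
Proof.
  intros HL [del Hdel].
  assert (Hd := cond_pos del). assert (Hd5 : 0 < del ^ 5 / 2) by (apply Rdiv_lt_0_compat; [apply pow_lt|]; lra).
  eapply filter_imp; [|apply filter_and; [exact HL|exact (small_mul c2 _ Hd5)]].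
  cbv beta. intros h [[Hh HLh] [_ Hc]].
  destruct (Rpower_fifth (L h)) as [Hs Hs5]; [lra|].
  apply Hdel; [|exact Hs].
  set (s := Rpower (L h) (/ 5)) in *.
  assert (Hlt : s < del).
  { apply Rnot_le_lt. intros Hle.
    assert (del ^ 5 <= s ^ 5) by (apply pow_incr; lra). lra. }
  unfold ball; simpl; unfold AbsRing_ball, abs, minus, plus, opp; simpl.
  rewrite Ropp_0, Rplus_0_r, Rabs_pos_eq; lra.
Qed.

Lemma ventcel_asymptotics_of_scaling (nu a b c km wm cw kk Cw tau P cp cq : R) (L dt : R -> R)
  (A := Aconst nu a b c km wm) :
  0 < nu -> 0 <= b -> 0 <= km -> 0 < wm -> 0 < cw -> 0 < kk -> 0 < Cw -> tau = 1 \/ tau = 0 ->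
  0 < P -> 512 * P ^ 5 = nu * A ^ 4 * (1 + tau * tau) ->
  (exists c2, at_right 0 (fun h => 0 < h /\ 0 < L h <= c2 * h)) ->
  at_right 0 (fun h => kk <= L h * (PI / h) /\
      (tau = 1 -> cw <= L h * L h * (PI / dt h)) /\
      (tau = 0 -> cw <= L h * (PI / dt h) <= Cw)) ->
  (forall l, 0 < l -> cp * pinf nu A l = P / Rpower l (/ 5)) ->
  (forall l, 0 < l -> cq * qinf nu A l = 4 * nu * (A ^ 2 / (32 * P ^ 3)) * Rpower l (/ 5) ^ 3) ->
  ventcel_asymptotics nu a b c km wm L dt cp cq.
Proof.
  intros Hnu Hb Hkm Hwm Hcw Hkk HCw Htau HP HP5 [c2 HL] Hcond Hpinf Hqinf.
  destruct (Aconst_spec nu a b c km wm Hnu Hb Hkm Hwm) as [HA4 _]. fold A in HA4.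
  assert (HA : 0 < A) by lra.
  set (sol := fun (h : R) (t : C * C * R) =>
    unique_best_approx nu a b c km wm h (dt h) (L h) (fst (fst t)) (snd (fst t)) (snd t)).
  set (t0 := inhabits ((RtoC 0, RtoC 0), 0) : inhabited (C * C * R)).
  set (best := fun h => epsilon t0 (sol h)).
  set (s := fun h => Rpower (L h) (/ 5)).
  assert (Hbest : forall eps, 0 < eps -> at_right 0 (fun h => 0 < h /\ 0 < s h /\ 0 < L h /\
     sol h (best h) /\
     exists d p q : R, best h = ((RtoC p, RtoC q), d) /\
        Rabs (p / (P / s h) - 1) <= eps /\
        Rabs (q / (4 * nu * (A ^ 2 / (32 * P ^ 3)) * s h ^ 3) - 1) <= eps /\
        1 - eps <= d <= 1)).
  { intros eps He.
    assert (Hsc := ventcel_scaled nu a b c km wm cw kk Cw tau P eps Hnu Hb Hkm Hwm Hcw Hkk HCw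
                     Htau HP HP5 He).
    apply (at_right_fifth_root L c2 _ HL) in Hsc.
    eapply filter_imp; [|apply filter_and; [exact Hsc|apply filter_and; [exact HL|exact Hcond]]].
    cbv beta. intros h [H1 [[Hh HLh] [C1 [C2 C3]]]].
    destruct (Rpower_fifth (L h)) as [Hs Hs5]; [lra|].
    fold A in H1. fold (s h) in H1, Hs, Hs5.
    replace (s h ^ 10) with (L h * L h) in H1 by (rewrite <- Hs5; ring).
    rewrite Hs5 in H1.
    destruct (H1 h (dt h) C1 C2 C3) as [d [p [q [Hu Hrest]]]].
    assert (Hsol : sol h (best h)).
    { apply epsilon_spec. exists ((RtoC p, RtoC q), d). exact Hu. }
    split; [exact Hh|]. split; [exact Hs|]. split; [lra|]. split; [exact Hsol|].
    exists d, p, q. split; [|exact Hrest].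
    destruct (best h) as [[p' q'] d'].
    destruct (unique_best_approx_inj _ _ _ _ _ _ _ _ _ _ _ _ _ _ _ Hsol Hu) as [E1 [E2 E3]].
    simpl in E1, E2, E3. congruence. }
  assert (HQ : 0 < 4 * nu * (A ^ 2 / (32 * P ^ 3))).
  { apply Rmult_lt_0_compat; [lra|]. apply Rdiv_lt_0_compat; [apply pow_lt; lra|].
    assert (0 < P ^ 3) by (apply pow_lt; lra). lra. }
  set (Q4 := 4 * nu * (A ^ 2 / (32 * P ^ 3))) in *.
  unfold ventcel_asymptotics. fold A. cbv zeta.
  exists (fun h => fst (fst (best h))), (fun h => snd (fst (best h))), (fun h => snd (best h)).
  split; [|split; [|split]].
  - destruct (Hbest 1 Rlt_0_1) as [del Hdel]. exists del. split; [apply cond_pos|].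
    intros h [Hh Hhd]. apply Hdel; [|exact Hh].
    unfold ball; simpl; unfold AbsRing_ball, abs, minus, plus, opp; simpl.
    rewrite Ropp_0, Rplus_0_r, Rabs_pos_eq; lra.
  - apply equiv0_real with (f := fun h => Re (fst (fst (best h)))) (g := fun h => P / s h).
    + eapply filter_imp; [|exact (Hbest 1 Rlt_0_1)]. cbv beta.
      intros h [Hh [Hs [HLh [_ [d [p [q [E _]]]]]]]]. rewrite E, Hpinf by exact HLh. simpl.
      split; [reflexivity|]. split; [reflexivity|].
      apply Rgt_not_eq, Rdiv_lt_0_compat; assumption.
    + intros e He. eapply filter_imp; [|exact (Hbest e He)]. cbv beta.
      intros h [_ [_ [_ [_ [d [p [q [E [H1 _]]]]]]]]]. rewrite E. exact H1.
  - apply equiv0_real with (f := fun h => Re (snd (fst (best h)))) (g := fun h => Q4 * s h ^ 3).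
    + eapply filter_imp; [|exact (Hbest 1 Rlt_0_1)]. cbv beta.
      intros h [Hh [Hs [HLh [_ [d [p [q [E _]]]]]]]]. rewrite E, Hqinf by exact HLh. simpl fst. simpl snd.
      split; [reflexivity|]. split; [reflexivity|].
      apply Rgt_not_eq, Rmult_lt_0_compat; [exact HQ|apply pow_lt, Hs].
    + intros e He. eapply filter_imp; [|exact (Hbest e He)]. cbv beta.
      intros h [_ [_ [_ [_ [d [p [q [E [_ [H1 _]]]]]]]]]]. rewrite E. exact H1.
  - assert (Hsmall : forall e, 0 < e -> at_right 0 (fun h => A * s h <= e)).
    { intros e He.
      assert (H := at_right_fifth_root L c2 _ HL (small_mul A e He)).
      eapply filter_imp; [|exact H]. cbv beta. intros h [_ Hh]. exact Hh. }
    assert (Hp : forall h p, 0 < s h -> Rabs (p / (P / s h) - 1) <= / 2 ->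
               0 < p /\ 0 < A / (2 * p) <= A * s h / P).
    { intros h p Hs Hc. set (x := p / (P / s h)) in *. apply Rabs_le_between in Hc.
      assert (HPs : 0 < P / s h) by (apply Rdiv_lt_0_compat; lra).
      assert (Ep : p = x * (P / s h)) by (unfold x; field; lra).
      assert (Hp0 : 0 < p) by (rewrite Ep; apply Rmult_lt_0_compat; lra).
      split; [exact Hp0|]. split; [apply Rdiv_lt_0_compat; lra|].
      replace (A * s h / P) with (A * / (P / s h)) by (field; lra).
      apply Rmult_le_compat_l; [lra|]. apply Rinv_le_contravar; [exact HPs|].
      assert (/ 2 * (P / s h) <= x * (P / s h)) by (apply Rmult_le_compat_r; lra). lra. }
    assert (Hhalf : 0 < / 2) by lra.
    assert (Hev : forall e, 0 < e <= / 2 -> at_right 0 (fun h => exists d p q : R,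
              best h = ((RtoC p, RtoC q), d) /\ 0 < p /\ 0 < A / (2 * p) <= e /\ 1 - e <= d <= 1)).
    { intros e He. assert (HPe : 0 < P * e) by (apply Rmult_lt_0_compat; lra).
      eapply filter_imp; [|apply filter_and; [exact (Hbest e (proj1 He))|exact (Hsmall _ HPe)]].
      cbv beta. intros h [[_ [Hs [_ [_ [d [p [q [E [H1 [_ H3]]]]]]]]]] H4].
      exists d, p, q. split; [exact E|]. destruct (Hp h p Hs) as [Hp0 Hp1]; [lra|].
      split; [exact Hp0|]. split; [|exact H3]. split; [lra|].
      eapply Rle_trans; [apply Hp1|]. apply (Rle_div_l _ _ _ HP). lra. }
    apply equiv0_real with (f := fun h => snd (best h))
      (g := fun h => 1 - A / (2 * Re (fst (fst (best h))))).
    + eapply filter_imp; [|exact (Hev (/ 2) (conj Hhalf (Rle_refl _)))]. cbv beta.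
      intros h [d [p [q [E [Hp0 [Hp1 _]]]]]]. rewrite E. simpl fst. simpl snd.
      split; [reflexivity|]. split; [|simpl; lra].
      rewrite <- RtoC_mult, <- RtoC_div by lra. rewrite <- RtoC_minus. reflexivity.
    + intros e He.
      set (e' := Rmin (/ 2) (e / 2)).
      assert (He' : 0 < e' <= / 2) by (split; [apply Rmin_glb_lt; lra|apply Rmin_l]).
      assert (He2 : e' <= e / 2) by apply Rmin_r.
      eapply filter_imp; [|exact (Hev e' He')]. cbv beta.
      intros h [d [p [q [E [Hp0 [Hp1 Hd]]]]]]. rewrite E. simpl.
      set (x := A / (2 * p)) in *.
      replace (d / (1 - x) - 1) with ((d - 1 + x) / (1 - x)) by (field; lra).
      apply Rabs_le_between.
      assert (Hx : 0 < 1 - x) by lra.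
      split.
      * apply (Rle_div_r _ _ _ Hx). nra.
      * apply (Rle_div_l _ _ _ Hx). nra.
Qed.

Lemma pinf_scaling (nu A t cp : R) :
  0 < nu -> 0 < A -> 0 < t -> 0 < cp -> 2 * cp ^ 5 = t ->
  let P := Rpower (nu * A ^ 4 * t / 512) (/ 5) in
  0 < P /\ 512 * P ^ 5 = nu * A ^ 4 * t /\
  (forall l, 0 < l -> cp * pinf nu A l = P / Rpower l (/ 5)).
Proof.
  intros Hnu HA Ht Hcp Et P.
  assert (HA4 : 0 < nu * A ^ 4) by (apply Rmult_lt_0_compat; [|apply pow_lt]; lra).
  assert (Hpos : 0 < nu * A ^ 4 * t / 512) by (apply Rdiv_lt_0_compat; [apply Rmult_lt_0_compat|]; lra).
  destruct (Rpower_fifth _ Hpos) as [HP HP5]. fold P in HP, HP5.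
  split; [exact HP|]. split; [rewrite HP5; field|].
  intros l Hl. unfold pinf.
  destruct (Rpower_fifth l Hl) as [Hs Hs5]. set (s := Rpower l (/ 5)) in *.
  assert (Hx : 0 < nu * A ^ 4 / (8 * l)) by (apply Rdiv_lt_0_compat; lra).
  destruct (Rpower_fifth _ Hx) as [Hy Hy5]. set (y := Rpower (nu * A ^ 4 / (8 * l)) (/ 5)) in *.
  apply pow5_inj; [apply Rmult_lt_0_compat; lra|apply Rdiv_lt_0_compat; lra|].
  transitivity (cp ^ 5 * y ^ 5 / 32); [field|]. rewrite Hy5.
  transitivity (P ^ 5 / s ^ 5); [|field; lra].
  rewrite HP5, Hs5, <- Et. field. lra.
Qed.

Lemma qinf_scaling (nu A t cq P : R) :
  0 < nu -> 0 < A -> 0 < t -> 0 < cq -> 0 < P -> cq ^ 5 * t ^ 3 = 8 ->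
  512 * P ^ 5 = nu * A ^ 4 * t ->
  forall l, 0 < l -> cq * qinf nu A l = 4 * nu * (A ^ 2 / (32 * P ^ 3)) * Rpower l (/ 5) ^ 3.
Proof.
  intros Hnu HA Ht Hcq HP Et HP5 l Hl. unfold qinf.
  destruct (Rpower_fifth l Hl) as [Hs Hs5]. set (s := Rpower l (/ 5)) in *.
  assert (HA2 : 0 < A ^ 2) by (apply pow_lt; lra).
  assert (HP3 : 0 < P ^ 3) by (apply pow_lt; lra).
  assert (Hx : 0 < nu ^ 2 * l ^ 3 / (2 * A ^ 2)).
  { apply Rdiv_lt_0_compat; [apply Rmult_lt_0_compat; apply pow_lt|]; lra. }
  destruct (Rpower_fifth _ Hx) as [Hy Hy5]. set (y := Rpower (nu ^ 2 * l ^ 3 / (2 * A ^ 2)) (/ 5)) in *.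
  apply pow5_inj.
  - apply Rmult_lt_0_compat; lra.
  - apply Rmult_lt_0_compat; [|apply pow_lt, Hs].
    apply Rmult_lt_0_compat; [lra|]. apply Rdiv_lt_0_compat; lra.
  - transitivity (1024 * cq ^ 5 * y ^ 5); [ring|]. rewrite Hy5.
    transitivity (1024 * nu ^ 5 * A ^ 10 * 4 * (s ^ 5) ^ 3 / (512 * P ^ 5) ^ 3); [|field; lra].
    rewrite HP5, Hs5. replace (cq ^ 5) with (8 / t ^ 3) by (rewrite <- Et; field; lra).
    field. lra.
Qed.

Lemma Rpower_pow5 (x y : R) : Rpower x y ^ 5 = Rpower x (5 * y).
Proof.
  rewrite <- Rpower_pow by apply exp_pos. rewrite Rpower_mult. f_equal. simpl. ring.
Qed.

Theorem theorem6 (nu a b c km wm : R) (L dt : R -> R) :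
  0 < nu -> 0 <= b -> 0 <= km -> 0 < wm ->
  (* standing assumption (automatic here since wm > 0) *)
  (x02 nu a b + 4 * nu ^ 2 * km ^ 2 <> 0 \/ wm <> 0) ->
  (forall h, 0 < h -> 0 <= L h /\ 0 < dt h) ->
  asymp0 L 1 ->
  (asymp0 dt 2 -> ventcel_asymptotics nu a b c km wm L dt 1 1) /\
  (asymp0 dt 1 -> ventcel_asymptotics nu a b c km wm L dt (Rpower 2 (- / 5)) (Rpower 2 (3 / 5))).
Proof.
  intros Hnu Hb Hkm Hwm _ HLdt HL.
  destruct (Aconst_spec nu a b c km wm Hnu Hb Hkm Hwm) as [HA4 _].
  set (A := Aconst nu a b c km wm) in *.
  assert (HA : 0 < A) by lra.
  destruct (asymp0_bounds L 1) as [l1 [l2 [Hl1 [Hl2 HLb]]]]; auto.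
  { intros h Hh. apply HLdt, Hh. }
  assert (HPI := PI_RGT_0).
  assert (HLlin : exists c2, at_right 0 (fun h => 0 < h /\ 0 < L h <= c2 * h)).
  { exists l2. eapply filter_imp; [|exact HLb]. cbv beta. intros h [Hh H].
    rewrite pow_1 in H. assert (0 < l1 * h) by (apply Rmult_lt_0_compat; lra). lra. }
  assert (Hkh : forall h, 0 < h -> l1 * h ^ 1 <= L h -> l1 * PI <= L h * (PI / h)).
  { intros h Hh H. rewrite pow_1 in H.
    replace (l1 * PI) with (l1 * h * (PI / h)) by (field; lra).
    apply Rmult_le_compat_r; [apply Rlt_le, Rdiv_lt_0_compat; lra|exact H]. }
  split; intros Hdt.
  - destruct (asymp0_bounds dt 2) as [d1 [d2 [Hd1 [Hd2 Hdb]]]]; auto.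
    { intros h Hh. apply Rlt_le, HLdt, Hh. }
    destruct (pinf_scaling nu A (1 + 1 * 1) 1) as [HP [HP5 Hpinf]]; try lra.
    set (P := Rpower _ _) in HP, HP5, Hpinf.
    apply (ventcel_asymptotics_of_scaling nu a b c km wm (l1 * l1 * PI / d2) (l1 * PI) 1 1 P);
      auto; try lra.
    + apply Rdiv_lt_0_compat; [|lra]. apply Rmult_lt_0_compat; [apply Rmult_lt_0_compat|]; lra.
    + apply Rmult_lt_0_compat; lra.
    + eapply filter_imp; [|apply filter_and; [exact HLb|exact Hdb]]. cbv beta.
      intros h [[Hh H1] [_ H2]]. split; [apply Hkh; tauto|]. split; [intros _|lra].
      destruct (HLdt h Hh) as [_ Hdt0]. rewrite pow_1 in H1.
      assert (Hl1h : 0 < l1 * h) by (apply Rmult_lt_0_compat; lra).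
      assert (HLL : l1 * h * (l1 * h) <= L h * L h) by (apply Rmult_le_compat; lra).
      replace (L h * L h * (PI / dt h)) with (L h * L h * PI / dt h) by (field; lra).
      apply (Rle_div_r _ _ _ Hdt0).
      apply Rle_trans with (l1 * l1 * PI / d2 * (d2 * h ^ 2)).
      * apply Rmult_le_compat_l; [|lra]. apply Rlt_le, Rdiv_lt_0_compat; [|lra].
        apply Rmult_lt_0_compat; [apply Rmult_lt_0_compat|]; lra.
      * replace (l1 * l1 * PI / d2 * (d2 * h ^ 2)) with (l1 * h * (l1 * h) * PI) by (field; lra).
        apply Rmult_le_compat_r; lra.
    + apply (qinf_scaling nu A (1 + 1 * 1) 1 P); auto; lra.
  - destruct (asymp0_bounds dt 1) as [d1 [d2 [Hd1 [Hd2 Hdb]]]]; auto.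
    { intros h Hh. apply Rlt_le, HLdt, Hh. }
    assert (H2p : Rpower 2 1 = 2) by (apply Rpower_1; lra).
    assert (Hcp : 0 < Rpower 2 (- / 5)) by apply exp_pos.
    assert (Hcq : 0 < Rpower 2 (3 / 5)) by apply exp_pos.
    assert (Ecp : 2 * Rpower 2 (- / 5) ^ 5 = 1 + 0 * 0).
    { rewrite Rpower_pow5. replace (5 * - / 5) with (- (1)) by field.
      rewrite Rpower_Ropp, H2p. field. }
    assert (Ecq : Rpower 2 (3 / 5) ^ 5 * (1 + 0 * 0) ^ 3 = 8).
    { rewrite Rpower_pow5. replace (5 * (3 / 5)) with (INR 3) by (simpl; field).
      rewrite Rpower_pow by lra. ring. }
    destruct (pinf_scaling nu A (1 + 0 * 0) (Rpower 2 (- / 5))) as [HP [HP5 Hpinf]]; auto; try lra.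
    set (P := Rpower (nu * _ * _ / _) _) in HP, HP5, Hpinf.
    apply (ventcel_asymptotics_of_scaling nu a b c km wm (l1 * PI / d2) (l1 * PI) (l2 * PI / d1) 0 P);
      auto; try lra; try (apply Rdiv_lt_0_compat; [apply Rmult_lt_0_compat|]; lra).
    + apply Rmult_lt_0_compat; lra.
    + eapply filter_imp; [|apply filter_and; [exact HLb|exact Hdb]]. cbv beta.
      intros h [[Hh H1] [_ H2]]. split; [apply Hkh; tauto|]. split; [lra|intros _].
      destruct (HLdt h Hh) as [_ Hdt0]. rewrite pow_1 in H1, H2.
      replace (L h * (PI / dt h)) with (L h * PI / dt h) by (field; lra).
      assert (Hl1h : 0 < l1 * h) by (apply Rmult_lt_0_compat; lra).
      split.
      * apply (Rle_div_r _ _ _ Hdt0). apply Rle_trans with (l1 * PI / d2 * (d2 * h)).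
        -- apply Rmult_le_compat_l; [|lra].
           apply Rlt_le, Rdiv_lt_0_compat; [apply Rmult_lt_0_compat|]; lra.
        -- replace (l1 * PI / d2 * (d2 * h)) with (l1 * h * PI) by (field; lra).
           apply Rmult_le_compat_r; lra.
      * apply (Rle_div_l _ _ _ Hdt0). apply Rle_trans with (l2 * PI / d1 * (d1 * h)).
        -- replace (l2 * PI / d1 * (d1 * h)) with (l2 * h * PI) by (field; lra).
           apply Rmult_le_compat_r; lra.
        -- apply Rmult_le_compat_l; [|lra].
           apply Rlt_le, Rdiv_lt_0_compat; [apply Rmult_lt_0_compat|]; lra.
    + apply (qinf_scaling nu A (1 + 0 * 0) (Rpower 2 (3 / 5)) P); auto; lra.
Qed.
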